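(* Let $\Bbbk$ be a field of characteristic $0$, $n$ a positive integer, and let $\cdots\to F_2\to F_1\to F_0\to S/\det_n^\perp\to0$ be the minimal graded free resolution of $S/\det_n^\perp$. There is an isomorphism of $G_{\det_n}$-representations $$F_2\cong\big((V_{(3)}\otimes W_{(2,1)})\oplus(V_{(2,1)}\otimes W_{(3)})\big)\otimes S.$$ In particular, the degree $3$ component of $F_2$ is isomorphic to the irreducible $G_{\det_n}$-representation $(V_{(3)}\otimes W_{(2,1)})\oplus(V_{(2,1)}\otimes W_{(3)})$.
   Context: Let $V\cong W\cong\Bbbk^n$, $M_n(\Bbbk)=V\otimes W$ with standard basis $X_{i,j}$, $S=\operatorname{Sym}^*M_n(\Bbbk)=\Bbbk[X_{i,j}]$, and $R=\Bbbk[x_{i,j}]$ the polynomial ring on the dual basis. $S$ acts on $R$ by identifying $X_{i,j}$ with $x_{i,j}^{-1}$: for monomials $g\in S$, $f\in R$, $g\star f=gf$ if this lies in $R$, and $0$ otherwise, extended bilinearly. With $\det_n\in R$ the determinant of the matrix $(x_{i,j})$, the apolar ideal is $\det_n^\perp=\{g\in S:g\star\det_n=0\}$. $G_{\det_n}=(\operatorname{GL}(V)\times\operatorname{GL}(W))/\Bbbk^*\rtimes\mathbb Z/2$, where $\Bbbk^*$ is embedded as pairs $(\alpha I_n,\alpha^{-1}I_n)$; $(A,B)$ acts on $M_n(\Bbbk)$ by $M\mapsto AMB^\top$ and the nontrivial element of $\mathbb Z/2$ by $M\mapsto M^\top$. This group preserves $\det_n$ up to scaling, so it acts on $S$ and on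 $\det_n^\perp$, and the minimal graded free resolution is naturally a resolution of $G_{\det_n}$-representations. A representation of $G_{\det_n}$ is the same as a $\operatorname{GL}(V)\times\operatorname{GL}(W)$-representation $Q$ on which $\Bbbk^*$ acts trivially, together with an involution $\iota:Q\to Q$ with $(g_1,g_2)\cdot\iota(q)=\iota((g_2,g_1)\cdot q)$. For a highest weight $\lambda:\lambda_1\ge\cdots\ge\lambda_n$ (trailing zeros are omitted in the notation), $V_\lambda$ (resp. $W_\lambda$) is the irreducible $\operatorname{GL}(V)$- (resp. $\operatorname{GL}(W)$-) representation of highest weight $\lambda$. For distinct highest weights $\lambda,\eta$ with $\lambda_1+\cdots+\lambda_n=\eta_1+\cdots+\eta_n$, $(V_\lambda\otimes W_\eta)\oplus(V_\eta\otimes W_\lambda)$ is a $G_{\det_n}$-representation with the involution interchanging the two summands. *)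

(* Defs.v *)
From HB Require Import structures.
From mathcomp Require Import all_boot all_order all_algebra.
From mathcomp Require Import mpoly.

Set Implicit Arguments.
Unset Strict Implicit.
Unset Printing Implicit Defensive.

Import GRing.Theory.
Local Open Scope ring_scope.

(* The variable attached to the position (i, j) is the one of index           *)
(* mxvec_index i j : 'I_(n * n).  The same type is used for S (variables      *)
(* X_ij) and for R (dual variables x_ij).                                     *)
Notation mxpolyring K n := {mpoly K[n * n]}.

Definition varmx (K : fieldType) (n : nat) : 'M[mxpolyring K n]_n :=
  \matrix_(i, j) 'X_(mxvec_index i j).

Definition cstmx (K : fieldType) (N m p : nat) (A : 'M[K]_(m, p)) :
  'M[{mpoly K[N]}]_(m, p) := map_mx (@mpolyC N K) A.

(* X_ij |-> M i j *)
Definition mxsubst (K : fieldType) (n : nat) (M : 'M[mxpolyring K n]_n)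
    (p : mxpolyring K n) : mxpolyring K n :=
  p \mPo [tuple mxvec M 0 t | t < n * n].

(** Apolarity *)

(* g * f for the contraction action X_ij = x_ij ^ -1. *)
Definition contract (K : fieldType) (N : nat) (g f : {mpoly K[N]}) :
  {mpoly K[N]} :=
  \sum_(m <- msupp g) \sum_(m' <- msupp f | (m <= m')%MM)
    (g@_m * f@_m') *: 'X_[(m' - m)%MM].

Definition in_det_perp (K : fieldType) (n : nat) (g : mxpolyring K n) : Prop :=
  contract g (\det (varmx K n)) = 0.

(** Representations of G_det: a representation of GL(V) x GL(W) on which the
    pairs (a I, a^-1 I) act trivially, with an involution invol such that
    g invol = invol g' where g' is g with its components exchanged.  The values
    of gl_act on non-invertible matrices are irrelevant. *)

Record gdet_action (K : fieldType) (n : nat) (U : Type) := GdetAction {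
  gl_act : 'M[K]_n -> 'M[K]_n -> U -> U;
  invol : U -> U
}.

Definition is_gdet_action (K : fieldType) (n : nat) (U : Type)
    (a : gdet_action K n U) : Prop :=
  [/\ forall u, gl_act a 1%:M 1%:M u = u,
      forall A B A' B' u,
        A \in unitmx -> B \in unitmx -> A' \in unitmx -> B' \in unitmx ->
        gl_act a (A *m A') (B *m B') u = gl_act a A B (gl_act a A' B' u),
      forall (c : K) u, c != 0 -> gl_act a c%:M (c^-1)%:M u = u,
      forall u, invol a (invol a u) = u
    & forall A B u, A \in unitmx -> B \in unitmx ->
        gl_act a A B (invol a u) = invol a (gl_act a B A u)].

Definition equivariant (K : fieldType) (n : nat) (U U' : Type)
    (a : gdet_action K n U) (a' : gdet_action K n U') (f : U -> U') : Prop :=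
  (forall A B u, A \in unitmx -> B \in unitmx ->
     f (gl_act a A B u) = gl_act a' A B (f u))
  /\ (forall u, f (invol a u) = invol a' (f u)).

Definition gdet_irreducible (K : fieldType) (n : nat) (U : vectType K)
    (a : gdet_action K n U) : Prop :=
  ({:U} != 0)%VS /\
  forall P : {vspace U},
    (forall A B u, A \in unitmx -> B \in unitmx ->
       u \in P -> gl_act a A B u \in P) ->
    (forall u, u \in P -> invol a u \in P) ->
    P = 0%VS \/ P = fullv.

(* M |-> A M B^T sends E_ij to \sum_(k, l) A k i * B l j *: E_kl, hence the
   generic matrix X to A^T X B. *)
Definition poly_action (K : fieldType) (n : nat) :
    gdet_action K n (mxpolyring K n) :=
  GdetAction
    (fun A B => mxsubst ((cstmx _ A)^T *m varmx K n *m cstmx _ B))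
    (mxsubst (varmx K n)^T).

(** Graded free modules and minimal graded free resolutions *)

(* p, seen in S(-a), is homogeneous of degree d. *)
Definition shift_homog (K : fieldType) (N a d : nat) (p : {mpoly K[N]}) : bool :=
  all (fun m => mdeg m + a == d)%N (msupp p).

(* The row module 'rV[S]_r graded as the direct sum of the S(-sh j). *)
Definition row_homog (K : fieldType) (N r : nat) (sh : 'I_r -> nat) (d : nat)
    (u : 'rV[{mpoly K[N]}]_r) : bool :=
  [forall j, shift_homog (sh j) d (u 0 j)].

(* F_i = 'rV[S]_(rk i); the map F_(i+1) -> F_i is right multiplication by
   bdry i.  The augmentation F_0 -> S / det^perp is given by a homogeneous lift
   F_0 -> S, namely right multiplication by aug. *)
Record min_resolution (K : fieldType) (n : nat) := MinResolution {
  rk : nat -> nat;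
  shift : forall i, 'I_(rk i) -> nat;
  bdry : forall i, 'M[mxpolyring K n]_(rk i.+1, rk i);
  aug : 'cV[mxpolyring K n]_(rk 0%N);
  bdry_homog : forall i d u,
    row_homog (@shift i.+1) d u -> row_homog (@shift i) d (u *m bdry i);
  aug_homog : forall d u,
    row_homog (@shift 0%N) d u -> (u *m aug) 0 0 \is d.-homog;
  aug_surj : forall p, exists u : 'rV_(rk 0%N),
    in_det_perp (p - (u *m aug) 0 0);
  exact_aug : forall u : 'rV_(rk 0%N),
    in_det_perp ((u *m aug) 0 0) <-> exists v, u = v *m bdry 0%N;
  exact_bdry : forall i (u : 'rV_(rk i.+1)),
    u *m bdry i = 0 <-> exists v, u = v *m bdry i.+1;
  bdry_minimal : forall i j k, (bdry i j k)@_0%MM = 0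
}.

Notation resmod F i := 'rV[mxpolyring _ _]_(rk F i).

(* Actions of G_det on all the F_i making F a resolution of S / det^perp by
   graded G_det-equivariant S-modules. *)
Record equivariant_structure (K : fieldType) (n : nat) (F : min_resolution K n)
    (a : forall i, gdet_action K n (resmod F i)) : Prop :=
  EquivariantStructure {
  eqv_action : forall i, is_gdet_action (a i);
  eqv_gl_semilinear : forall i A B s u v, A \in unitmx -> B \in unitmx ->
    gl_act (a i) A B (s *: u + v)
    = gl_act (poly_action K n) A B s *: gl_act (a i) A B u
      + gl_act (a i) A B v;
  eqv_invol_semilinear : forall i s u v,
    invol (a i) (s *: u + v)
    = invol (poly_action K n) s *: invol (a i) u + invol (a i) v;
  eqv_gl_homog : forall i A B d u, A \in unitmx -> B \in unitmx ->
    row_homog (@shift _ _ F i) d u ->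
    row_homog (@shift _ _ F i) d (gl_act (a i) A B u);
  eqv_invol_homog : forall i d u,
    row_homog (@shift _ _ F i) d u ->
    row_homog (@shift _ _ F i) d (invol (a i) u);
  eqv_bdry : forall i, equivariant (a i.+1) (a i) (fun u => u *m bdry F i);
  eqv_aug_gl : forall A B u, A \in unitmx -> B \in unitmx ->
    in_det_perp ((gl_act (a 0%N) A B u *m aug F) 0 0
                 - gl_act (poly_action K n) A B ((u *m aug F) 0 0));
  eqv_aug_invol : forall u,
    in_det_perp ((invol (a 0%N) u *m aug F) 0 0
                 - invol (poly_action K n) ((u *m aug F) 0 0))
}.

(** Irreducible representations of GL_n *)

(* rho A acts on 'cV[K]_d by left multiplication; its matrix coefficients are
   regular functions on GL_n, i.e. polynomials divided by a power of det. *)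
Definition is_gl_rep (K : fieldType) (n d : nat) (rho : 'M[K]_n -> 'M[K]_d) :
  Prop :=
  [/\ rho 1%:M = 1%:M,
      forall A B, A \in unitmx -> B \in unitmx ->
        rho (A *m B) = rho A *m rho B
    & exists (e : nat) (P : 'M[mxpolyring K n]_d),
      forall A, A \in unitmx ->
        \det A ^+ e *: rho A = \matrix_(i, j) (P i j).@[mxvec A 0]].

Definition gl_irreducible (K : fieldType) (n d : nat)
    (rho : 'M[K]_n -> 'M[K]_d) : Prop :=
  (0 < d)%N /\
  forall P : {vspace 'cV[K]_d},
    (forall A u, A \in unitmx -> u \in P -> rho A *m u \in P) ->
    P = 0%VS \/ P = fullv.

(* A highest weight vector is an eigenvector of weight lambda for the group of
   invertible upper triangular matrices. *)
Definition has_highest_weight (K : fieldType) (n d : nat)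
    (rho : 'M[K]_n -> 'M[K]_d) (lambda : seq nat) : Prop :=
  exists2 v : 'cV[K]_d, v != 0 &
    forall B : 'M[K]_n, B \in unitmx -> (forall i j : 'I_n, (j < i)%N -> B i j = 0) ->
      rho B *m v = (\prod_(i < n) B i i ^+ nth 0%N lambda i) *: v.

(* rho is (a matrix form of) V_lambda, for a partition lambda without trailing
   zeros; V_lambda = 0 if lambda has more than n parts. *)
Definition is_V (K : fieldType) (n d : nat) (lambda : seq nat)
    (rho : 'M[K]_n -> 'M[K]_d) : Prop :=
  if (size lambda <= n)%N
  then [/\ is_gl_rep rho, gl_irreducible rho & has_highest_weight rho lambda]
  else d = 0%N.

(* An element of V_lambda (x) W_eta is a d x e matrix M, with
   (A, B) M = rho A M (sigma B)^T. *)
Notation swapmod T d e := ('M[T]_(d, e) * 'M[T]_(e, d))%type.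

(* (V_lambda (x) W_eta) (+) (V_eta (x) W_lambda) *)
Definition swap_action (K : fieldType) (n d e : nat)
    (rho : 'M[K]_n -> 'M[K]_d) (sigma : 'M[K]_n -> 'M[K]_e) :
    gdet_action K n (swapmod K d e) :=
  GdetAction
    (fun A B q => (rho A *m q.1 *m (sigma B)^T, sigma A *m q.2 *m (rho B)^T))
    (fun q => (q.2^T, q.1^T)).

(* The previous representation tensored with S: matrices with entries in S. *)
Definition swap_action_poly (K : fieldType) (n d e : nat)
    (rho : 'M[K]_n -> 'M[K]_d) (sigma : 'M[K]_n -> 'M[K]_e) :
    gdet_action K n (swapmod (mxpolyring K n) d e) :=
  GdetAction
    (fun A B q =>
       (cstmx _ (rho A) *m map_mx (gl_act (poly_action K n) A B) q.1
          *m (cstmx _ (sigma B))^T,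
        cstmx _ (sigma A) *m map_mx (gl_act (poly_action K n) A B) q.2
          *m (cstmx _ (rho B))^T))
    (fun q => ((map_mx (invol (poly_action K n)) q.2)^T,
               (map_mx (invol (poly_action K n)) q.1)^T)).

(* Grading on Q (x) S with Q placed in degree a. *)
Definition swap_homog (K : fieldType) (N d e a k : nat)
    (q : swapmod {mpoly K[N]} d e) : bool :=
  [forall i, forall j, shift_homog a k (q.1 i j)]
  && [forall i, forall j, shift_homog a k (q.2 i j)].

(* Main.v *)
(** The apolar ideal is generated by the 2 x 2 permanents [X_ij X_kl + X_il X_kj]: modulo these a
    polynomial is a combination of the squarefree monomials attached to pairs of subsets of rows
    and columns, and such monomials pair independently with the monomials of the determinant.

    The syzygies of the permanents are generated by the linear ones. Write a syzygy of degree D as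
    a combination [z] of words (a word of rows and a word of columns of length D, with two marked
    positions). Applying the Hessian [f |-> \sum_ab d_a d_b f * (generator ab)] to its image, which
    is zero, gives, up to linear syzygies and Koszul relations, [T z] where [T] is the sum of
    [1 + u] over all transpositions [u] of the word of rows; the Koszul relations are themselves
    linear combinations of linear syzygies. As [T] is symmetric over the integers, it is invertible
    modulo its kernel, the kernel consists of alternating words, and alternating combinations
    vanish because the generators are symmetric. So [z] comes from linear syzygies, and by
    Nakayama's lemma F_1 and F_2 sit in degrees 2 and 3.

    The linear syzygies are the tensors [t] with two triples of indices, symmetric in the first two
    indices of each triple and with zero sum over the simultaneous rotations of the two triples.
    These split as Sym^3 (x) M + M (x) Sym^3, where M is the space of mixed tensors, on which the
    sum over rotations is zero. For a representation with a given highest weight, the function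
    [A |-> l (rho A v)], where [v] is a highest weight vector, is determined on the dense set of
    matrices with an LU decomposition; it equals [A_11 ^ 3], respectively
    [A_11 (A_11 A_22 - A_12 A_21)], and its translates identify V_(3) with Sym^3 and V_(2,1) with M.
    Minimality makes constant vectors of F_1 and F_2 determined by their boundaries, so that every
    lift of the group action acts on linear syzygies by the expected formula.

    For irreducibility, the third finite difference of [k |-> rho (diag (k, 1, ..., 1))] projects
    V_(3) onto a line and kills V_(2,1), so an invariant subspace contains a pure tensor. *)

Require Import Defs.
From HB Require Import structures.
From mathcomp Require Import all_boot all_order all_fingroup all_algebra.
From mathcomp Require Import ring zify.
From mathcomp Require Import mpoly.
From Stdlib Require Import Classical.

Set Implicit Arguments.
Unset Strict Implicit.
Unset Printing Implicit Defensive.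

Import GRing.Theory Num.Theory.
Local Open Scope ring_scope.

(** The Hessian imitates Euler's formula: on the monomial of a word it returns the sum of all ways
    to mark two letters. It therefore inverts the map to the ideal not up to a scalar but up to the
    operator [T], which is singular. Over [K] symmetry alone says little, since a symmetric matrix
    over a field such as the complex numbers may be nilpotent. Positivity of sums of squares is
    available over the integers, and what is carried to [K] is the identity [T q(T) = 0] with [q(0)]
    nonzero.

    The representations V_(3) and V_(2,1) are given only by irreducibility and a highest weight
    vector, so their tensor models have to be found. A functional that detects the highest weight
    line turns matrix coefficients into explicit polynomials on the group, and polarising the
    translates of these polynomials yields the tensor coordinates.

    For [n = 1] the representation V_(2,1) and the module F_2 are both zero, so the isomorphism
    persists while irreducibility is claimed for [1 < n] only. *)

Section CharZero.

Variable (K : fieldType) (charK : [pchar K] =i pred0).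

Lemma natf_neq0_char0 (n : nat) : (n.+1%:R != 0 :> K).
Proof. by move/pcharf0P: charK => ->. Qed.

Lemma intf_eq0_char0 (z : int) : (z%:~R == 0 :> K) = (z == 0).
Proof.
case: z => m; first by move/pcharf0P: charK => /(_ m).
by rewrite NegzE mulrNz oppr_eq0 (negbTE (natf_neq0_char0 m)) oppr_eq0.
Qed.

End CharZero.

(* The sum of squares [x^T x] detects zero, so a symmetric integer matrix has
   no nilpotent part. *)
Lemma int_gram_eq0 (m p : nat) (y : 'M[int]_(m, p)) : y^T *m y = 0 -> y = 0.
Proof.
move=> h; apply/matrixP => i j; rewrite mxE.
have /matrixP/(_ j j) := h; rewrite !mxE => /eqP.
have hk (k : 'I_m) : y^T j k * y k j = (y k j) ^+ 2 by rewrite mxE expr2.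
rewrite (eq_bigr _ (fun k _ => hk k)) psumr_eq0; last by move=> k _; rewrite sqr_ge0.
by move/allP/(_ i (mem_index_enum _)); rewrite /= sqrf_eq0 => /eqP.
Qed.

Lemma int_sym_nilp (m p k : nat) (T : 'M[int]_m.+1) (y : 'M[int]_(m.+1, p)) :
  T^T = T -> T ^+ k *m y = 0 -> T *m y = 0.
Proof.
move=> symT; elim: k => [|[|k] IHk]; first by rewrite expr0 mul1mx => ->; rewrite mulmx0.
  by rewrite expr1.
move=> h; apply: IHk; apply: int_gram_eq0.
have symk j : (T ^+ j)^T = T ^+ j.
  elim: j => [|j IHj]; first by rewrite !expr0 trmx1.
  by rewrite {1}exprSr trmx_mul symT IHj exprS.
rewrite trmx_mul symk -mulmxA [T ^+ k.+1 *m (_ *m _)]mulmxA.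
have -> : T ^+ k.+1 *m T ^+ k.+1 = T ^+ k *m T ^+ k.+2.
  by rewrite !mulmxE -!exprD addSnnS.
by rewrite -mulmxA h mulmx0 mulmx0.
Qed.

(** Write the characteristic polynomial as [q X^k] with [q(0)] nonzero. Cayley-Hamilton gives
    [T^k q(T) = 0], and the absence of nilpotents replaces [k] by 1. *)
Lemma int_sym_fitting (m : nat) (T : 'M[int]_m.+1) : T^T = T ->
  exists2 q : {poly int}, q.[0] != 0 & T *m horner_mx T q = 0.
Proof.
move=> symT.
have chi0 := char_poly_monic T.
have [k [q + chiE]] := multiplicity_XsubC (char_poly T) 0.
rewrite monic_neq0 //= => q0; exists q => //.
apply: (@int_sym_nilp _ _ k) => //.
have := Cayley_Hamilton T; rewrite chiE subr0 rmorphM rmorphXn /= horner_mx_X.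
have -> : horner_mx T q * T ^+ k = T ^+ k * horner_mx T q; last by [].
by apply: commrX; apply: comm_horner_mx.
Qed.

(** * The sum of the transpositions of a word *)

Section Words.

Variables (d n : nat).

Local Notation word := {ffun 'I_d -> 'I_n}.

Definition wact (r : word) (s : 'S_d) : word := [ffun i => r (s i)].

Lemma wact1 r : wact r 1%g = r.
Proof. by apply/ffunP => i; rewrite ffunE perm1. Qed.

Lemma wactM r s t : wact (wact r s) t = wact r (t * s)%g.
Proof. by apply/ffunP => i; rewrite !ffunE permM. Qed.

Lemma wact_tpermK i j : involutive (wact^~ (tperm i j)).
Proof. by move=> r; rewrite wactM tperm2 wact1. Qed.

(** Each transposition is counted twice, once for each order of [i] and [j], in agreement with the
    second derivatives that produce this operator. *)
Definition transp_sum (R : pzRingType) (V : lmodType R) (phi : word -> V) (r : word) : V :=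
  \sum_(i < d) \sum_(j < d | i != j) (phi r + phi (wact r (tperm i j))).

Local Notation W := #|{: word}|.

Definition transp_mx (R : pzRingType) : 'M[R]_W :=
  \matrix_(k, l) \sum_(i < d) \sum_(j < d | i != j)
    ((k == l)%:R + (wact (enum_val k) (tperm i j) == enum_val l)%:R).

Lemma transp_mx_tr (R : pzRingType) : (transp_mx R)^T = transp_mx R.
Proof.
apply/matrixP => k l; rewrite !mxE; apply: eq_bigr => i _; apply: eq_bigr => j _.
rewrite [l == k]eq_sym; congr (_ + _%:R).
by rewrite -(inj_eq (inv_inj (wact_tpermK i j))) wact_tpermK eq_sym.
Qed.

Lemma transp_mx_map (R : pzRingType) : map_mx intr (transp_mx int) = transp_mx R.
Proof.
apply/matrixP => k l; rewrite !mxE rmorph_sum; apply: eq_bigr => i _.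
rewrite rmorph_sum; apply: eq_bigr => j _ /=.
by rewrite rmorphD /= !rmorph_nat.
Qed.

Lemma transp_mxE (R : pzRingType) (V : lmodType R) (phi : word -> V) (k : 'I_W) :
  \sum_l transp_mx R k l *: phi (enum_val l) = transp_sum phi (enum_val k).
Proof.
under eq_bigr => l _ do rewrite mxE scaler_suml.
rewrite exchange_big; apply: eq_bigr => i _.
under eq_bigr => l _ do rewrite scaler_suml.
rewrite exchange_big; apply: eq_bigr => j _.
under eq_bigr => l _ do rewrite scalerDl.
rewrite big_split /=; congr (_ + _).
  rewrite (bigD1 k) //= eqxx scale1r big1 ?addr0 // => l /negbTE.
  by rewrite eq_sym => ->; rewrite scale0r.
rewrite (bigD1 (enum_rank (wact (enum_val k) (tperm i j)))) //= enum_rankK eqxx scale1r.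
rewrite big1 ?addr0 // => l ne; case: eqP => [e|_]; last by rewrite scale0r.
by rewrite e enum_valK eqxx in ne.
Qed.

(** Reindexing by the involution [u] gives that the sum over [r] of [2 x(r) (x(r) + x(ru))] equals
    the sum of [(x(r) + x(ru))^2]. So the quadratic form of [T] is half a sum of squares, and on the
    kernel every square vanishes. *)
Lemma int_transp_ker (x : word -> int) :
  (forall r, transp_sum (x : word -> int^o) r = 0) ->
  forall i j r, i != j -> x (wact r (tperm i j)) = - x r.
Proof.
move=> h.
have sq (i j : 'I_d) : \sum_r (x r * (x r + x (wact r (tperm i j)))) *+ 2 =
    \sum_r (x r + x (wact r (tperm i j))) ^+ 2.
  have reidx (f : word -> int) : \sum_r f r = \sum_r f (wact r (tperm i j)).
    by rewrite (reindex_inj (inv_inj (wact_tpermK i j))).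
  under eq_bigr => r _ do rewrite mulr2n.
  rewrite big_split /= [X in _ + X]reidx -big_split /=.
  by apply: eq_bigr => r _; rewrite wact_tpermK; ring.
have tot : \sum_i \sum_(j | i != j) \sum_r (x r + x (wact r (tperm i j))) ^+ 2 = 0.
  under eq_bigr => i _ do under eq_bigr => j _ do rewrite -sq.
  under eq_bigr => i _ do rewrite exchange_big /=.
  rewrite exchange_big big1 // => r _.
  under eq_bigr => i _ do rewrite sumrMnl -mulr_sumr.
  by rewrite sumrMnl -mulr_sumr -[X in x r * X]/(transp_sum (x : word -> int^o) r) h mulr0 mul0rn.
move=> i j r ij; apply/eqP; rewrite -addr_eq0 addrC -sqrf_eq0.
move/eqP: tot; rewrite psumr_eq0; last first.
  by move=> k _; apply: sumr_ge0 => l _; apply: sumr_ge0 => s _; apply: sqr_ge0.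
move/allP/(_ i (mem_index_enum _)); rewrite implyTb psumr_eq0; last first.
  by move=> l _; apply: sumr_ge0 => s _; apply: sqr_ge0.
move/allP/(_ j (mem_index_enum _)); rewrite ij implyTb psumr_eq0; last first.
  by move=> s _; apply: sqr_ge0.
by move/allP/(_ r (mem_index_enum _)).
Qed.

Hypothesis W_gt0 : (0 < W)%N.

(* As [T] is symmetric over the integers, [T *m q(T) = 0] for some [q] with [q(0) != 0];
   then the rows of [q(T)] are alternating. *)
Lemma transp_descent (K : fieldType) (charK : [pchar K] =i pred0) (p : nat)
    (Z : 'M[K]_(p, W) -> Prop) :
  (forall c a b, Z a -> Z b -> Z (c *: a + b)) ->
  (forall a, Z a -> Z (a *m transp_mx K)) ->
  (forall a : 'M[K]_(p, W),
     (forall k i j r, i != j ->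
        a k (enum_rank (wact r (tperm i j))) = - a k (enum_rank r)) -> Z a) ->
  forall a, Z (a *m transp_mx K) -> Z a.
Proof.
move=> Zlin ZT Zalt.
(* Matrices form a ring only in a size written as a successor, so everything is transported along
   [Wm] before polynomials in [T] are formed. *)
have [m Wm] : {m | W = m.+1} by exists W.-1; rewrite prednK.
pose cst q (B : 'M[K]_(q, W)) := castmx (erefl q, Wm) B.
have [TZ [TZsym TZalt [TK [TKE TKmap]]]] : exists TZ : 'M[int]_m.+1, [/\ TZ^T = TZ,
    (forall y : 'cV_m.+1, TZ *m y = 0 -> forall i j r, i != j ->
       y (cast_ord Wm (enum_rank (wact r (tperm i j)))) 0 = - y (cast_ord Wm (enum_rank r)) 0) &
    exists TK : 'M[K]_m.+1, (forall p (a : 'M_(p, W)), cst _ (a *m transp_mx K) = cst _ a *m TK)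
      /\ TK = map_mx intr TZ].
  have [TZ0 s0] : {T : 'M[int]_W | T = transp_mx int} by exists (transp_mx int).
  have [TK0 s1] : {T : 'M[K]_W | T = transp_mx K} by exists (transp_mx K).
  exists (castmx (Wm, Wm) TZ0); split.
  - by apply/matrixP => i j; rewrite mxE !castmxE /= s0 -{1}transp_mx_tr mxE.
  - move=> y Ty i j r ij.
    pose x r := y (cast_ord Wm (enum_rank r)) 0.
    apply: (@int_transp_ker x) => // r'.
    have := congr1 (fun M : 'cV_m.+1 => M (cast_ord Wm (enum_rank r')) 0) Ty.
    rewrite !mxE => e.
    have {e} : \sum_l transp_mx int (enum_rank r') l *: (x (enum_val l) : int^o) = 0.
      rewrite -[RHS]e (reindex (cast_ord Wm)) /=.
        by apply: eq_bigr => l _; rewrite castmxE !cast_ordK s0 /x enum_valK.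
      by exists (cast_ord (esym Wm)) => z _; rewrite ?cast_ordK ?cast_ordKV.
    by rewrite (@transp_mxE int int^o (x : word -> int^o)) enum_rankK.
  - exists (castmx (Wm, Wm) TK0); split.
      move=> q a; rewrite /cst -s1; apply/matrixP => i j; rewrite castmxE !mxE.
      rewrite [RHS](reindex (cast_ord Wm)) /=.
        by apply: eq_bigr => l _; rewrite !castmxE /= !cast_ordK.
      by exists (cast_ord (esym Wm)) => z _; rewrite ?cast_ordK ?cast_ordKV.
    by apply/matrixP => i j; rewrite mxE !castmxE /= s0 s1 -(transp_mx_map K) mxE.
have [q q0 Tq] := int_sym_fitting TZsym.
pose qK := map_poly (intr : int -> K) q.
have qKT : horner_mx TK qK = map_mx intr (horner_mx TZ q).
  by rewrite TKmap map_horner_mx.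
pose uncst (B : 'M[K]_(p, m.+1)) := castmx (erefl p, esym Wm) B.
have cstK a : uncst (cst _ a) = a by apply/matrixP => i j; rewrite !castmxE; congr (a _ _); apply: val_inj.
have ucstK a : cst _ (uncst a) = a by apply/matrixP => i j; rewrite !castmxE; congr (a _ _); apply: val_inj.
have ZhT r b : Z (uncst b) -> Z (uncst (b *m horner_mx TK r)).
  have uL c x y : uncst (c *: x + y) = c *: uncst x + uncst y.
    by apply/matrixP => i j; rewrite !(castmxE, mxE).
  have Z0 x : Z x -> Z 0 by move=> Zx; rewrite -(subrr x) -scaleN1r addrC; apply: Zlin.
  elim/poly_ind: r b => [|r c IHr] b Zb.
    rewrite rmorph0 mulmx0; have -> : uncst 0 = 0 by apply/matrixP => i j; rewrite castmxE !mxE.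
    exact: Z0 Zb.
  rewrite rmorphD rmorphM /= horner_mx_X horner_mx_C mulmxDr mul_mx_scalar addrC uL.
  apply: Zlin => //; rewrite mulmxA.
  have -> : uncst (b *m horner_mx TK r *m TK) = uncst (b *m horner_mx TK r) *m transp_mx K.
    by rewrite -[RHS]cstK TKE ucstK.
  exact/ZT/IHr.
move=> a ZaT.
(* With [q = q' X + q(0)], one has [q(0) a = a q(T) - (a T) q'(T)]. The first term has alternating
   rows, the second lies in [Z] because [a T] does. *)
have [q' qE] : exists q', qK = q' * 'X + (qK.[0])%:P.
  have : root (qK - (qK.[0])%:P) 0 by rewrite rootE !hornerE subrr.
  by case/factor_theorem => q' e; exists q'; rewrite subr0 in e; rewrite -e subrK.
have qK0 : qK.[0] = (q.[0])%:~R by rewrite -(rmorph0 intr) horner_map.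
have qK0n : qK.[0] != 0 by rewrite qK0 intf_eq0_char0.
have Zq : Z (uncst (cst _ a *m horner_mx TK qK)).
  apply: Zalt => k i j r ij; rewrite qKT !castmxE !mxE -sumrN; apply: eq_bigr => l _.
  rewrite -mulrN; congr (_ * _); rewrite !mxE /=.
  (* [T q(T) = 0] makes the columns of [q(T)] alternating; by symmetry so are its rows. *)
  have symq : (horner_mx TZ q)^T = horner_mx TZ q.
    elim/poly_ind: (q) => [|s c IHs]; first by rewrite rmorph0 trmx0.
    rewrite rmorphD rmorphM /= horner_mx_X horner_mx_C linearD /= tr_scalar_mx.
    rewrite trmx_mul IHs TZsym; congr (_ + _); symmetry.
    by apply: comm_horner_mx.
  have Tc : TZ *m col l (horner_mx TZ q) = 0.
    by rewrite colE mulmxA Tq mul0mx.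
  have HS u v : horner_mx TZ q u v = horner_mx TZ q v u by rewrite -{1}symq mxE.
  have := TZalt _ Tc i j r ij; rewrite !mxE !(HS l) => e.
  have castW t : cast_ord (esym (esym Wm)) t = cast_ord Wm t by apply: val_inj.
  by rewrite !castW e rmorphN.
have ZTq' : Z (uncst (cst _ a *m horner_mx TK (q' * 'X))).
  rewrite mulrC rmorphM /= horner_mx_X mulmxA; apply: ZhT.
  by rewrite -TKE cstK.
have -> : a = (qK.[0])^-1 *: (-1 *: uncst (cst _ a *m horner_mx TK (q' * 'X)) +
                               uncst (cst _ a *m horner_mx TK qK)) + 0.
  rewrite addr0 [X in _ *: (_ + uncst (_ *m horner_mx _ X))]qE.
  rewrite rmorphD /= horner_mx_C mulmxDr mul_mx_scalar.
  set A := _ *m _; have -> : uncst (A + qK.[0] *: cst _ a) = uncst A + qK.[0] *: a.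
    by apply/matrixP => i j; rewrite !(castmxE, mxE) !cast_ordKV; congr (_ + _ * a _ _); apply: val_inj.
  by rewrite addrA scaleN1r addNr add0r scalerA mulVf ?scale1r.
have Z0 : Z 0 by rewrite -(subrr (uncst (cst _ a *m horner_mx TK qK))) -scaleN1r addrC; apply: (Zlin).
by apply: (Zlin) => //; apply: (Zlin).
Qed.

End Words.

(** * Generators of the apolar ideal *)

Section Pairing.

Variables (K : fieldType) (N : nat).
Implicit Types (f g : {mpoly K[N]}) (m k : 'X_{1..N}).

Lemma sum_msupp_ext (phi : 'X_{1..N} -> K) g (r : seq 'X_{1..N}) :
  uniq r -> {subset msupp g <= r} ->
  \sum_(m <- msupp g) g@_m * phi m = \sum_(m <- r) g@_m * phi m.
Proof.
move=> ur sub; rewrite [RHS](bigID (mem (msupp g))) /= [X in _ + X]big1 ?addr0.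
  rewrite -[in RHS]big_filter; apply: perm_big; apply: uniq_perm.
  - exact: msupp_uniq.
  - exact: filter_uniq.
  by move=> m; rewrite mem_filter /=; case: (boolP (m \in _)) => // /sub.
by move=> m /memN_msupp_eq0 ->; rewrite mul0r.
Qed.

(* The coefficient of [x^k] in the contraction of [f] by [g]. *)
Definition pairing f k g := \sum_(m <- msupp g) g@_m * f@_(m + k).

Lemma pairing_is_linear f k : linear (pairing f k : {mpoly K[N]} -> K^o).
Proof.
move=> c g h.
pose r := undup (msupp g ++ msupp h ++ msupp (c *: g + h)).
have ur : uniq r by apply: undup_uniq.
rewrite /pairing !(@sum_msupp_ext (fun m => f@_(m + k)) _ r) //.
- rewrite scaler_sumr -big_split /=; apply: eq_bigr => m _.
  by rewrite mcoeffD mcoeffZ mulrDl -mulrA.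
- by move=> m; rewrite mem_undup !mem_cat => ->; rewrite !orbT.
- by move=> m; rewrite mem_undup !mem_cat => ->.
- by move=> m; rewrite mem_undup !mem_cat => ->; rewrite !orbT.
Qed.

HB.instance Definition _ f k :=
  GRing.isLinear.Build K {mpoly K[N]} K^o _ (pairing f k) (pairing_is_linear f k).

Lemma pairingD f k g h : pairing f k (g + h) = pairing f k g + pairing f k h.
Proof. exact: (linearD (pairing f k : {linear _ -> K^o})). Qed.

Lemma pairing0 f k : pairing f k 0 = 0.
Proof. exact: (linear0 (pairing f k : {linear _ -> K^o})). Qed.

Lemma pairingZ f k c g : pairing f k (c *: g) = c * pairing f k g.
Proof. by have := pairing_is_linear f k c g 0; rewrite addr0 pairing0 addr0. Qed.

Lemma pairing_sum f k (I : Type) (r : seq I) (P : pred I) (G : I -> {mpoly K[N]}) :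
  pairing f k (\sum_(i <- r | P i) G i) = \sum_(i <- r | P i) pairing f k (G i).
Proof. exact: (linear_sum (pairing f k : {linear _ -> K^o})). Qed.

Lemma pairingX f k m : pairing f k 'X_[m] = f@_(m + k).
Proof. by rewrite /pairing msuppX big_seq1 mcoeffX eqxx mul1r. Qed.

Lemma pairingMX f k m g : pairing f k ('X_[m] * g) = pairing f (m + k) g.
Proof.
rewrite [g]mpolyE mulr_sumr !pairing_sum; apply: eq_bigr => m' _.
rewrite -scalerAr !pairingZ -mpolyXD !pairingX.
by rewrite addmA [(m' + m)%MM]addmC.
Qed.

Lemma contract_coeff g f k : (contract g f)@_k = pairing f k g.
Proof.
rewrite /contract /pairing raddf_sum; apply: eq_bigr => m _.
rewrite raddf_sum /=.
under eq_bigr => m' _ do rewrite mcoeffZ mcoeffX.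
have key m' : (m <= m')%MM -> ((m' - m)%MM == k) = (m' == (m + k)%MM).
  move=> le; apply/eqP/eqP => [<-|->]; first by rewrite addmC submK.
  by rewrite addmC addmK.
case: (boolP ((m + k)%MM \in msupp f)) => h; last first.
  rewrite (memN_msupp_eq0 h) mulr0 big1_seq // => m' /andP[le m'f].
  rewrite key //; case: eqP => [e|_]; last by rewrite mulr0.
  by rewrite -e m'f in h.
have le : (m <= m + k)%MM by apply: lem_addr.
rewrite big_mkcond (bigD1_seq (m + k)%MM) ?msupp_uniq //= le.
rewrite [X in _ + X]big1 ?addr0.
  by rewrite [(m + k)%MM]addmC addmK eqxx mulr1.
move=> m' /negbTE ne; case: ifP => // le'.
by rewrite key // ne mulr0.
Qed.

End Pairing.

(** * The apolar ideal of the determinant: permanents and normal forms modulo them *)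

Section DetPerp.

Variables (K : fieldType) (n : nat).
Local Notation S := (mxpolyring K n).
Local Notation I2 := ('I_n * 'I_n)%type.
Local Notation idx i j := (@mxvec_index n n i j).
Local Notation X i j := ('X_(idx i j) : S).
Local Notation DET := (\det (varmx K n)).

Lemma idx_inj i j k l : idx i j = idx k l -> i = k /\ j = l.
Proof.
move=> e; have [g gK _] := curry_mxvec_bij n n.
have h1 := gK (i, j) isT; have h2 := gK (k, l) isT.
by rewrite /= e in h1; rewrite /= h1 in h2; case: h2 => -> ->.
Qed.

Lemma eq_idx i j k l : (idx i j == idx k l) = (i == k) && (j == l).
Proof.
by apply/eqP/andP => [/idx_inj[-> ->]|[/eqP-> /eqP->]].
Qed.

Lemma in_det_perpP (g : S) : in_det_perp g <-> forall k, pairing DET k g = 0.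
Proof.
split=> [h k|h]; first by rewrite -contract_coeff h mcoeff0.
by apply/mpolyP => k; rewrite contract_coeff h mcoeff0.
Qed.

Lemma in_det_perp_lin (c g h : S) : in_det_perp g -> in_det_perp h ->
  in_det_perp (c * g + h).
Proof.
move=> /in_det_perpP hg /in_det_perpP hh; apply/in_det_perpP => k.
rewrite pairingD hh addr0 [c]mpolyE mulr_suml pairing_sum big1 // => m _.
by rewrite -scalerAl pairingZ pairingMX hg mulr0.
Qed.

Lemma in_det_perp0 : in_det_perp (0 : S).
Proof. by apply/in_det_perpP => k; rewrite pairing0. Qed.

Lemma in_det_perpM (c g : S) : in_det_perp g -> in_det_perp (c * g).
Proof. by move=> h; rewrite -[_ * _]addr0; apply: in_det_perp_lin => //; apply: in_det_perp0. Qed.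

Lemma in_det_perpD (g h : S) : in_det_perp g -> in_det_perp h -> in_det_perp (g + h).
Proof. by move=> ? ?; rewrite -[g]mul1r; apply: in_det_perp_lin. Qed.

Definition perm_mnm (s : 'S_n) : 'X_{1..n * n} := (\sum_i U_(idx i (s i)))%MM.

Lemma det_coeff m : DET@_m = \sum_(s : 'S_n) (-1) ^+ s * (perm_mnm s == m)%:R.
Proof.
rewrite /determinant raddf_sum; apply: eq_bigr => s _ /=.
rewrite -signr_odd; have -> (b : bool) (f : S) : (-1) ^+ b * f = (-1) ^+ b *: f.
  by case: b; rewrite ?expr1 ?expr0 ?mul1r ?scale1r // mulN1r scaleN1r.
rewrite mcoeffZ signr_odd; congr (_ * _).
rewrite (eq_bigr (fun i => 'X_(idx i (s i)))); last by move=> i _; rewrite mxE.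
by rewrite mprodXE mcoeffX // /perm_mnm.
Qed.

Lemma perm_mnmE s i j : perm_mnm s (idx i j) = (s i == j).
Proof.
rewrite /perm_mnm mnm_sumE (bigD1 i) //= mnm1E eq_idx eqxx /= big1 ?addn0 // => k ne.
by rewrite mnm1E eq_idx (negbTE ne).
Qed.

Lemma perm_mnm_inj : injective perm_mnm.
Proof.
move=> s t e; apply/permP => i; have := perm_mnmE s i (s i).
by rewrite e perm_mnmE eqxx; case: eqP.
Qed.

Lemma perm_mnm_swap (s : 'S_n) i k : i != k ->
  (perm_mnm (tperm i k * s)%g + (U_(idx i (s i)) + U_(idx k (s k)))
   = perm_mnm s + (U_(idx i (s k)) + U_(idx k (s i))))%MM.
Proof.
move=> ik; rewrite /perm_mnm.
rewrite (bigD1 i) //= (bigD1 k) 1?eq_sym //= [Y in _ = (Y + _)%MM](bigD1 i) //=.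
rewrite [Y in _ = (_ + Y + _)%MM](bigD1 k) 1?eq_sym //=.
have -> : (\sum_(t < n | (t != i) && (t != k)) U_(idx t ((tperm i k * s)%g t)) =
          \sum_(t < n | (t != i) && (t != k)) U_(idx t (s t)))%MM.
  by apply: eq_bigr => t /andP[ti tk]; rewrite permM tpermD // eq_sym.
rewrite !permM tpermL tpermR.
apply/mnmP => t; rewrite !mnmDE; ring.
Qed.

Lemma det_coeff_swap i k j l m :
  DET@_(U_(idx i j) + U_(idx k l) + m) + DET@_(U_(idx i l) + U_(idx k j) + m) = 0.
Proof.
have val s i' j' k' l' : perm_mnm s = (U_(idx i' j') + U_(idx k' l') + m)%MM ->
    [/\ s i' = j', s k' = l' & (i' != k') || (j' != l')].
  move=> e; have h1 := perm_mnmE s i' j'; have h2 := perm_mnmE s k' l'.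
  rewrite e !mnmDE !mnm1E !eqxx in h1 h2.
  have [e1 e2] : s i' = j' /\ s k' = l'.
    by split; [case: (s i' =P j') h1 | case: (s k' =P l') h2] => //; lia.
  split=> //; rewrite -negb_and -eq_idx; apply: contraT; rewrite negbK => /eqP e3.
  by move: h1; rewrite e3 eqxx e1 eqxx; lia.
have [ik|ik] := eqVneq i k.
  have zero j' l' : DET@_(U_(idx i j') + U_(idx k l') + m) = 0.
    rewrite det_coeff big1 // => s _; case: eqP => [/val[]|]; last by rewrite mulr0.
    by rewrite ik eqxx /= => -> ->; rewrite eqxx.
  by rewrite !zero addr0.
have step j' l' s : perm_mnm s = (U_(idx i j') + U_(idx k l') + m)%MM ->
    perm_mnm (tperm i k * s)%g = (U_(idx i l') + U_(idx k j') + m)%MM.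
  move=> e; have [e1 e2 _] := val _ _ _ _ _ e.
  have := perm_mnm_swap s ik; rewrite e1 e2 e => h.
  apply: (@addIm _ (U_(idx i j') + U_(idx k l'))%MM); rewrite h.
  by apply/mnmP => t; rewrite !mnmDE; ring.
rewrite !det_coeff [Y in _ + Y](reindex_inj (mulgI (tperm i k))) /= -big_split big1 // => s _.
rewrite /= odd_permM odd_tperm ik addTb.
have -> : (perm_mnm (tperm i k * s)%g == (U_(idx i l) + U_(idx k j) + m)%MM) =
          (perm_mnm s == (U_(idx i j) + U_(idx k l) + m)%MM).
  apply/eqP/eqP => [/step|/step //].
  by rewrite mulgA tperm2 mul1g.
by rewrite signrN mulNr addrN.
Qed.

(* The 2 x 2 permanent with rows [a] and columns [c], repetitions being allowed. *)
Definition perm2 (a c : I2) : S := X a.1 c.1 * X a.2 c.2 + X a.1 c.2 * X a.2 c.1.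

Lemma perm2_in_perp a c : in_det_perp (perm2 a c).
Proof.
apply/in_det_perpP => m; rewrite pairingD -!mpolyXD !pairingX.
exact: det_coeff_swap.
Qed.

Definition in_perm2 (g : S) : Prop :=
  exists s : I2 -> I2 -> S, g = \sum_a \sum_c s a c * perm2 a c.

Lemma in_perm2_perp g : in_perm2 g -> in_det_perp g.
Proof.
case=> s ->; elim/big_ind: _ => [||a _]; [exact: in_det_perp0|exact: in_det_perpD|].
elim/big_ind: _ => [||c _]; [exact: in_det_perp0|exact: in_det_perpD|].
by apply: in_det_perpM; apply: perm2_in_perp.
Qed.

Lemma in_perm2_lin c g h : in_perm2 g -> in_perm2 h -> in_perm2 (c * g + h).
Proof.
case=> s -> [t ->]; exists (fun a b => c * s a b + t a b).
rewrite mulr_sumr -big_split; apply: eq_bigr => a _ /=.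
rewrite mulr_sumr -big_split; apply: eq_bigr => b _ /=.
by rewrite mulrDl mulrA.
Qed.

Lemma in_perm2_0 : in_perm2 0.
Proof. by exists (fun _ _ => 0); rewrite big1 // => a _; rewrite big1 // => c _; rewrite mul0r. Qed.

Lemma in_perm2M c g : in_perm2 g -> in_perm2 (c * g).
Proof. by move=> h; rewrite -[_ * _]addr0; apply: in_perm2_lin => //; apply: in_perm2_0. Qed.

Lemma in_perm2D g h : in_perm2 g -> in_perm2 h -> in_perm2 (g + h).
Proof. by move=> ? ?; rewrite -[g]mul1r; apply: in_perm2_lin. Qed.

Lemma in_perm2_gen a c : in_perm2 (perm2 a c).
Proof.
exists (fun a' c' => ((a' == a) && (c' == c))%:R).
rewrite (bigD1 a) //= (bigD1 c) //= !eqxx mul1r !big1 ?addr0 //.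
  by move=> a' /negbTE ne; rewrite big1 // => c' _; rewrite ne mul0r.
by move=> c' /negbTE ne; rewrite ne mul0r.
Qed.

Definition xword (r c : seq 'I_n) : S := \prod_(q <- zip r c) X q.1 q.2.
Definition mword (r c : seq 'I_n) : 'X_{1..n * n} := (\sum_(q <- zip r c) U_(idx q.1 q.2))%MM.

Lemma xwordE r c : xword r c = 'X_[mword r c].
Proof. by rewrite /xword mprodXE. Qed.

Lemma xword_cons i r j c : xword (i :: r) (j :: c) = X i j * xword r c.
Proof. by rewrite /xword /= big_cons. Qed.

Lemma xword_cat r1 r2 c1 c2 : size r1 = size c1 ->
  xword (r1 ++ r2) (c1 ++ c2) = xword r1 c1 * xword r2 c2.
Proof. by move=> e; rewrite /xword zip_cat // big_cat. Qed.

Lemma split_at (c : seq 'I_n) k : (k < size c)%N ->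
  exists c1 b c2, c = c1 ++ b :: c2 /\ size c1 = k.
Proof.
move=> h; case: (drop k c) (cat_take_drop k c) (size_drop k c) => [|b c2] e sz.
  by move: sz; rewrite /=; lia.
by exists (take k c), b, c2; rewrite size_takel //; lia.
Qed.

(** Exchanging the columns of two letters costs a sign modulo one permanent. The induction brings
    the first column of [c'] to the front by one such exchange. The sign is left existential, since
    only vanishing and spanning matter later. *)
Lemma xword_col_perm r c c' : size r = size c -> perm_eq c c' ->
  exists b : bool, in_perm2 (xword r c - (-1) ^+ b * xword r c').
Proof.
elim: r c c' => [|i r IHr] [|j c] [|j' c'] //=; try by move=> _ /perm_size.
  by move=> _ _; exists false; rewrite mul1r subrr; apply: in_perm2_0.
move=> [sz] pe.
have [jj|jj] := eqVneq j j'.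
  rewrite -jj perm_cons in pe *; have [b hb] := IHr _ _ sz pe.
  exists b; rewrite !xword_cons mulrCA -mulrBr; exact: in_perm2M.
have j'c : j' \in c.
  by have := perm_mem pe j'; rewrite !inE eqxx eq_sym (negbTE jj).
have [c1 [c2 ce]] : exists c1 c2, c = c1 ++ j' :: c2.
  by case/splitPr: j'c => c1 c2; exists c1, c2.
have [r1 [k [r2 [re szr]]]] : exists r1 k r2, r = r1 ++ k :: r2 /\ size r1 = size c1.
  by apply: split_at; rewrite sz ce size_cat /=; lia.
have pe' : perm_eq (c1 ++ j :: c2) c'.
  rewrite -(perm_cons j'); apply: perm_trans pe; rewrite ce.
  by apply/seq.permP => a; rewrite /= !count_cat /=; lia.
have [|b hb] := IHr (c1 ++ j :: c2) c' _ pe'; first by rewrite sz ce !size_cat.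
rewrite re xword_cat // xword_cons in hb.
exists (~~ b); rewrite signrN !xword_cons re ce !xword_cat // !xword_cons.
set A := xword r1 c1 in hb *; set B := xword r2 c2 in hb *; set C := xword _ c' in hb *.
have -> : X i j * (A * (X k j' * B)) - - (-1) ^+ b * (X i j' * C) =
   (A * B) * perm2 (i, k) (j, j') + - (X i j') * (A * (X k j * B) - (-1) ^+ b * C).
  by rewrite /perm2 /=; ring.
by apply: in_perm2_lin; [apply: in_perm2_gen|apply: in_perm2M].
Qed.

Lemma xword_row_perm r r' c : size r = size c -> perm_eq r r' ->
  exists2 c', perm_eq c c' & xword r c = xword r' c'.
Proof.
elim: r' r c => [|i r' IHr] r c sz pe.
  have r0 : r = [::] by apply/nilP; rewrite /nilp (perm_size pe).
  by exists c => //; rewrite r0.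
have ir : i \in r by rewrite (perm_mem pe) inE eqxx.
have [r1 [r2 re]] : exists r1 r2, r = r1 ++ i :: r2.
  by case/splitPr: ir => r1 r2; exists r1, r2.
have [c1 [j [c2 [ce szc]]]] : exists c1 b c2, c = c1 ++ b :: c2 /\ size c1 = size r1.
  by apply: split_at; rewrite -sz re size_cat /=; lia.
have [|| c' pc' e'] := IHr (r1 ++ r2) (c1 ++ c2).
- by move: sz; rewrite re ce !size_cat /=; lia.
- rewrite -(perm_cons i); apply: perm_trans pe; rewrite re.
  by apply/seq.permP => a; rewrite /= !count_cat /=; lia.
exists (j :: c'); last first.
  by rewrite xword_cons -e' re ce !xword_cat // xword_cons mulrCA.
rewrite ce; apply: (@perm_trans _ (j :: (c1 ++ c2))); last by rewrite perm_cons.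
by apply/seq.permP => a; rewrite /= !count_cat /=; lia.
Qed.

Lemma xword_perm r r' c c' : size r = size c -> perm_eq r r' -> perm_eq c c' ->
  exists b : bool, in_perm2 (xword r c - (-1) ^+ b * xword r' c').
Proof.
move=> sz pr pc; have [c1 pc1 ->] := xword_row_perm sz pr.
apply: xword_col_perm; first by rewrite -(perm_size pr) -(perm_size pc1).
by apply: perm_trans pc; rewrite perm_sym.
Qed.

Hypothesis charK : [pchar K] =i pred0.

Lemma two_unit (g : S) : in_perm2 (2%:R * g) -> in_perm2 g.
Proof.
have n2 : (2%:R : K) != 0 by apply: natf_neq0_char0.
move=> h; have -> : g = ((2%:R : K)^-1)%:MP * (2%:R * g).
  by rewrite mulrA -mpolyC_nat -mpolyCM mulVf // mul1r.
exact: in_perm2M.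
Qed.

(** Two letters in the same row [i] form half of the permanent whose two rows are both [i]. *)
Lemma xword_row_rep i j r c : size r = size c -> i \in r -> in_perm2 (X i j * xword r c).
Proof.
move=> sz ir.
have [r1 [r2 re]] : exists r1 r2, r = r1 ++ i :: r2.
  by case/splitPr: ir => r1 r2; exists r1, r2.
have [c1 [j' [c2 [ce szc]]]] : exists c1 b c2, c = c1 ++ b :: c2 /\ size c1 = size r1.
  by apply: split_at; rewrite -sz re size_cat /=; lia.
apply: two_unit; rewrite re ce xword_cat // xword_cons.
have -> : 2%:R * (X i j * (xword r1 c1 * (X i j' * xword r2 c2))) =
   (xword r1 c1 * xword r2 c2) * perm2 (i, i) (j, j') by rewrite /perm2 /=; ring.
by apply: in_perm2M; apply: in_perm2_gen.
Qed.

Lemma xword_col_rep i j r c : size r = size c -> j \in c -> in_perm2 (X i j * xword r c).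
Proof.
move=> sz jc.
have [c1 [c2 ce]] : exists c1 c2, c = c1 ++ j :: c2.
  by case/splitPr: jc => c1 c2; exists c1, c2.
have [r1 [k [r2 [re szr]]]] : exists r1 k r2, r = r1 ++ k :: r2 /\ size r1 = size c1.
  by apply: split_at; rewrite sz ce size_cat /=; lia.
apply: two_unit; rewrite re ce xword_cat // xword_cons.
have -> : 2%:R * (X i j * (xword r1 c1 * (X k j * xword r2 c2))) =
   (xword r1 c1 * xword r2 c2) * perm2 (i, k) (j, j) by rewrite /perm2 /=; ring.
by apply: in_perm2M; apply: in_perm2_gen.
Qed.

Definition xminor (R C : {set 'I_n}) : S := xword (enum R) (enum C).

Definition has_normal_form (g : S) : Prop :=
  exists b : {set 'I_n} -> {set 'I_n} -> K,
    in_perm2 (g - \sum_(R : {set 'I_n}) \sum_(C : {set 'I_n} | #|R| == #|C|) b R C *: xminor R C).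

Lemma has_normal_form0 : has_normal_form 0.
Proof.
exists (fun _ _ => 0); rewrite big1 ?subrr; first exact: in_perm2_0.
by move=> R _; rewrite big1 // => C _; rewrite scale0r.
Qed.

Lemma has_normal_form_lin c g h :
  has_normal_form g -> has_normal_form h -> has_normal_form (c *: g + h).
Proof.
move=> [b hb] [b' hb']; exists (fun R C => c * b R C + b' R C).
have -> : \sum_(R : {set 'I_n}) \sum_(C : {set 'I_n} | #|R| == #|C|) (c * b R C + b' R C) *: xminor R C =
  c *: (\sum_(R : {set 'I_n}) \sum_(C : {set 'I_n} | #|R| == #|C|) b R C *: xminor R C) +
  \sum_(R : {set 'I_n}) \sum_(C : {set 'I_n} | #|R| == #|C|) b' R C *: xminor R C.
  rewrite scaler_sumr -big_split; apply: eq_bigr => R _ /=.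
  rewrite scaler_sumr -big_split; apply: eq_bigr => C _ /=.
  by rewrite scalerDl scalerA.
set A := \sum_(R : {set 'I_n}) _; set B := \sum_(R : {set 'I_n}) _.
have -> : c *: g + h - (c *: A + B) = c%:MP * (g - A) + (h - B).
  by rewrite mul_mpolyC scalerBr opprD !addrA; congr (_ - _); rewrite addrAC.
exact: in_perm2_lin.
Qed.

Lemma has_normal_form_minor (R C : {set 'I_n}) : #|R| = #|C| -> has_normal_form (xminor R C).
Proof.
move=> e; exists (fun R' C' => ((R' == R) && (C' == C))%:R).
rewrite (bigD1 R) //= (bigD1 C) ?e //= !eqxx scale1r !big1 ?addr0 ?subrr.
- exact: in_perm2_0.
- by move=> R' /negbTE ne; rewrite big1 // => C' _; rewrite ne scale0r.
by move=> C' /andP[_ /negbTE ne]; rewrite ne scale0r.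
Qed.

Lemma in_perm2_normal_form g h : in_perm2 (g - h) -> has_normal_form h -> has_normal_form g.
Proof.
move=> gh [b hb]; exists b.
by have := in_perm2D gh hb; rewrite addrA subrK.
Qed.

Lemma has_normal_formMX i j g : has_normal_form g -> has_normal_form (X i j * g).
Proof.
case=> b /(in_perm2M (X i j)); rewrite mulrBr => /in_perm2_normal_form; apply.
rewrite mulr_sumr; elim/big_ind: _ => [||R _]; first exact: has_normal_form0.
  by move=> x y hx hy; rewrite -[x]scale1r; apply: has_normal_form_lin.
rewrite mulr_sumr; elim/big_ind: _ => [||C /eqP RC]; first exact: has_normal_form0.
  by move=> x y hx hy; rewrite -[x]scale1r; apply: has_normal_form_lin.
rewrite -scalerAr -[_ *: _]addr0; apply: has_normal_form_lin; last exact: has_normal_form0.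
have sz : size (enum R) = size (enum C) by rewrite -!cardE.
have [iR|iR] := boolP (i \in R).
  apply: (@in_perm2_normal_form _ 0); last exact: has_normal_form0.
  by rewrite subr0; apply: xword_row_rep => //; rewrite mem_enum.
have [jC|jC] := boolP (j \in C).
  apply: (@in_perm2_normal_form _ 0); last exact: has_normal_form0.
  by rewrite subr0; apply: xword_col_rep => //; rewrite mem_enum.
rewrite -xword_cons.
have pe (T : finType) (A : {set T}) x : x \notin A -> perm_eq (x :: enum A) (enum (x |: A)).
  move=> xA; apply: uniq_perm; rewrite ?enum_uniq //= ?mem_enum ?xA ?enum_uniq //.
  by move=> y; rewrite mem_enum !inE mem_enum.
have [|b' hb'] := xword_perm _ (pe _ _ _ iR) (pe _ _ _ jC); first by rewrite /= sz.
apply: in_perm2_normal_form hb' _.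
have -> : (-1) ^+ b' * xword (enum (i |: R)) (enum (j |: C)) = (-1) ^+ b' *: xminor (i |: R) (j |: C) + 0.
  by rewrite addr0; case: b'; rewrite ?expr1 ?expr0 ?mul1r ?scale1r // mulN1r scaleN1r.
apply: has_normal_form_lin; last exact: has_normal_form0.
by apply: has_normal_form_minor; rewrite !cardsU1 iR jC RC.
Qed.

Lemma normal_form_exists g : has_normal_form g.
Proof.
elim/mpolyind: g => [|c m g _ _ hg]; first exact: has_normal_form0.
apply: has_normal_form_lin => // {c g hg}.
suff : forall h, has_normal_form h -> has_normal_form ('X_[m] * h).
  move=> /(_ 1); rewrite mulr1; apply.
  have -> : 1 = xminor set0 set0 by rewrite /xminor enum_set0 /xword big_nil.
  exact: has_normal_form_minor.
rewrite mpolyXE_id; elim/big_ind: _ => [h|x y hx hy h hh|t _].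
- by rewrite mul1r.
- by rewrite -mulrA; apply/hx/hy.
case/mxvec_indexP: t => i j; elim: (m _) => [|k IHk] h hh; first by rewrite expr0 mul1r.
by rewrite exprS -mulrA; apply: has_normal_formMX; apply: IHk.
Qed.

(** The multiplicity of [i] in [r] is the sum of the exponents along row [i], which is 1 for the
    monomial of a permutation; likewise for columns. *)
Lemma perm_mnm_mword s r c : size r = size c -> perm_mnm s = mword r c ->
  forall i, count_mem i r = 1%N /\ count_mem i c = 1%N.
Proof.
move=> sz e i.
have mwE k l : mword r c (idx k l) = count_mem (k, l) (zip r c).
  rewrite /mword mnm_sumE -sum1_count big_mkcond [RHS]big_mkcond /=.
  by apply: eq_bigr => -[a b] _; rewrite mnm1E eq_idx /= xpair_eqE; case: ifP.
have cnt (T : finType) (f : 'I_n * 'I_n -> T) (x : T) (w : seq ('I_n * 'I_n)) :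
    count_mem x (map f w) = (\sum_(q | f q == x) count_mem q w)%N.
  elim: w => [|q w IHw]; first by rewrite big1.
  rewrite /= IHw big_split /=; congr (_ + _)%N.
  rewrite (eq_bigr (fun p => (p == q) : nat)); last by move=> p _; rewrite eq_sym.
  have [fq|fq] := eqVneq (f q) x.
    by rewrite (bigD1 q) ?fq //= eqxx big1 // => p /andP[_ /negbTE ->].
  by rewrite big1 // => p /eqP fp; case: eqP => // pq; rewrite -pq fp eqxx in fq.
split.
- rewrite -{1}(unzip1_zip (eq_leq sz)) cnt (bigD1 (i, s i)) //= big1.
    by rewrite -mwE -e perm_mnmE eqxx.
  move=> [k l] /= /andP[/eqP -> ne]; rewrite -mwE -e perm_mnmE.
  by case: (s i =P l) ne => // ->; rewrite eqxx.
rewrite -{1}(unzip2_zip (eq_leq (esym sz))) cnt (bigD1 ((s^-1)%g i, i)) //= big1.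
  by rewrite -mwE -e perm_mnmE permKV eqxx.
move=> [k l] /= /andP[/eqP -> ne]; rewrite -mwE -e perm_mnmE.
by case: (s k =P i) ne => // <-; rewrite permK eqxx.
Qed.

Lemma det_coeff_mword_neq0 r c : size r = size c -> perm_eq r (enum 'I_n) ->
  perm_eq c (enum 'I_n) -> DET@_(mword r c) != 0.
Proof.
move=> sz pr pc.
have ur : uniq r by rewrite (perm_uniq pr) enum_uniq.
have uc : uniq c by rewrite (perm_uniq pc) enum_uniq.
have allr i : i \in r by rewrite (perm_mem pr) mem_enum.
pose f i := nth i c (index i r).
have f_inj : injective f.
  move=> i j; rewrite /f; have := allr i; have := allr j.
  rewrite -!index_mem => hj hi; rewrite (set_nth_default i j) -?sz // => /eqP.
  rewrite nth_uniq -?sz // => /eqP e.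
  by rewrite -(nth_index i (allr i)) e nth_index.
have cE : c = map f r.
  case: (posnP (size r)) => [/eqP|].
    by rewrite size_eq0 => /eqP r0; move: sz; rewrite r0 => /esym/eqP; rewrite size_eq0 => /eqP.
  case: (r) ur sz @f {f_inj allr} => // x0 r' ur' sz' f _.
  apply: (@eq_from_nth _ x0); first by rewrite size_map.
  move=> k; rewrite -sz' => hk; rewrite (nth_map x0) // /f index_uniq //.
  by apply: set_nth_default; rewrite -sz'.
have e : perm_mnm (perm f_inj) = mword r c.
  rewrite /perm_mnm -big_enum /= -(perm_big _ pr) /mword cE.
  elim: (r) => [|i r' IHr]; first by rewrite !big_nil.
  by rewrite /= !big_cons IHr permE.
rewrite det_coeff (bigD1 (perm f_inj)) //= e eqxx mulr1 big1 ?addr0 ?signr_eq0 //.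
move=> s ne; case: eqP => [e'|_]; last by rewrite mulr0.
by move: ne; rewrite (perm_mnm_inj (etrans e' (esym e))) eqxx.
Qed.

(** The monomial of [(R, C)] times that of the complements of [(R0, C0)] uses every row and every
    column exactly once only if [R = R0] and [C = C0]. The complementary monomials thus act as a
    dual basis for the normal forms. *)
Lemma pairing_minor (R0 C0 R C : {set 'I_n}) : #|R| = #|C| -> #|R0| = #|C0| ->
  (pairing DET (mword (enum (~: R0)) (enum (~: C0))) (xminor R C) != 0) = (R == R0) && (C == C0).
Proof.
move=> eRC eRC0; rewrite /xminor xwordE pairingX.
have szc : size (enum R) = size (enum C) by rewrite -!cardE.
have szc0 : size (enum (~: R0)) = size (enum (~: C0)).
  by rewrite -!cardE; have := cardsC R0; have := cardsC C0; lia.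
have -> : (mword (enum R) (enum C) + mword (enum (~: R0)) (enum (~: C0)))%MM =
    mword (enum R ++ enum (~: R0)) (enum C ++ enum (~: C0)).
  by rewrite /mword zip_cat // big_cat.
have szt : size (enum R ++ enum (~: R0)) = size (enum C ++ enum (~: C0)).
  by rewrite !size_cat szc szc0.
apply/idP/andP => [h|[/eqP-> /eqP->]].
  have [s /eqP hs] : exists s, perm_mnm s == mword (enum R ++ enum (~: R0)) (enum C ++ enum (~: C0)).
    apply/existsP; apply: contraNT h; rewrite negb_exists => /forallP h.
    by rewrite det_coeff big1 // => s _; rewrite (negbTE (h s)) mulr0.
  have cnt := perm_mnm_mword szt hs.
  have setP (A B : {set 'I_n}) : (forall i, count_mem i (enum A ++ enum (~: B)) = 1%N) -> A = B.
    move=> h1; apply/setP => i; have := h1 i; rewrite count_cat !count_uniq_mem ?enum_uniq //.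
    by rewrite !mem_enum inE; case: (i \in A); case: (i \in B).
  by split; apply/eqP/setP => i; have [] := cnt i.
have pe (A : {set 'I_n}) : perm_eq (enum A ++ enum (~: A)) (enum 'I_n).
  apply: uniq_perm; rewrite ?enum_uniq //.
    rewrite cat_uniq !enum_uniq andbT /=; apply/hasPn => i.
    by rewrite !mem_enum inE.
  by move=> i; rewrite mem_cat !mem_enum !inE orbN.
apply: det_coeff_mword_neq0 => //.
by rewrite !size_cat szc0 -!cardE eRC0.
Qed.

Lemma in_det_perp_perm2 (g : S) : in_det_perp g <-> in_perm2 g.
Proof.
split; last exact: in_perm2_perp.
move=> gI; have [b hb] := normal_form_exists g.
suff h0 (R C : {set 'I_n}) : #|R| = #|C| -> b R C = 0.
  move: hb; rewrite big1 ?subr0 // => R _; rewrite big1 // => C /eqP /h0 ->.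
  by rewrite scale0r.
move=> RC.
set h := \sum_(R : {set 'I_n}) _ in hb.
have hI : in_det_perp h.
  have -> : h = -1 * (g - h) + g by ring.
  by apply: in_det_perp_lin => //; apply: in_perm2_perp.
move/in_det_perpP/(_ (mword (enum (~: R)) (enum (~: C)))): hI.
rewrite pairing_sum (bigD1 R) //= pairing_sum (bigD1 C) ?RC //= !pairingZ.
rewrite !big1 ?addr0.
- move/eqP; rewrite mulf_eq0 => /orP[/eqP //|].
  by rewrite (negbTE (_ : _ != 0)) // pairing_minor ?eqxx.
- move=> R' ne; rewrite pairing_sum big1 // => C' /eqP e'; rewrite pairingZ.
  by have := pairing_minor e' RC; rewrite (negbTE ne) => /negbFE/eqP ->; rewrite mulr0.
- move=> C' /andP[/eqP e' ne]; rewrite pairingZ.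
  have := @pairing_minor R C R C' _ RC; rewrite RC (negbTE ne) andbF => h1.
  by rewrite (eqP (negbFE (h1 e'))) mulr0.
Qed.

End DetPerp.

(** * Derivatives of products of variables *)

Section Derivatives.

Variables (K : fieldType) (N : nat).
Local Notation S := {mpoly K[N]}.

Lemma mderiv_var (x p : 'I_N) : ('X_x : S)^`M(p) = (x == p)%:R.
Proof.
rewrite mderivX mnm1E; case: eqP => [->|_]; last by rewrite scale0r.
have -> : (U_(p) - U_(p) = 0)%MM by apply/mnmP => i; rewrite mnmBE subnn mnm0E.
by rewrite mpolyX0 scale1r.
Qed.

Lemma mderiv_nat (k : nat) (p : 'I_N) : (k%:R : S)^`M(p) = 0.
Proof. by rewrite -mpolyC_nat mderivC. Qed.

Lemma mderiv2 (x y p q : 'I_N) : ('X_x * 'X_y : S)^`M(p)^`M(q) =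
  (x == p)%:R * (y == q)%:R + (x == q)%:R * (y == p)%:R.
Proof.
rewrite mderivM !mderiv_var mderivD !mderivM !mderiv_var !mderiv_nat.
by rewrite mul0r mulr0 add0r addr0.
Qed.

Lemma mderiv3 (x y z p q r : 'I_N) : ('X_x * 'X_y * 'X_z : S)^`M(p)^`M(q)^`M(r) =
  (x == p)%:R * (y == q)%:R * (z == r)%:R + (x == q)%:R * (y == p)%:R * (z == r)%:R
  + (x == p)%:R * (y == r)%:R * (z == q)%:R + (x == r)%:R * (y == p)%:R * (z == q)%:R
  + (x == q)%:R * (y == r)%:R * (z == p)%:R + (x == r)%:R * (y == q)%:R * (z == p)%:R.
Proof.
rewrite !(mderivM, mderivD, mderiv_var, mderiv_nat, mul0r, mulr0, addr0, add0r).
move: ((x == p)%:R : S) ((x == q)%:R : S) ((x == r)%:R : S) => x1 x2 x3.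
move: ((y == p)%:R : S) ((y == q)%:R : S) ((y == r)%:R : S) => y1 y2 y3.
move: ((z == p)%:R : S) ((z == q)%:R : S) ((z == r)%:R : S) => z1 z2 z3.
ring.
Qed.

End Derivatives.

(** The list [l] holds the positions already removed by earlier derivatives, which lets the product
    rule be iterated. *)
Lemma mderiv_prodX (K : fieldType) (N d : nat) (v : 'I_d -> 'I_N) (t : 'I_N) (l : seq 'I_d) :
  uniq l ->
  (\prod_(s < d | s \notin l) 'X_(v s) : {mpoly K[N]})^`M(t) =
  \sum_(s < d | s \notin l) (v s == t)%:R * \prod_(u < d | u \notin s :: l) 'X_(v u).
Proof.
have [k hk] := ubnP (d - size l); elim: k l hk => // k IHk l hk ul.
have [/existsP[s0 s0l]|no] := boolP [exists s, s \notin l]; last first.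
  rewrite negb_exists in no; move/forallP: no => no.
  by rewrite !big_pred0 ?mderivC // => s; apply: negbTE.
have ul' : uniq (s0 :: l) by rewrite /= s0l.
have prodD1 l' (s : 'I_d) : s \notin l' -> \prod_(u < d | u \notin l') 'X_(v u) =
    'X_(v s) * \prod_(u < d | u \notin s :: l') 'X_(v u) :> {mpoly K[N]}.
  move=> sl; rewrite (bigD1 s) //=; congr (_ * _).
  by apply: eq_bigl => u; rewrite inE negb_or andbC.
rewrite (prodD1 _ s0) // mderivM mderiv_var.
rewrite IHk //; last first.
  have := uniq_leq_size ul' (s2 := enum 'I_d) (fun x _ => mem_enum _ x).
  by move: hk; rewrite size_enum_ord /=; lia.
rewrite [RHS](bigD1 s0) //=; congr (_ + _).
rewrite mulr_sumr; apply: eq_big => [s|s sl]; first by rewrite inE negb_or andbC.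
rewrite mulrCA; congr (_ * _); rewrite [RHS](prodD1 _ s0).
  by congr (_ * _); apply: eq_bigl => u; rewrite !inE orbCA.
by move: sl; rewrite !inE !negb_or s0l andbT eq_sym => /andP[].
Qed.

(** * Syzygies of the permanents *)

Section LinearSyzygies.

Variables (R : comNzRingType) (I : Type) (r : nat) (x : I -> I -> R).
Local Notation I2 := (I * I)%type.
Variables (G : I2 -> I2 -> 'rV[R]_r) (Zp : 'rV[R]_r -> Prop).
Local Notation X i j := (x i j).

Definition perm_pol (a c : I2) : R := X a.1 c.1 * X a.2 c.2 + X a.1 c.2 * X a.2 c.1.

Hypothesis GswapR : forall a c, G a (c.2, c.1) = G a c.
Hypothesis Zplin : forall s u v, Zp u -> Zp v -> Zp (s *: u + v).
Hypothesis Zp0 : Zp 0.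
Hypothesis seq_mu : forall (q : seq (bool * (I2 * (I2 * I2)))),
  \sum_(z <- q) (-1) ^+ z.1 * X z.2.1.1 z.2.1.2 * perm_pol z.2.2.1 z.2.2.2 = 0 ->
  Zp (\sum_(z <- q) ((-1) ^+ z.1 * X z.2.1.1 z.2.1.2) *: G z.2.2.1 z.2.2.2).

Let ZpD u v : Zp u -> Zp v -> Zp (u + v).
Proof. by move=> hu hv; rewrite -[u]scale1r; apply: Zplin. Qed.

Let ZpZ s u : Zp u -> Zp (s *: u).
Proof. by move=> hu; rewrite -[_ *: _]addr0; apply: Zplin. Qed.

Let ZpN u : Zp u -> Zp (- u).
Proof. by rewrite -scaleN1r; apply: ZpZ. Qed.

(** Needed for marked pairs that overlap, on three positions with row letters [i], [k], [u] and
    column letters [j], [l], [v]. The coefficient 2 is entered as a repeated item, since [seq_mu]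
    allows only signs. *)
Lemma lin_syz_transp i k u j l v :
  Zp (X k l *: G (i, u) (j, v) + X i j *: G (k, u) (l, v) + X k j *: G (i, u) (l, v)
      + X i l *: G (k, u) (j, v) - 2%:R *: (X u v *: G (i, k) (j, l))
      - X i v *: G (u, k) (j, l) - X k v *: G (i, u) (j, l)).
Proof.
have := @seq_mu [:: (false, ((k, l), ((i, u), (j, v)))); (false, ((i, j), ((k, u), (l, v))));
  (false, ((k, j), ((i, u), (l, v)))); (false, ((i, l), ((k, u), (j, v))));
  (true, ((u, v), ((i, k), (j, l)))); (true, ((u, v), ((i, k), (j, l))));
  (true, ((i, v), ((u, k), (j, l)))); (true, ((k, v), ((i, u), (j, l))))].
rewrite !big_cons !big_nil /= !expr1 !expr0 !mulN1r !mul1r => h.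
set A := (X in Zp X); set B := (X in _ -> Zp X) in h.
have -> : A = B by apply/rowP => t; rewrite /A /B !mxE; ring.
by apply: h; rewrite /perm_pol /=; ring.
Qed.

(** A variable times a permanent is an edge joining two monomials on the same rows that differ by
    exchanging two columns. The alternating sum of the edges of an even closed walk is a syzygy;
    this one and the next are closed walks of four edges. *)
Lemma lin_syz_sq r1 r2 r3 a b' c :
  Zp (X r2 b' *: G (r1, r3) (a, c) - X r3 a *: G (r1, r2) (c, b')
      + X r1 b' *: G (r2, r3) (c, a) - X r3 c *: G (r1, r2) (a, b')).
Proof.
have := @seq_mu [:: (false, ((r2, b'), ((r1, r3), (a, c)))); (true, ((r3, a), ((r1, r2), (c, b'))));
  (false, ((r1, b'), ((r2, r3), (c, a)))); (true, ((r3, c), ((r1, r2), (a, b'))))].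
rewrite !big_cons !big_nil /= !expr1 !expr0 !mulN1r !mul1r => h.
set A := (X in Zp X); set B := (X in _ -> Zp X) in h.
have -> : A = B by apply/rowP => t; rewrite /A /B !mxE; ring.
by apply: h; rewrite /perm_pol /=; ring.
Qed.

Lemma lin_syz_cyc r1 r3 r4 a c d :
  Zp (X r4 d *: G (r1, r3) (a, c) - X r3 a *: G (r1, r4) (c, d)
      + X r4 c *: G (r1, r3) (d, a) - X r1 a *: G (r3, r4) (c, d)).
Proof.
have := @seq_mu [:: (false, ((r4, d), ((r1, r3), (a, c)))); (true, ((r3, a), ((r1, r4), (c, d))));
  (false, ((r4, c), ((r1, r3), (d, a)))); (true, ((r1, a), ((r3, r4), (c, d))))].
rewrite !big_cons !big_nil /= !expr1 !expr0 !mulN1r !mul1r => h.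
set A := (X in Zp X); set B := (X in _ -> Zp X) in h.
have -> : A = B by apply/rowP => t; rewrite /A /B !mxE; ring.
by apply: h; rewrite /perm_pol /=; ring.
Qed.

(* In terms of permutations of four columns this is the commuting square of the
   transpositions (12) and (34), cut into the hexagons of (134) and (234) and three
   squares joining them. *)
Lemma koszul_syz r1 r2 r3 r4 a b' c d :
  Zp (perm_pol (r3, r4) (c, d) *: G (r1, r2) (a, b') - perm_pol (r1, r2) (a, b') *: G (r3, r4) (c, d)).
Proof.
have hA := ZpZ (X r2 b') (lin_syz_cyc r1 r3 r4 a c d).
have hB := ZpZ (X r1 b') (lin_syz_cyc r2 r3 r4 a c d).
have h1 := ZpN (ZpZ (X r4 d) (lin_syz_sq r1 r2 r3 a b' c)).
have h2 := ZpZ (X r3 a) (lin_syz_sq r1 r2 r4 c b' d).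
have h3 := ZpN (ZpZ (X r4 c) (lin_syz_sq r1 r2 r3 d b' a)).
have := ZpD (ZpD (ZpD hA hB) (ZpD h1 h2)) h3.
rewrite -(GswapR (r2, r4) (d, c)) -(GswapR (r2, r3) (c, a)) -(GswapR (r2, r3) (a, d)) /=.
set A := (X in Zp X -> _); set B := (X in _ -> Zp X).
by have -> : A = B by apply/rowP => t; rewrite /A /B !mxE /perm_pol /=; ring.
Qed.

End LinearSyzygies.

Lemma sum_delta (R : pzRingType) (V : lmodType R) (p q : nat) (f : 'I_p -> 'I_q -> V) k0 l0 :
  \sum_k \sum_l (delta_mx k0 l0 : 'M[R]_(p, q)) k l *: f k l = f k0 l0.
Proof.
rewrite (bigD1 k0) //= (bigD1 l0) //= !big1 ?addr0.
- by rewrite mxE !eqxx scale1r.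
- by move=> k /negbTE ne; rewrite big1 // => l _; rewrite mxE ne scale0r.
- by move=> l /negbTE ne; rewrite mxE ne andbF scale0r.
Qed.

Lemma scale_koszulE (R : comNzRingType) (r : nat) (w a b c d a' b' c' d' : R) (u v : 'rV[R]_r) :
  - (w *: ((a * b + c * d) *: u - (a' * b' + c' * d') *: v)) =
  (a' * b' * w) *: v + (d' * c' * w) *: v - ((a * b * w) *: u + (d * c * w) *: u).
Proof. by apply/rowP => t; rewrite !mxE; ring. Qed.

Lemma scale_transpE (R : comNzRingType) (r : nat) (w a1 a2 a3 a4 a5 a6 a7 : R)
    (g1 g2 g3 g4 g5 g6 g7 : 'rV[R]_r) :
  w *: (a1 *: g1 + a2 *: g2 + a3 *: g3 + a4 *: g4 - 2%:R *: (a5 *: g5) - a6 *: g6 - a7 *: g7) =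
  (a1 * w) *: g1 + (a4 * w) *: g4 - ((a5 * w) *: g5 + (a6 * w) *: g6) +
  ((a2 * w) *: g2 + (a3 * w) *: g3 - ((a5 * w) *: g5 + (a7 * w) *: g7)).
Proof. by apply/rowP => t; rewrite !mxE; ring. Qed.

(** * Generation of the syzygies by the linear ones, through marked words *)

Section Syzygies.

Variables (K : fieldType) (charK : [pchar K] =i pred0) (n r : nat).
Local Notation S := (mxpolyring K n).
Local Notation I2 := ('I_n * 'I_n)%type.
Local Notation idx i j := (@mxvec_index n n i j).
Local Notation X i j := ('X_(idx i j) : S).

Variables (b : 'cV[S]_r) (G : I2 -> I2 -> 'rV[S]_r).
Definition rowev (u : 'rV[S]_r) : S := (u *m b) 0 0.
Local Notation mu := rowev.

Hypothesis GswapL : forall a c, G (a.2, a.1) c = G a c.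
Hypothesis GswapR : forall a c, G a (c.2, c.1) = G a c.
Hypothesis muG : forall a c, mu (G a c) = perm2 K a c.

(* The syzygies generated by the linear ones. *)
Variable Zp : 'rV[S]_r -> Prop.
Hypothesis Zp0 : Zp 0.
Hypothesis Zplin : forall s u v, Zp u -> Zp v -> Zp (s *: u + v).
Hypothesis Zpmu : forall u, Zp u -> mu u = 0.
Hypothesis Zp3 : forall q : seq (bool * (I2 * (I2 * I2))),
  let u := \sum_(z <- q) ((-1) ^+ z.1 * X z.2.1.1 z.2.1.2) *: G z.2.2.1 z.2.2.2 in
  mu u = 0 -> Zp u.

Lemma rowev_lin s u v : mu (s *: u + v) = s * mu u + mu v.
Proof. by rewrite /rowev mulmxDl -scalemxAl !mxE. Qed.

Lemma rowev0 : mu 0 = 0.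
Proof. by rewrite /rowev mul0mx mxE. Qed.

Lemma rowev_sum (I : Type) (l : seq I) (P : pred I) (f : I -> 'rV[S]_r) :
  mu (\sum_(i <- l | P i) f i) = \sum_(i <- l | P i) mu (f i).
Proof. by rewrite /rowev mulmx_suml summxE. Qed.

Lemma rowevZ s u : mu (s *: u) = s * mu u.
Proof. by rewrite -[s *: u]addr0 rowev_lin rowev0 addr0. Qed.

Lemma ZpD u v : Zp u -> Zp v -> Zp (u + v).
Proof. by move=> hu hv; rewrite -[u]scale1r; apply: Zplin. Qed.

Lemma ZpZ s u : Zp u -> Zp (s *: u).
Proof. by move=> hu; rewrite -[_ *: _]addr0; apply: Zplin. Qed.

Lemma ZpN u : Zp u -> Zp (- u).
Proof. by rewrite -scaleN1r; apply: ZpZ. Qed.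

Lemma Zp_sum (I : Type) (l : seq I) (P : pred I) (f : I -> 'rV[S]_r) :
  (forall i, P i -> Zp (f i)) -> Zp (\sum_(i <- l | P i) f i).
Proof. by move=> h; elim/big_ind: _ => //; apply: ZpD. Qed.

Let seq_mu (q : seq (bool * (I2 * (I2 * I2)))) :
  \sum_(z <- q) (-1) ^+ z.1 * X z.2.1.1 z.2.1.2
    * perm_pol (fun i j => X i j) z.2.2.1 z.2.2.2 = 0 ->
  Zp (\sum_(z <- q) ((-1) ^+ z.1 * X z.2.1.1 z.2.1.2) *: G z.2.2.1 z.2.2.2).
Proof.
move=> h; apply: Zp3; rewrite rowev_sum -[RHS]h; apply: eq_bigr => z _.
by rewrite rowevZ muG.
Qed.

Let syz_transp := @lin_syz_transp _ 'I_n r (fun i j => X i j) G Zp seq_mu.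
Let syz_koszul := @koszul_syz _ 'I_n r (fun i j => X i j) G Zp GswapR Zplin Zp0 seq_mu.

Section Word.

Variable d : nat.
Local Notation word := {ffun 'I_d -> 'I_n}.

Definition xw (rr cc : word) : S := \prod_(s < d) X (rr s) (cc s).

Definition ew (s s' : 'I_d) (rr cc : word) : 'rV[S]_r :=
  (\prod_(u < d | u \notin [:: s; s']) X (rr u) (cc u)) *: G (rr s, rr s') (cc s, cc s').

Lemma ewC s s' rr cc : ew s s' rr cc = ew s' s rr cc.
Proof.
rewrite /ew -(GswapL (rr s, rr s')) -(GswapR _ (cc s, cc s')) /=; congr (_ *: _).
by apply: eq_bigl => u; rewrite !inE orbC.
Qed.

(** There is no factor one half, so on a word every pair of letters is marked twice, once in each
    order. *)
Definition hess (f : S) : 'rV[S]_r :=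
  \sum_(x : I2) \sum_(y : I2) (f^`M(idx y.1 y.2)^`M(idx x.1 x.2) : S) *: G (x.1, y.1) (x.2, y.2).

Lemma hess_lin c f g : hess (c%:MP * f + g) = c%:MP *: hess f + hess g.
Proof.
rewrite /hess scaler_sumr -big_split; apply: eq_bigr => x _ /=.
rewrite scaler_sumr -big_split; apply: eq_bigr => y _ /=.
by rewrite !mderivD !mderiv_mulC scalerDl scalerA.
Qed.

Lemma hess_xw rr cc : hess (xw rr cc) = \sum_s \sum_(s' | s != s') ew s s' rr cc.
Proof.
have dx (l : seq 'I_d) (x : I2) : uniq l ->
   (\prod_(s < d | s \notin l) X (rr s) (cc s))^`M(idx x.1 x.2) =
   \sum_(s < d | s \notin l) ((rr s, cc s) == x)%:R * \prod_(u < d | u \notin s :: l) X (rr u) (cc u).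
  move=> ul; rewrite mderiv_prodX //; apply: eq_bigr => s _.
  by rewrite eq_idx; case: x => x1 x2; rewrite xpair_eqE.
have -> : xw rr cc = \prod_(s < d | s \notin [::]) X (rr s) (cc s).
  by apply: eq_bigl => s; rewrite in_nil.
rewrite /hess; under eq_bigr => x _ do under eq_bigr => y _ do rewrite dx // raddf_sum /= scaler_suml.
under eq_bigr => x _ do rewrite exchange_big /=.
rewrite exchange_big /=; apply: eq_big => // s _.
transitivity (\sum_(x : I2) ((\prod_(u < d | u \notin [:: s]) X (rr u) (cc u))^`M(idx x.1 x.2) : S) *: G (x.1, rr s) (x.2, cc s)).
  apply: eq_bigr => x _; rewrite (bigD1 (rr s, cc s)) //= eqxx mul1r [Y in _ + Y]big1 ?addr0 // => y ne.
  by rewrite eq_sym (negbTE ne) mul0r mderivC scale0r.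
set W := \prod_(_ < _ | _) _.
have dW x : W^`M(idx x.1 x.2) = _ := dx [:: s] x isT.
move: W dW => W dW; under [LHS]eq_bigr => x _ do rewrite dW scaler_suml.
rewrite exchange_big /=; apply: eq_big => [s'|s' _]; first by rewrite inE eq_sym.
rewrite ewC (bigD1 (rr s', cc s')) //= eqxx mul1r [Y in _ + Y]big1 ?addr0 // => y ne.
by rewrite eq_sym (negbTE ne) mul0r scale0r.
Qed.


Lemma prod_notin_cons (f : 'I_d -> S) (w : 'I_d) (l l' : seq 'I_d) : w \notin l ->
  l' =i w :: l -> \prod_(u < d | u \notin l) f u = f w * \prod_(u < d | u \notin l') f u.
Proof.
move=> wl ll'; rewrite (bigD1 w) //=; congr (_ * _).
by apply: eq_bigl => u; rewrite ll' inE negb_or andbC.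
Qed.

(** The permanent at the marked pair expands into the word itself and the word with its two marked
    row letters exchanged; this is how [1 + u] enters. *)
Lemma mu_ew s s' rr cc : s != s' ->
  mu (ew s s' rr cc) = xw rr cc + xw (wact rr (tperm s s')) cc.
Proof.
move=> ss; rewrite /ew rowevZ muG.
have xwE rr' : xw rr' cc = X (rr' s) (cc s) * (X (rr' s') (cc s') *
   \prod_(u < d | u \notin [:: s; s']) X (rr' u) (cc u)).
  transitivity (\prod_(u < d | u \notin [::]) X (rr' u) (cc u)).
    by apply: eq_bigl => u; rewrite in_nil.
  rewrite (@prod_notin_cons _ s [::] [:: s]) // (@prod_notin_cons _ s' [:: s] [:: s; s']) //.
    by rewrite inE eq_sym.
  by move=> u; rewrite !inE orbC.
rewrite !xwE /perm2 /= !ffunE tpermL tpermR.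
have -> : \prod_(u < d | u \notin [:: s; s']) X (wact rr (tperm s s') u) (cc u) =
   \prod_(u < d | u \notin [:: s; s']) X (rr u) (cc u).
  by apply: eq_bigr => u; rewrite !inE negb_or => /andP[us us']; rewrite ffunE tpermD // eq_sym.
set W := \prod_(_ < _ | _) _.
by rewrite mulrDr !(mulrC W) -!mulrA (mulrCA (X (rr s) (cc s'))).
Qed.

Lemma ew_act s s' rr cc : s != s' -> ew s s' (wact rr (tperm s s')) cc = ew s s' rr cc.
Proof.
move=> ss; rewrite /ew !ffunE tpermL tpermR -(GswapL (rr s, rr s')) /=; congr (_ *: _).
by apply: eq_bigr => u; rewrite !inE negb_or => /andP[us us']; rewrite ffunE tpermD // eq_sym.
Qed.

Variables (p q : 'I_d).
Hypothesis pq : p != q.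
Local Notation t := (tperm p q).

(** The failure of two operations to agree: marking [s], [s'] after applying [1 + t], and marking
    [p], [q] after applying [1 + u] with [u] the transposition of [s] and [s']. Summed over all
    pairs it is the Hessian of the image minus [T]. *)
Let F rr cc s s' := ew s s' rr cc + ew s s' (wact rr t) cc
                    - (ew p q rr cc + ew p q (wact rr (tperm s s')) cc).

Let FC rr cc s s' : F rr cc s s' = F rr cc s' s.
Proof. by rewrite /F (ewC s s' rr) (ewC s s' (wact rr t)) (tpermC s). Qed.

Let Fpq rr cc : F rr cc p q = 0.
Proof. by rewrite /F subrr. Qed.

(** The two transpositions are disjoint and commute; up to sign [F] is then a monomial times the
    Koszul relation of two permanents. *)
Let Fdisj rr cc s s' : s != s' -> s \notin [:: p; q] -> s' \notin [:: p; q] -> Zp (F rr cc s s').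
Proof.
move=> ss; rewrite !inE !negb_or => /andP[sp sq] /andP[s'p s'q].
pose W := \prod_(u < d | u \notin [:: p; q; s; s']) X (rr u) (cc u).
have ewss (rr' : word) : (forall u, u \notin [:: p; q; s; s'] -> rr' u = rr u) ->
  ew s s' rr' cc = (X (rr' p) (cc p) * X (rr' q) (cc q) * W) *: G (rr' s, rr' s') (cc s, cc s').
  move=> h; rewrite /ew (@prod_notin_cons _ q _ [:: q; s; s']) //; last first.
    by rewrite !inE negb_or eq_sym sq eq_sym s'q.
  rewrite (@prod_notin_cons _ p _ [:: p; q; s; s']) //; last first.
    by rewrite !inE !negb_or pq eq_sym sp eq_sym s'p.
  rewrite mulrCA mulrA; congr (_ * _ *: _).
  by apply: eq_bigr => u hu; rewrite h.
have ewpq (rr' : word) : (forall u, u \notin [:: p; q; s; s'] -> rr' u = rr u) ->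
  ew p q rr' cc = (X (rr' s) (cc s) * X (rr' s') (cc s') * W) *: G (rr' p, rr' q) (cc p, cc q).
  move=> h; rewrite /ew (@prod_notin_cons _ s' _ [:: s'; p; q]) //; last first.
    by rewrite !inE negb_or s'p s'q.
  rewrite (@prod_notin_cons _ s _ [:: p; q; s; s']) //; first last.
  - by move=> u; rewrite !inE; case: (u == p); case: (u == q); case: (u == s); case: (u == s').
  - by rewrite !inE !negb_or ss sp sq.
  rewrite mulrCA mulrA; congr (_ * _ *: _).
  by apply: eq_bigr => u hu; rewrite h.
rewrite /F (ewss rr) // (ewpq rr) // ewss ?ewpq; first last.
- move=> u; rewrite !inE !negb_or => /and4P[up uq us us'].
  by rewrite ffunE tpermD // eq_sym.
- move=> u; rewrite !inE !negb_or => /and4P[up uq us us'].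
  by rewrite ffunE tpermD // eq_sym.
rewrite !ffunE !tpermL !tpermR !tpermD // -?(eq_sym s) -?(eq_sym s') //.
have := ZpN (ZpZ W (syz_koszul (rr p) (rr q) (rr s) (rr s') (cc p) (cc q) (cc s) (cc s'))).
by rewrite /perm_pol scale_koszulE.
Qed.

(** Overlapping transpositions do not commute: [F p j] maps to the difference of the two words
    obtained from [rr] by the 3-cycles on [p], [q], [j]. Since [t] conjugates the transposition of
    [q], [j] into that of [p], [j], the image of [F q j] is the opposite difference, so the sum is a
    syzygy. *)
Let Fover rr cc j : j \notin [:: p; q] -> Zp (F rr cc p j + F rr cc q j).
Proof.
rewrite !inE !negb_or => /andP[jp jq].
pose W := \prod_(u < d | u \notin [:: p; q; j]) X (rr u) (cc u).
have ewE (rr' : word) s s' s'' : uniq [:: s; s'; s''] -> [:: s; s'; s''] =i [:: p; q; j] ->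
    (forall u, u \notin [:: p; q; j] -> rr' u = rr u) ->
  ew s s' rr' cc = (X (rr' s'') (cc s'') * W) *: G (rr' s, rr' s') (cc s, cc s').
  move=> us e h; rewrite /ew (@prod_notin_cons _ s'' _ [:: p; q; j]); first last.
  - by move=> u; rewrite -e !inE orbA orbC.
  - by move: us; rewrite /= !inE !negb_or => /and3P[/andP[? ?] ? _]; rewrite eq_sym; apply/andP; split => //; rewrite eq_sym.
  by congr (_ * _ *: _); apply: eq_bigr => u hu; rewrite h.
have hact s s' : s \in [:: p; q; j] -> s' \in [:: p; q; j] ->
    forall u, u \notin [:: p; q; j] -> wact rr (tperm s s') u = rr u.
  move=> hs hs' u hu; rewrite ffunE tpermD //.
    by apply: contraNneq hu => <-.
  by apply: contraNneq hu => <-.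
have upqj : uniq [:: p; q; j] by rewrite /= !inE negb_or pq eq_sym jp eq_sym jq.
have upjq : uniq [:: p; j; q] by rewrite /= !inE negb_or pq jq eq_sym jp.
have uqjp : uniq [:: q; j; p] by rewrite /= !inE negb_or jp eq_sym jq eq_sym pq.
have e1 : [:: p; j; q] =i [:: p; q; j] by move=> u; rewrite !inE; case: (u == p); case: (u == q); case: (u == j).
have e2 : [:: q; j; p] =i [:: p; q; j] by move=> u; rewrite !inE; case: (u == p); case: (u == q); case: (u == j).
have jj : j \in [:: p; q; j] by rewrite !inE eqxx !orbT.
have pp : p \in [:: p; q; j] by rewrite !inE eqxx.
have qq : q \in [:: p; q; j] by rewrite !inE eqxx !orbT.
rewrite /F (ewE rr p j q) // (ewE rr q j p) // (ewE rr p q j) //.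
rewrite (ewE (wact rr t) p j q) ?(ewE (wact rr t) q j p) //; try exact: hact.
rewrite (ewE (wact rr (tperm p j)) p q j) ?(ewE (wact rr (tperm q j)) p q j) //; try exact: hact.
rewrite !ffunE !tpermL !tpermR !(@tpermD _ p q j) ?(@tpermD _ p j q) ?(@tpermD _ q j p) //; try by rewrite eq_sym.
have := ZpZ W (syz_transp (rr p) (rr q) (rr j) (cc p) (cc q) (cc j)).
by rewrite scale_transpE.
Qed.

(** Pairs are sorted by their intersection with [p], [q]: the pair itself, those meeting it in one
    position, grouped as [(p, j)] with [(q, j)], and the disjoint ones. *)
Lemma sum_diff_pairs (f : 'I_d -> 'I_d -> 'rV[S]_r) : (forall s s', f s s' = f s' s) ->
  Zp (f p q) -> (forall j, j \notin [:: p; q] -> Zp (f p j + f q j)) ->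
  (forall s s', s != s' -> s \notin [:: p; q] -> s' \notin [:: p; q] -> Zp (f s s')) ->
  Zp (\sum_s \sum_(s' | s != s') f s s').
Proof.
move=> fC fpq fover fdisj.
have qp : q != p by rewrite eq_sym.
have rowE s (g : 'I_d -> 'rV[S]_r) : \sum_(s' | s != s') g s' =
    (if s == p then 0 else g p) + (if s == q then 0 else g q)
    + \sum_(s' | s' \notin [:: p; q]) (if s == s' then 0 else g s').
  rewrite big_mkcond (bigD1 p) //= (bigD1 q) //= addrA; congr (_ + _ + _).
  - by case: eqP.
  - by case: eqP.
  by apply: eq_big => [s'|s' _]; [rewrite !inE negb_or|case: eqP].
rewrite (bigD1 p) //= [Y in _ + Y](bigD1 q) //= addrA !rowE !eqxx (negbTE pq) (negbTE qp) addr0 add0r.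
set A := \sum_(s' | _) _; set B := \sum_(s' | _) _; set C := \sum_(i | _) _.
have -> : f p q + A + (f q p + B) + C = f p q + f p q + (A + B) + C.
  by rewrite (fC q p) addrACA.
apply: ZpD; last first.
  apply: Zp_sum => s /andP[sp sq]; rewrite rowE (negbTE sp) (negbTE sq).
  apply: ZpD; first by rewrite !(fC s); apply: fover; rewrite !inE negb_or sp.
  apply: Zp_sum => s' hs'; case: eqP => [//|/eqP ss].
  by apply: fdisj => //; rewrite !inE negb_or sp.
apply: ZpD; first exact: ZpD.
rewrite /A /B -big_split; apply: Zp_sum => j hj /=.
have : j \notin [:: p; q] by [].
by rewrite !inE negb_or => /andP[/negbTE jp /negbTE jq]; rewrite !(eq_sym _ j) jp jq; apply: fover.
Qed.

Lemma hess_mu_ew rr cc :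
  Zp (hess (mu (ew p q rr cc)) - transp_sum (fun r' => ew p q r' cc) rr).
Proof.
rewrite mu_ew // -[xw rr cc]mul1r -mpolyC1 hess_lin mpolyC1 scale1r !hess_xw.
have -> : \sum_s \sum_(s' | s != s') ew s s' rr cc + \sum_s \sum_(s' | s != s') ew s s' (wact rr t) cc
     - transp_sum (fun r' => ew p q r' cc) rr = \sum_s \sum_(s' | s != s') F rr cc s s'.
  rewrite -big_split -sumrB; apply: eq_bigr => s _ /=.
  by rewrite -big_split -sumrB; apply: eq_bigr => s' _ /=.
apply: sum_diff_pairs.
- exact: FC.
- by rewrite Fpq; apply: Zp0.
- by move=> j hj; apply: Fover.
- by move=> s s' ss hs hs'; apply: Fdisj.
Qed.

Local Notation W := #|{: word}|.

(** Rows of [a] are indexed by column words and columns by row words, so that [T] acting on row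
    words becomes multiplication by [transp_mx] on the right. *)
Definition zcomb (a : 'M[K]_(W, W)) : 'rV[S]_r :=
  \sum_k \sum_l (a k l)%:MP *: ew p q (enum_val l) (enum_val k).

Lemma zcomb_lin c a a' : zcomb (c *: a + a') = c%:MP *: zcomb a + zcomb a'.
Proof.
rewrite /zcomb scaler_sumr -big_split; apply: eq_bigr => k _ /=.
rewrite scaler_sumr -big_split; apply: eq_bigr => l _ /=.
by rewrite !mxE mpolyCD mpolyCM scalerDl scalerA.
Qed.

Lemma zcomb_delta k l : zcomb (delta_mx k l) = ew p q (enum_val l) (enum_val k).
Proof.
rewrite -[RHS](sum_delta (fun k' l' => ew p q (enum_val l') (enum_val k')) k l).
apply: eq_bigr => k' _; apply: eq_bigr => l' _; congr (_ *: _).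
by rewrite !mxE; case: (_ && _); rewrite ?mpolyC1 ?mpolyC0.
Qed.

Lemma zcomb_transp a : zcomb (a *m transp_mx d n K) =
  \sum_k \sum_l (a k l)%:MP *: transp_sum (fun r' => ew p q r' (enum_val k)) (enum_val l).
Proof.
have tS i j : (transp_mx d n K i j)%:MP = transp_mx d n S i j.
  rewrite !mxE rmorph_sum; apply: eq_bigr => s _; rewrite rmorph_sum; apply: eq_bigr => s' _ /=.
  by rewrite rmorphD /= !rmorph_nat.
apply: eq_bigr => k _.
under eq_bigr => l _ do rewrite mxE rmorph_sum scaler_suml.
rewrite exchange_big; apply: eq_bigr => l _ /=.
rewrite -(transp_mxE (fun r' => ew p q r' (enum_val k)) l) scaler_sumr.
by apply: eq_bigr => l' _; rewrite mpolyCM tS -scalerA.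
Qed.

Lemma syz_zcomb a : (0 < W)%N -> mu (zcomb a) = 0 -> Zp (zcomb a).
Proof.
move=> W0.
have step a' : mu (zcomb a') = 0 -> Zp (zcomb (a' *m transp_mx d n K)).
  move=> h; rewrite zcomb_transp.
  have h0 : \sum_k \sum_l (a' k l)%:MP *: hess (mu (ew p q (enum_val l) (enum_val k))) = 0.
    have hs0 : hess 0 = 0.
      by rewrite /hess big1 // => x _; rewrite big1 // => y _; rewrite !mderiv0 scale0r.
    have hsum (J : finType) (g : J -> S) : hess (\sum_i g i) = \sum_i hess (g i).
      apply: (big_morph hess) => // x y.
      by have := hess_lin 1 x y; rewrite mpolyC1 mul1r scale1r.
    rewrite -[RHS]hs0 -h rowev_sum hsum; apply: eq_bigr => k _.
    rewrite rowev_sum hsum; apply: eq_bigr => l _.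
    by rewrite rowevZ -[_ * _]addr0 hess_lin hs0 addr0.
  have Zpdiff A B : B = 0 -> Zp (B - A) -> Zp A by move=> -> /ZpN; rewrite sub0r opprK.
  apply: (Zpdiff _ _ h0); rewrite -sumrB; apply: Zp_sum => k _.
  by rewrite -sumrB; apply: Zp_sum => l _; rewrite -scalerBr; apply/ZpZ/hess_mu_ew.
move=> ha; apply: (transp_descent W0 charK (Z := fun a => Zp (zcomb a))).
- by move=> c a1 a2 h1 h2; rewrite zcomb_lin; apply: Zplin.
- by move=> a1 /Zpmu; apply: step.
- move=> a1 alt; suff -> : zcomb a1 = 0 by [].
  rewrite /zcomb big1 // => k _.
  set z := \sum_l _.
  have zN : z = - z.
    rewrite {1}/z (reindex_inj (h := fun l => enum_rank (wact (enum_val l) t))) /=.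
      rewrite -sumrN; apply: eq_bigr => l _.
      by rewrite enum_rankK ew_act // alt // enum_valK mpolyCN scaleNr.
    move=> l l' /enum_rank_inj /(congr1 (fun w => wact w t)).
    by rewrite !wact_tpermK => /enum_val_inj.
  have z2 : (2%:R : K)%:MP *: z = 0.
    by rewrite mpolyC_nat scaler_nat mulr2n {1}zN addNr.
  have n2 : (2%:R : K) != 0 by apply: natf_neq0_char0.
  by rewrite -[z]scale1r -mpolyC1 -(mulVf n2) mpolyCM -scalerA z2 scaler0.
exact: step.
Qed.

End Word.

Lemma mnm_word D (m : 'X_{1..n * n}) : mdeg m = D ->
  exists rr : 'I_D -> 'I_n, exists cc : 'I_D -> 'I_n, 'X_[m] = \prod_(s < D) X (rr s) (cc s).
Proof.
elim: D m => [|D IHD] m hm.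
  have i0 : 'I_0 -> 'I_n by case.
  exists i0, i0; rewrite big_ord0.
  by move/eqP: hm; rewrite mdeg_eq0 => /eqP->; rewrite mpolyX0.
have [t mt] : exists t, m t != 0%N.
  apply/existsP; apply: contraT; rewrite negb_exists => /forallP h.
  by move: hm; rewrite mdegE big1 // => t _; apply/eqP/negbNE/h.
have le : (U_(t) <= m)%MM by rewrite lep1mP.
have [|rr [cc e]] := IHD (m - U_(t))%MM.
  by have := congr1 mdeg (submK le); rewrite mdegD mdeg1 hm; lia.
case/mxvec_indexP: t le e {mt} => i j le e.
exists (fun s => if unlift ord0 s is Some s' then rr s' else i).
exists (fun s => if unlift ord0 s is Some s' then cc s' else j).
rewrite big_ord_recl unlift_none -(submK le) mpolyXD e mulrC; congr (_ * _).
by apply: eq_bigr => s _; rewrite liftK.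
Qed.

(** A coefficient monomial of degree [D] with its generator is a word of length [D.+2] whose first
    two letters are marked, so a single pair [p], [q] serves for all terms. *)
Lemma syz_generated D (s : I2 -> I2 -> S) :
  (forall a c, s a c \is D.-homog) ->
  mu (\sum_a \sum_c s a c *: G a c) = 0 -> Zp (\sum_a \sum_c s a c *: G a c).
Proof.
move=> hs.
pose p := ord0 : 'I_D.+2; pose q := lift ord0 ord0 : 'I_D.+2.
have pq : p != q by [].
(* Without letters there are no words, and the set of words must be nonempty for [syz_zcomb]. *)
have [/eqP n0|n0] := boolP (n == 0%N).
  by move=> _; rewrite big1 // => -[i j]; have := ltn_ord i; rewrite {2}n0.
have W0 : (0 < #|{: {ffun 'I_D.+2 -> 'I_n}}|)%N.
  by rewrite card_ffun !card_ord expn_gt0 lt0n n0.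
suff [a ->] : exists a, \sum_a \sum_c s a c *: G a c = zcomb p q a.
  exact: syz_zcomb.
pose P z := exists a, z = zcomb p q a.
have Plin c z z' : P z -> P z' -> P (c%:MP *: z + z').
  by move=> [a ->] [a' ->]; exists (c *: a + a'); rewrite zcomb_lin.
have PD z z' : P z -> P z' -> P (z + z').
  by move=> h h'; rewrite -[z]scale1r -mpolyC1; apply: Plin.
have Pew rr cc : P (ew p q rr cc).
  by exists (delta_mx (enum_rank cc) (enum_rank rr)); rewrite zcomb_delta !enum_rankK.
have P0 : P 0.
  exists 0; rewrite /zcomb big1 // => k _; rewrite big1 // => l _.
  by rewrite mxE mpolyC0 scale0r.
rewrite -/(P _); elim/big_ind: _ => // a _; elim/big_ind: _ => // c _.
rewrite [s a c]mpolyE scaler_suml.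
rewrite big_seq; elim/big_ind: _ => // m hm.
rewrite -mul_mpolyC -scalerA -[_ *: _]addr0; apply: Plin => //.
have [rr [cc ->]] := mnm_word (dhomogP _ _ _ (hs a c) _ hm).
pose rr' : {ffun 'I_D.+2 -> 'I_n} :=
  [ffun u => if unlift ord0 u is Some u1 then if unlift ord0 u1 is Some u2 then rr u2 else a.2 else a.1].
pose cc' : {ffun 'I_D.+2 -> 'I_n} :=
  [ffun u => if unlift ord0 u is Some u1 then if unlift ord0 u1 is Some u2 then cc u2 else c.2 else c.1].
suff <- : ew p q rr' cc' = (\prod_(s0 < D) X (rr s0) (cc s0)) *: G a c by [].
rewrite /ew /p /q !ffunE !unlift_none !liftK !unlift_none; congr (_ *: _); last first.
  by case: (a); case: (c).
rewrite big_mkcond big_ord_recl big_ord_recl /= !mul1r; apply: eq_bigr => u _.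
by rewrite !ffunE !liftK.
Qed.

End Syzygies.

(** * The beginning of the resolution *)

Section GradedRows.

Variables (K : fieldType) (N r : nat) (sh : 'I_r -> nat).
Local Notation S := {mpoly K[N]}.

Lemma row_homogP d (u : 'rV[S]_r) :
  row_homog sh d u <-> forall j m, (u 0 j)@_m != 0 -> (mdeg m + sh j)%N = d.
Proof.
split=> [/forallP h j m|h].
  by rewrite -mcoeff_msupp => hm; apply/eqP; have /allP := h j; apply.
by apply/forallP => j; apply/allP => m; rewrite mcoeff_msupp => /h ->.
Qed.

Lemma row_homog_delta j : row_homog sh (sh j) (delta_mx 0 j : 'rV[S]_r).
Proof.
apply/row_homogP => k m; rewrite mxE eqxx /=.
case: (k =P j) => [->|_]; last by rewrite mcoeff0 eqxx.
by rewrite mcoeff1; case: (m =P 0%MM) => [->|_]; rewrite ?mdeg0 // eqxx.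
Qed.

Lemma row_homog_sum d (I : Type) (l : seq I) (P : pred I) (f : I -> 'rV[S]_r) :
  (forall i, P i -> row_homog sh d (f i)) -> row_homog sh d (\sum_(i <- l | P i) f i).
Proof.
move=> h; elim/big_ind: _ => //.
  by apply/row_homogP => j m; rewrite mxE mcoeff0 eqxx.
move=> u v /row_homogP hu /row_homogP hv; apply/row_homogP => j m; rewrite mxE mcoeffD.
by have [-> |/hu //] := eqVneq ((u 0 j)@_m) 0; rewrite add0r; apply: hv.
Qed.

Lemma row_homogZ e d s (u : 'rV[S]_r) : s \is e.-homog -> row_homog sh d u ->
  row_homog sh (e + d) (s *: u).
Proof.
move=> /dhomogP hs /row_homogP hu; apply/row_homogP => j m; rewrite mxE.
rewrite -mcoeff_msupp => /msuppM_le /allpairsP[[m1 m2] /= [h1 h2 ->]].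
by rewrite mdegD -addnA (hs _ h1) (hu j) // -mcoeff_msupp.
Qed.

End GradedRows.

Definition crow (K : fieldType) (N r : nat) (u : 'rV[K]_r) : 'rV[{mpoly K[N]}]_r :=
  map_mx (@mpolyC N K) u.

Definition const_coef (K : fieldType) (N r : nat) (u : 'rV[{mpoly K[N]}]_r) : 'rV[K]_r :=
  map_mx (mcoeff 0%MM) u.

Section ConstRows.

Variables (K : fieldType) (N r : nat).
Local Notation S := {mpoly K[N]}.
Implicit Types (u v : 'rV[S]_r).

Lemma crowK : cancel (@crow K N r) (@const_coef K N r).
Proof. by move=> u; apply/rowP => j; rewrite !mxE mcoeffC eqxx mulr1. Qed.

Lemma crow_lin c (u v : 'rV[K]_r) : crow N (c *: u + v) = c%:MP *: crow N u + crow N v.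
Proof. by apply/rowP => j; rewrite !mxE mpolyCD mpolyCM. Qed.

Lemma crow0 : crow N (0 : 'rV[K]_r) = 0.
Proof. by apply/rowP => j; rewrite !mxE mpolyC0. Qed.

Lemma crow_sum (J : finType) (z : J -> 'rV[K]_r) : crow N (\sum_t z t) = \sum_t crow N (z t).
Proof.
apply: (big_morph _ _ crow0) => x y.
by have := crow_lin 1 x y; rewrite mpolyC1 !scale1r.
Qed.

Lemma const_coef_lin (s : S) u v :
  const_coef (s *: u + v) = s@_0%MM *: const_coef u + const_coef v.
Proof. by apply/rowP => j; rewrite !mxE mcoeffD rmorphM. Qed.

Lemma row_homog_crow sh d (u : 'rV[S]_r) : (forall j, sh j = d) ->
  row_homog sh d u <-> crow N (const_coef u) = u.
Proof.
move=> hsh; split=> [/row_homogP h|<-].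
  apply/rowP => j; rewrite !mxE; apply/mpolyP => m; rewrite mcoeffC.
  have [->|m0] := eqVneq m 0%MM; first by rewrite mulr1.
  rewrite mulr0; apply/esym/eqP; apply: contraNT m0 => /h; rewrite hsh => e.
  by rewrite -mdeg_eq0; lia.
apply/row_homogP => j m; rewrite !mxE mcoeffC.
have [->|m0] := eqVneq m 0%MM; first by rewrite mdeg0 hsh.
by rewrite mulr0 eqxx.
Qed.

End ConstRows.

(** * Ranks and degrees of the first modules of the resolution *)

Section Resolution.

Variables (K : fieldType) (charK : [pchar K] =i pred0) (n : nat) (F : min_resolution K n).
Local Notation S := (mxpolyring K n).
Local Notation I2 := ('I_n * 'I_n)%type.
Local Notation sh i := (@shift _ _ F i).

Lemma in_det_perp_const0 (g : S) : in_det_perp g -> g@_0%MM = 0.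
Proof.
move/(in_det_perp_perm2 charK) => [s ->]; rewrite raddf_sum big1 // => a _ /=.
rewrite raddf_sum big1 // => c _ /=; rewrite rmorphM /= rmorphD /= !rmorphM /=.
by rewrite !mcoeffX !mnm1_eq0 !mulr0 addr0 mulr0.
Qed.

Lemma bdry_const0 i (v : 'rV[S]_(rk F i.+1)) : const_coef (v *m bdry F i) = 0.
Proof.
apply/rowP => j; rewrite !mxE raddf_sum big1 // => k _ /=.
by rewrite rmorphM /= bdry_minimal mulr0.
Qed.

(* Nakayama's lemma: modulo boundaries a basis vector is a combination of elements of
   degree d only if it has degree d. *)
Lemma shift_eq i (j : 'I_(rk F i)) d (l : seq (S * 'rV[S]_(rk F i))) (v : 'rV[S]_(rk F i.+1)) :
  (forall x, x \in l -> row_homog (sh i) d x.2) ->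
  delta_mx 0 j - \sum_(x <- l) x.1 *: x.2 = v *m bdry F i -> sh i j = d.
Proof.
move=> hl e; have /rowP/(_ j) := bdry_const0 v; rewrite -e !mxE !eqxx summxE mcoeffB mcoeff1 eqxx.
move/eqP; rewrite subr_eq0 => /eqP h1.
have [/hasP[x xl hx]|/hasPn no] := boolP (has (fun x : S * 'rV[S]_(rk F i) => (x.2 0 j)@_0%MM != 0) l).
  by have /row_homogP/(_ j 0%MM hx) := hl x xl; rewrite mdeg0.
have /eqP := h1; rewrite raddf_sum big1_seq ?oner_eq0 // => x /= xl.
rewrite mxE rmorphM /=; have /negbNE/eqP -> := no x xl.
by rewrite mulr0.
Qed.

Lemma bdry_entry_homog i t k m : (bdry F i t k)@_m != 0 -> (mdeg m + sh i k)%N = sh i.+1 t.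
Proof.
have /bdry_homog/row_homogP := row_homog_delta K (n * n) (sh i.+1) t.
by rewrite -rowE => h hm; apply: h; rewrite mxE.
Qed.

Definition row_comp r (s : 'I_r -> nat) d (v : 'rV[S]_r) : 'rV[S]_r :=
  \row_j \sum_(m <- msupp (v 0 j) | (mdeg m + s j)%N == d) (v 0 j)@_m *: 'X_[m].

Lemma row_comp_coef r (s : 'I_r -> nat) d (v : 'rV[S]_r) j m :
  (row_comp s d v 0 j)@_m = if (mdeg m + s j)%N == d then (v 0 j)@_m else 0.
Proof.
rewrite mxE raddf_sum /=.
have [hm|hm] := boolP (m \in msupp (v 0 j)).
  rewrite big_mkcond (bigD1_seq m) ?msupp_uniq //= big1 ?addr0.
    by case: ifP => // _; rewrite mcoeffZ mcoeffX eqxx mulr1.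
  by move=> m' /negbTE ne; case: ifP => // _; rewrite mcoeffZ mcoeffX ne mulr0.
rewrite (memN_msupp_eq0 hm) if_same big1_seq // => m' /andP[_ hm'].
rewrite mcoeffZ mcoeffX; case: eqP => [e|_]; last by rewrite mulr0.
by rewrite -e hm' in hm.
Qed.

(** The entries of the boundary matrix are homogeneous, so the component of [v] in degree [d] has
    the same image. *)
Lemma homog_lift i d (v : 'rV[S]_(rk F i.+1)) : row_homog (sh i) d (v *m bdry F i) ->
  exists2 v', row_homog (sh i.+1) d v' & v' *m bdry F i = v *m bdry F i.
Proof.
move=> /row_homogP hv; exists (row_comp (sh i.+1) d v).
  apply/row_homogP => j m; rewrite row_comp_coef.
  by case: ifP => [/eqP -> //|_]; rewrite eqxx.
have /bdry_homog/row_homogP hv' : row_homog (sh i.+1) d (row_comp (sh i.+1) d v).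
  apply/row_homogP => j m; rewrite row_comp_coef.
  by case: ifP => [/eqP -> //|_]; rewrite eqxx.
apply/rowP => k; apply/mpolyP => m.
have [hm|hm] := eqVneq (mdeg m + sh i k)%N d; last first.
  transitivity (0 : K).
    by apply/eqP; apply: contraNT hm => /hv' ->.
  by apply/esym/eqP; apply: contraNT hm => /hv ->.
rewrite !mxE !raddf_sum; apply: eq_bigr => t _ /=.
rewrite !mcoeffM; apply: eq_bigr => -[m1 m2] /= /eqP e.
have [->|hb] := eqVneq ((bdry F i t k)@_m2) 0; first by rewrite !mulr0.
have h2 := bdry_entry_homog hb.
rewrite row_comp_coef; have -> : (mdeg m1 + sh i.+1 t == d)%N; last by [].
by rewrite -h2 addnA -mdegD -e hm.
Qed.

(** Since 1 is hit modulo the apolar ideal, which has no constant terms, some entry of [aug] has a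
    nonzero constant term and is constant by degree. Any other basis vector, corrected by a multiple
    of this one, lies in the kernel, hence is a boundary with constant term 1, against
    minimality. *)
Lemma rk0_basis : exists j0 : 'I_(rk F 0), exists c : K,
  [/\ forall j, j = j0, aug F j0 0 = c%:MP, c != 0 & sh 0%N j0 = 0%N].
Proof.
have [u hu] := @aug_surj _ _ F 1.
have [j0 hj0] : exists j0, (aug F j0 0)@_0%MM != 0.
  apply/existsP; apply: contraT; rewrite negb_exists => /forallP no.
  have /eqP := in_det_perp_const0 hu; rewrite mcoeffB mcoeff1 eqxx mxE raddf_sum big1 ?subr0 ?oner_eq0 // => j _ /=.
  by rewrite rmorphM /=; have /negbNE/eqP-> := no j; rewrite mulr0.
have hom := aug_homog (row_homog_delta K (n * n) (sh 0) j0).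
have augE j : ((delta_mx 0 j : 'rV_(rk F 0)) *m aug F) 0 0 = aug F j 0 by rewrite -rowE mxE.
have sh0 : sh 0%N j0 = 0%N.
  by have := dhomogP _ _ _ hom 0%MM; rewrite augE mcoeff_msupp => /(_ hj0) <-; exact: mdeg0.
pose c := (aug F j0 0)@_0%MM.
have augc : aug F j0 0 = c%:MP.
  rewrite augE sh0 in hom; apply/mpolyP => m; rewrite mcoeffC.
  have [->|m0] := eqVneq m 0%MM; first by rewrite mulr1.
  rewrite mulr0; apply/eqP; apply: contraNT m0.
  by rewrite -mcoeff_msupp => /(dhomogP _ _ _ hom) e; rewrite -mdeg_eq0; apply/eqP.
exists j0, c; split=> // j; apply/eqP; apply: contraT => jj0.
pose w : 'rV[S]_(rk F 0) := delta_mx 0 j - ((c^-1)%:MP * aug F j 0) *: delta_mx 0 j0.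
have w0 : (w *m aug F) 0 0 = 0.
  rewrite mulmxBl -scalemxAl mxE augE mxE mxE augE augc.
  by rewrite mulrAC -mpolyCM mulVf // mpolyC1 mul1r subrr.
have [v ev] : exists v, w = v *m bdry F 0 by apply/exact_aug; rewrite w0; apply: in_det_perp0.
have /rowP/(_ j) := bdry_const0 v; rewrite -ev !mxE !eqxx (negbTE jj0) /= mulr0 subr0.
by rewrite mcoeff1 eqxx => /eqP; rewrite oner_eq0.
Qed.

(** As F_0 has rank one and a nonzero constant augmentation, composing with [aug] does not change
    the kernel of the boundary, and turns it into a column of generators of the ideal. *)
Definition gen_map : 'cV[S]_(rk F 1) := bdry F 0 *m aug F.
Local Notation mu := (rowev gen_map).

Lemma gen_map_perp v : in_det_perp (mu v).
Proof. by rewrite /rowev mulmxA; apply/exact_aug; exists v. Qed.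

Lemma gen_map_eq0 v : mu v = 0 <-> exists w, v = w *m bdry F 1.
Proof.
rewrite -exact_bdry /rowev mulmxA; split=> [h|->]; last by rewrite mul0mx mxE.
have [j0 [c [hj0 augc c0 _]]] := rk0_basis.
apply/rowP => j; rewrite (hj0 j) [RHS]mxE; apply/eqP.
move/eqP: h; rewrite mxE (bigD1 j0) //= big1 ?addr0 ?augc.
  by rewrite mulf_eq0 mpolyC_eq0 (negbTE c0) orbF.
by move=> k; rewrite (hj0 k) eqxx.
Qed.

Lemma perm2_homog (a c : I2) : perm2 K a c \is 2.-homog.
Proof.
apply: rpredD; rewrite -mpolyXD; apply/dhomogP => m; rewrite msuppX inE => /eqP ->;
by rewrite -[LHS]/(mdeg _) mdegD !mdeg1.
Qed.

Lemma quad_lift_ex a c : exists g : 'rV[S]_(rk F 1), row_homog (sh 1%N) 2 g /\ mu g = perm2 K a c.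
Proof.
have [j0 [k [hj0 augc k0 sh0]]] := rk0_basis.
pose w : 'rV[S]_(rk F 0) := ((k^-1)%:MP * perm2 K a c) *: delta_mx 0 j0.
have wE : (w *m aug F) 0 0 = perm2 K a c.
  rewrite -scalemxAl mxE -rowE mxE augc mulrC mulrA -mpolyCM mulfV // mpolyC1.
  by rewrite mul1r.
have [v ev] : exists v, w = v *m bdry F 0.
  by apply/exact_aug; rewrite wE; apply: perm2_in_perp.
have hw : row_homog (sh 0%N) 2 w.
  have h2 : (k^-1)%:MP * perm2 K a c \is 2.-homog.
    by rewrite mul_mpolyC; apply: rpredZ; apply: perm2_homog.
  by have := row_homogZ h2 (row_homog_delta K (n * n) (sh 0) j0); rewrite sh0 addn0.
rewrite ev in hw; have [v' hv' ev'] := homog_lift hw.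
by exists v'; split=> //; rewrite /rowev mulmxA ev' -ev.
Qed.

Lemma shift1 j : sh 1%N j = 2%N.
Proof.
have [s es] := (in_det_perp_perm2 charK _).1 (gen_map_perp (delta_mx 0 j)).
have [g hg] : exists g : I2 -> I2 -> 'rV[S]_(rk F 1),
    forall a c, row_homog (sh 1%N) 2 (g a c) /\ mu (g a c) = perm2 K a c.
  have := fin_all_exists (fun a => fin_all_exists (quad_lift_ex a)).
  by case=> g hg; exists g.
pose l := [seq (s x.1 x.2, g x.1 x.2) | x <- index_enum (I2 * I2)%type].
have [v ev] : exists v, delta_mx 0 j - \sum_(x <- l) x.1 *: x.2 = v *m bdry F 1.
  apply/gen_map_eq0; rewrite big_map -scaleN1r addrC rowev_lin es rowev_sum mulN1r.
  rewrite pair_bigA /= addrC; apply/eqP; rewrite subr_eq0; apply/eqP; apply: eq_bigr => x _.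
  by rewrite rowevZ (hg _ _).2.
by apply: shift_eq ev => x /mapP[y _ ->]; apply: (hg _ _).1.
Qed.

Lemma gen_map_inj (u v : 'rV[K]_(rk F 1)) : mu (crow _ u) = mu (crow _ v) -> u = v.
Proof.
move=> e; have [w ew] : exists w, crow (n * n) (u - v) = w *m bdry F 1.
  apply/gen_map_eq0; rewrite -scaleN1r addrC crow_lin rowev_lin e mpolyCN mpolyC1 mulN1r.
  exact: addNr.
have := bdry_const0 w; rewrite -ew crowK => /eqP; rewrite subr_eq0.
by move/eqP.
Qed.

Lemma quad_gen_ex : exists g : I2 -> I2 -> 'rV[K]_(rk F 1),
  forall a c, mu (crow _ (g a c)) = perm2 K a c.
Proof.
have [g hg] := fin_all_exists (fun a => fin_all_exists (quad_lift_ex a)).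
exists (fun a c => const_coef (g a c)) => a c; have [h1 h2] := hg a c.
by rewrite ((row_homog_crow _ shift1).1 h1).
Qed.

Section Generators.

Variable (g : I2 -> I2 -> 'rV[K]_(rk F 1)).
Hypothesis gP : forall a c, mu (crow _ (g a c)) = perm2 K a c.
Local Notation G a c := (crow (n * n) (g a c)).

Lemma quad_gen_swapL a c : g (a.2, a.1) c = g a c.
Proof. by apply: gen_map_inj; rewrite !gP /perm2 /= addrC; congr (_ + _); exact: mulrC. Qed.

Lemma quad_gen_swapR a c : g a (c.2, c.1) = g a c.
Proof. by apply: gen_map_inj; rewrite !gP /perm2 /= addrC. Qed.

Lemma quad_gen_homog a c : row_homog (sh 1%N) 2 (G a c).
Proof. by apply/(row_homog_crow _ shift1); rewrite crowK. Qed.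

(** In an expression with polynomial coefficients, passing to constant terms loses nothing, because
    the error is a boundary. *)
Lemma quad_gen_span (u : 'rV[K]_(rk F 1)) :
  exists k : I2 -> I2 -> K, u = \sum_a \sum_c k a c *: g a c.
Proof.
have [s es] := (in_det_perp_perm2 charK _).1 (gen_map_perp (crow _ u)).
exists (fun a c => (s a c)@_0%MM).
have [w ew] : exists w, crow _ u - \sum_a \sum_c s a c *: G a c = w *m bdry F 1.
  apply/gen_map_eq0; rewrite -scaleN1r addrC rowev_lin es rowev_sum mulN1r addrC.
  apply/eqP; rewrite subr_eq0; apply/eqP; apply: eq_bigr => a _.
  by rewrite rowev_sum; apply: eq_bigr => c _; rewrite rowevZ gP.
have := bdry_const0 w; rewrite -ew => /eqP.
rewrite -scaleN1r addrC const_coef_lin crowK mcoeffN mcoeff1 eqxx scaleN1r addrC subr_eq0.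
move=> /eqP ->; apply/rowP => j; rewrite mxE !summxE raddf_sum; apply: eq_bigr => a _ /=.
rewrite !summxE raddf_sum; apply: eq_bigr => c _ /=.
by rewrite !mxE rmorphM /= mcoeffC eqxx mulr1.
Qed.

Lemma quad_gen_span_homog D (z : 'rV[S]_(rk F 1)) : (forall j, z 0 j \is D.-homog) ->
  exists s : I2 -> I2 -> S,
    (forall a c, s a c \is D.-homog) /\ z = \sum_a \sum_c s a c *: G a c.
Proof.
move=> hz; have [k hk] := fin_all_exists (fun j => quad_gen_span (delta_mx 0 j)).
exists (fun a c => \sum_j (k j a c)%:MP * z 0 j); split.
  by move=> a c; apply: rpred_sum => j _; rewrite mul_mpolyC; apply: rpredZ.
rewrite [LHS]row_sum_delta; apply/rowP => i; rewrite !summxE.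
transitivity (\sum_j \sum_a \sum_c (k j a c)%:MP * z 0 j * (g a c 0 i)%:MP).
  apply: eq_bigr => j _; rewrite mxE.
  have -> : (delta_mx 0 j : 'rV[S]_(rk F 1)) 0 i = (((delta_mx 0 j : 'rV[K]_(rk F 1)) 0 i)%:MP).
    by rewrite !mxE; case: (_ && _); rewrite ?mpolyC1 ?mpolyC0.
  rewrite hk summxE raddf_sum mulr_sumr; apply: eq_bigr => a _ /=.
  rewrite summxE raddf_sum mulr_sumr; apply: eq_bigr => c _ /=.
  by rewrite mxE mpolyCM mulrA [z 0 j * _]mulrC.
rewrite exchange_big; apply: eq_bigr => a _ /=; rewrite summxE exchange_big.
by apply: eq_bigr => c _ /=; rewrite mxE mulr_suml mxE.
Qed.

(** The instance of the predicate [Zp]. The preimage is kept as a list of coefficients and degree 3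
    elements, the form that [shift_eq] accepts. *)
Definition cubic_span (z : 'rV[S]_(rk F 1)) : Prop :=
  exists l : seq (S * 'rV[S]_(rk F 2)),
    (forall x, x \in l -> row_homog (sh 2%N) 3 x.2) /\
    z = (\sum_(x <- l) x.1 *: x.2) *m bdry F 1.

Lemma cubic_span0 : cubic_span 0.
Proof. by exists [::]; split => //; rewrite big_nil mul0mx. Qed.

Lemma cubic_span_lin s u v : cubic_span u -> cubic_span v -> cubic_span (s *: u + v).
Proof.
move=> [l [hl ->]] [l' [hl' ->]]; exists ([seq (s * x.1, x.2) | x <- l] ++ l'); split.
  by move=> x; rewrite mem_cat => /orP[/mapP[y yl ->]|/hl' //]; apply: hl yl.
rewrite big_cat big_map /=.
have -> : \sum_(x <- l) (s * x.1) *: x.2 = s *: \sum_(x <- l) x.1 *: x.2.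
  by rewrite scaler_sumr; apply: eq_bigr => x _; rewrite scalerA.
by rewrite mulmxDl scalemxAl.
Qed.

Lemma cubic_spanE z : row_homog (sh 1%N) 3 z -> mu z = 0 -> cubic_span z.
Proof.
move=> hz /gen_map_eq0[w ew]; rewrite ew in hz *.
have [w' hw' <-] := homog_lift hz.
exists [:: (1, w')]; rewrite big_seq1 scale1r; split => // x.
by rewrite inE => /eqP->.
Qed.

Lemma shift2 j : sh 2%N j = 3%N.
Proof.
pose z := (delta_mx 0 j : 'rV_(rk F 2)) *m bdry F 1.
have z0 : mu z = 0 by apply/gen_map_eq0; exists (delta_mx 0 j).
have hz : row_homog (sh 1%N) (sh 2%N j) z by apply/bdry_homog/row_homog_delta.
have nz : z <> 0.
  rewrite /z => /exact_bdry[v ev].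
  have /rowP/(_ j) := bdry_const0 v; rewrite -ev !mxE !eqxx mcoeff1 eqxx => /eqP.
  by rewrite oner_eq0.
(* This makes the truncated difference [sh 2%N j - 2] below the true degree of the coefficients. *)
have ge2 : (2 <= sh 2%N j)%N.
  rewrite leqNgt; apply/negP => lt2; apply: nz; apply/rowP => k; apply/mpolyP => m.
  rewrite [in RHS]mxE mcoeff0; apply/eqP; apply: contraLR lt2 => h.
  by have /row_homogP/(_ k m h) := hz; rewrite shift1; lia.
have [|s [hs zE]] := @quad_gen_span_homog (sh 2%N j - 2) z.
  move=> k; apply/dhomogP => m; rewrite mcoeff_msupp => h.
  have /row_homogP/(_ k m h) := hz; rewrite shift1 => <-; by rewrite addnK.
have Zz : cubic_span z.
  rewrite zE; apply: (syz_generated charK (b := gen_map)) hs _.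
  - by move=> a c; rewrite quad_gen_swapL.
  - by move=> a c; rewrite quad_gen_swapR.
  - exact: gP.
  - exact: cubic_span0.
  - exact: cubic_span_lin.
  - by move=> u [l [_ ->]]; apply/gen_map_eq0; eexists.
  - move=> q u hu; apply: cubic_spanE hu; rewrite /u; apply: row_homog_sum => x _.
    rewrite -[3%N]/(1 + 2)%N; apply: row_homogZ; last exact: quad_gen_homog.
    rewrite -signr_odd; case: (odd _); rewrite ?expr1 ?expr0 ?mulN1r ?mul1r ?rpredN;
    by apply/dhomogP => m; rewrite msuppX inE => /eqP ->; exact: mdeg1.
  by rewrite -zE.
have [l [hl el]] := Zz.
have [v ev] : exists v, delta_mx 0 j - \sum_(x <- l) x.1 *: x.2 = v *m bdry F 2.
  by apply/exact_bdry; rewrite mulmxBl -el subrr.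
exact: shift_eq hl ev.
Qed.

End Generators.
End Resolution.

(** * Highest weight representations *)

Section Subspaces.

Variables (K : fieldType) (V : vectType K) (Q : V -> Prop).
Hypothesis Q0 : Q 0.
Hypothesis Qlin : forall c u v, Q u -> Q v -> Q (c *: u + v).

(** A subspace inside [Q] is enlarged one vector at a time; if it never exhausted [Q], its dimension
    would exceed that of [V]. Excluded middle is used because [Q] will quantify over the whole
    group. *)
Lemma vspace_of_pred : exists U : {vspace V}, forall u, u \in U <-> Q u.
Proof.
have [//|no] := classic (exists U : {vspace V}, forall u, u \in U <-> Q u).
have big k : exists2 U : {vspace V}, (forall u, u \in U -> Q u) & (k <= \dim U)%N.
  elim: k => [|k [U hU dU]].
    by exists 0%VS => // u; rewrite memv0 => /eqP ->.
  have [u Qu uU] : exists2 u, Q u & u \notin U.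
    apply: NNPP => no'; apply: no; exists U => u; split; first exact: hU.
    by move=> Qu; apply: contraT => uU; case: no'; exists u.
  exists (<[u]> + U)%VS.
    move=> w /memv_addP[_ /vlineP[c ->]] [w' w'U ->].
    by apply: Qlin => //; apply: hU.
  have /dimv_disjoint_sum -> : (<[u]> :&: U = 0)%VS.
    apply/eqP; rewrite -subv0; apply/subvP => w; rewrite memv_cap => /andP[/vlineP[c ->] cU].
    have [->|c0] := eqVneq c 0; first by rewrite scale0r mem0v.
    by move: uU; rewrite -[u](scalerK c0) memvZ.
  rewrite dim_vline; have -> : u != 0 by apply: contraNneq uU => ->; rewrite mem0v.
  by rewrite addnC addn1 ltnS.
have [U _] := big (\dim {:V}).+1.
by rewrite ltnNge dimvS ?subvf.
Qed.

End Subspaces.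

Lemma gl_irreducible_pred (K : fieldType) (n d : nat) (rho : 'M[K]_n -> 'M[K]_d)
    (Q : 'cV[K]_d -> Prop) : gl_irreducible rho -> Q 0 ->
  (forall c u v, Q u -> Q v -> Q (c *: u + v)) ->
  (forall A u, A \in unitmx -> Q u -> Q (rho A *m u)) ->
  (exists2 u, Q u & u != 0) -> forall u, Q u.
Proof.
move=> [_ irr] Q0 Qlin Qst [v Qv v0] u.
have [U hU] := vspace_of_pred Q0 Qlin.
have [A w Au /hU wU|U0|U1] := irr U; first by apply/hU/Qst.
  by move/hU: Qv; rewrite U0 memv0 (negbTE v0).
by apply/hU; rewrite U1 memvf.
Qed.

(** * LU decomposition of generic matrices *)

Section LU.

(** The product of the pivots of fraction-free elimination. The Schur complement is multiplied by
    the corner entry to remain polynomial, so that [pivots] commutes with evaluation. *)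
Fixpoint pivots (R : comPzRingType) (n : nat) : 'M[R]_n -> R :=
  match n return 'M[R]_n -> R with
  | 0 => fun _ => 1
  | m.+1 => fun A : 'M[R]_(1 + m) =>
      A 0 0 * pivots (A 0 0 *: drsubmx A - dlsubmx A *m ursubmx A)
  end.

Lemma map_pivots (R R' : comPzRingType) (f : {rmorphism R -> R'}) n (A : 'M[R]_n) :
  pivots (map_mx f A) = f (pivots A).
Proof.
elim: n A => [|n IHn] A; first by rewrite /= rmorph1.
rewrite /= rmorphM /= -IHn mxE; congr (_ * _).
by rewrite map_mxB map_mxZ map_mxM map_drsubmx map_dlsubmx map_ursubmx.
Qed.

Definition lower_unitri (R : comPzRingType) n (L : 'M[R]_n) :=
  (forall i j : 'I_n, (i < j)%N -> L i j = 0) /\ forall i, L i i = 1.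

Definition upper_tri (R : comPzRingType) n (U : 'M[R]_n) :=
  forall i j : 'I_n, (j < i)%N -> U i j = 0.

Lemma LU_of_pivots (K : fieldType) n (A : 'M[K]_n) : pivots A != 0 ->
  exists L U, [/\ lower_unitri L, upper_tri U & A = L *m U].
Proof.
elim: n A => [|n IHn] A.
  by move=> _; exists 1%:M, 1%:M; split; [split; case|case|rewrite [LHS]flatmx0 [RHS]flatmx0].
rewrite -[n.+1]/(1 + n)%N in A * => /=; rewrite mulf_eq0 negb_or => /andP[a0 /IHn[L [U [[L0 L1] U0 e]]]].
set a := A 0 0 in a0 e.
pose L' : 'M[K]_(1 + n) := block_mx 1%:M 0 (a^-1 *: dlsubmx A) L.
pose U' : 'M[K]_(1 + n) := block_mx (ulsubmx A) (ursubmx A) 0 (a^-1 *: U).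
have aE : ulsubmx A = a%:M.
  by rewrite [LHS]mx11_scalar !mxE /=; congr (A _ _)%:M; apply: val_inj.
exists L', U'; split.
- split=> [i j|i].
    case: (split_ordP i) => [i'|i'] ->; case: (split_ordP j) => [j'|j'] -> //=.
    + by rewrite !ord1.
    + by rewrite block_mxEur mxE.
    + by rewrite ord1.
    + by rewrite block_mxEdr => /L0.
  case: (split_ordP i) => [i'|i'] ->; first by rewrite block_mxEul mxE eqxx.
  by rewrite block_mxEdr L1.
- move=> i j.
  case: (split_ordP i) => [i'|i'] ->; case: (split_ordP j) => [j'|j'] -> //=.
  + by rewrite !ord1.
  + by rewrite ord1.
  + by rewrite block_mxEdl mxE.
  + by rewrite block_mxEdr mxE => /U0 ->; rewrite mulr0.
rewrite mulmx_block !mul1mx !mul0mx mulmx0 !addr0 -[LHS](@submxK _ 1 n 1 n).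
congr block_mx; first by rewrite aE mul_mx_scalar scalerA mulfV // scale1r.
rewrite -scalemxAl -scalemxAr -e -scalerDr addrC subrK scalerA mulVf ?scale1r //.
Qed.

(** Diagonal entries of degree [m] dominate off-diagonal ones of smaller degree. One elimination
    step preserves this pattern with [m] doubled. *)
Lemma pivots_dominant (K : fieldType) n m (A : 'M[{poly K}]_n) :
  (forall i, size (A i i) = m.+1) -> (forall i j, i != j -> (size (A i j) <= m)%N) ->
  pivots A != 0.
Proof.
elim: n m A => [|n IHn] m A hd ho; first exact: oner_neq0.
rewrite -[n.+1]/(1 + n)%N in A hd ho *; rewrite /= mulf_eq0 negb_or.
have a0 : A 0 0 != 0 by rewrite -size_poly_eq0 hd.
rewrite a0 /=.
have szc i j : (size ((dlsubmx A *m ursubmx A) i j) <= m.*2.-1)%N.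
  rewrite !mxE big_ord1 !mxE; apply: (leq_trans (size_polyMleq _ _)).
  have h1 : (size (A (rshift 1 i) (lshift n ord0)) <= m)%N by apply: ho.
  have h2 : (size (A (lshift n ord0) (rshift 1 j)) <= m)%N by apply: ho.
  lia.
have szN i j : (size (- (dlsubmx A *m ursubmx A) i j) <= m.*2.-1)%N by rewrite size_polyN.
have ent i j : (A 0 0 *: drsubmx A - dlsubmx A *m ursubmx A) i j =
    A 0 0 * A (rshift 1 i) (rshift 1 j) + - (dlsubmx A *m ursubmx A) i j.
  by rewrite mxE; congr (_ + _); rewrite !mxE.
apply: (IHn m.*2) => [i|i j ij]; rewrite ent.
  have e : size (A 0 0 * A (rshift 1 i) (rshift 1 i)) = m.*2.+1.
    by rewrite size_mul ?hd -?size_poly_eq0 ?hd //; lia.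
  rewrite size_polyDl e //; apply: leq_ltn_trans (szN i i) _; lia.
apply: (leq_trans (size_polyD _ _)); rewrite geq_max; apply/andP; split.
  apply: (leq_trans (size_polyMleq _ _)); rewrite hd.
  have h : (size (A (rshift 1 i) (rshift 1 j)) <= m)%N.
    by apply: ho; apply: contraNneq ij => /rshift_inj ->.
  lia.
by apply: (leq_trans (szN i j)); lia.
Qed.

End LU.

(** * A functional evaluating the highest weight function on group elements *)

Section HighestWeightFunctional.

Variables (K : fieldType) (charK : [pchar K] =i pred0).

Lemma poly_eq0_infinite (p : {poly K}) : (forall k : nat, p.[k.+1%:R] = 0) -> p = 0.
Proof.
move=> hp; apply/eqP; apply: contraT => p0.
have /(max_poly_roots p0) : all (root p) [seq (k.+1%:R : K) | k <- iota 0 (size p)].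
  by apply/allP => x /mapP[k _ ->]; rewrite rootE hp.
rewrite size_map size_iota ltnn; apply.
rewrite map_inj_uniq ?iota_uniq // => k l /eqP.
have inj (a b : nat) : (a <= b)%N -> (a%:R == b%:R :> K) -> a = b.
  move=> ab; rewrite eq_sym -subr_eq0 -natrB //.
  move/pcharf0P: charK => ->; rewrite subn_eq0 => ba.
  by apply/eqP; rewrite eqn_leq ab.
case: (leqP k l) => [kl|/ltnW lk] e; first by have [] := inj k.+1 l.+1 kl e.
by rewrite eq_sym in e; have [] := inj l.+1 k.+1 lk e.
Qed.

Lemma poly_eq0_generic (p q : {poly K}) : q != 0 ->
  (forall x, q.[x] != 0 -> p.[x] = 0) -> p = 0.
Proof.
move=> q0 h; have : p * q = 0.
  apply: poly_eq0_infinite => k; rewrite hornerM.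
  by have [->|/h ->] := eqVneq (q.[k.+1%:R]) 0; rewrite ?mulr0 ?mul0r.
by move/eqP; rewrite mulf_eq0 (negbTE q0) orbF => /eqP.
Qed.

Variables (n d : nat).
Local Notation S := (mxpolyring K n).
Local Notation ev x := (map_mx (horner_eval (x : K))).

Lemma ev_mulmx x a b c (A : 'M[{poly K}]_(a, b)) (B : 'M_(b, c)) i j :
  ((A *m B) i j).[x] = (ev x A *m ev x B) i j.
Proof. by rewrite -map_mxM [RHS]mxE. Qed.

Lemma ev_const x a b (A : 'M[K]_(a, b)) : ev x (map_mx polyC A) = A.
Proof. by apply/matrixP => i j; rewrite !mxE /horner_eval hornerC. Qed.

(** The values of [det^e rho] along a polynomial path of matrices. Unlike [rho], this makes sense
    also at the parameters where the path is singular. *)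
Definition path_mx (P : 'M[S]_d) (Gam : 'M[{poly K}]_n) : 'M[{poly K}]_d :=
  \matrix_(i, j) mmap polyC (mxvec Gam 0) (P i j).

Lemma path_mxE P Gam x :
  ev x (path_mx P Gam) = \matrix_(i, j) (P i j).@[mxvec (ev x Gam) 0].
Proof.
apply/matrixP => i j; rewrite !mxE /horner_eval /meval /mmap horner_sum.
apply: eq_bigr => m _; rewrite hornerM hornerC; congr (_ * _).
rewrite /mmap1 horner_prod; apply: eq_bigr => t _; rewrite horner_exp; congr (_ ^+ _).
by case/mxvec_indexP: t => k l; rewrite !mxvecE mxE.
Qed.

Variables (rho : 'M[K]_n -> 'M[K]_d) (e : nat) (P : 'M[S]_d).
Hypothesis rho1 : rho 1%:M = 1%:M.
Hypothesis rhoM : forall A B, A \in unitmx -> B \in unitmx -> rho (A *m B) = rho A *m rho B.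
Hypothesis rhoP : forall A, A \in unitmx ->
  \det A ^+ e *: rho A = \matrix_(i, j) (P i j).@[mxvec A 0].

Lemma rho_path Gam x : ev x Gam \in unitmx ->
  \det (ev x Gam) ^+ e *: rho (ev x Gam) = ev x (path_mx P Gam).
Proof. by move=> /rhoP ->; rewrite path_mxE. Qed.

Variables (lambda : seq nat) (v : 'cV[K]_d).
Hypothesis v_neq0 : v != 0.
Hypothesis hw : forall B : 'M[K]_n, B \in unitmx -> upper_tri B ->
  rho B *m v = (\prod_(i < n) B i i ^+ nth 0%N lambda i) *: v.

Definition torus_path : 'M[{poly K}]_n := \matrix_(i, j) (if i == j then 'X^i else 0).

(** The conjugate of [L] by [torus_path], for lower triangular [L]; the truncation of [i - j]
    matters only where [L] is zero. At parameter 0 it becomes the identity. *)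
Definition lower_path (L : 'M[K]_n) : 'M[{poly K}]_n :=
  \matrix_(i, j) ((L i j)%:P * 'X^(i - j)).

Lemma lower_unitri_det (L : 'M[K]_n) : lower_unitri L -> \det L = 1.
Proof.
by move=> [L0 L1]; rewrite det_trig; [rewrite big1|apply/is_trig_mxP].
Qed.

Lemma lower_unitri_unit (L : 'M[K]_n) : lower_unitri L -> L \in unitmx.
Proof. by move=> hL; rewrite unitmxE lower_unitri_det ?unitr1. Qed.

Lemma ev_torusE x i j : ev x torus_path i j = if i == j then x ^+ i else 0.
Proof. by rewrite !mxE /horner_eval; case: eqP; rewrite ?hornerXn ?horner0. Qed.

Lemma ev_lowerE L x i j : ev x (lower_path L) i j = L i j * x ^+ (i - j).
Proof. by rewrite !mxE /horner_eval hornerM hornerC hornerXn. Qed.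

Lemma ev_lower_unitri L x : lower_unitri L -> lower_unitri (ev x (lower_path L)).
Proof.
move=> [L0 L1]; split=> [i j ij|i]; rewrite ev_lowerE; first by rewrite L0 ?mul0r.
by rewrite L1 subnn expr0 mulr1.
Qed.

Lemma ev_torus_upper x : upper_tri (ev x torus_path).
Proof. by move=> i j ji; rewrite ev_torusE; case: eqP => // e'; rewrite e' ltnn in ji. Qed.

Lemma ev_torus_det x : \det (ev x torus_path) = x ^+ (\sum_(i < n) i).
Proof.
rewrite det_trig; last first.
  by apply/is_trig_mxP => i j ij; rewrite ev_torusE; case: eqP => // e'; rewrite e' ltnn in ij.
rewrite expr_sum; apply: eq_bigr => i _; by rewrite ev_torusE eqxx.
Qed.

Lemma torus_lower L x : lower_unitri L ->
  ev x torus_path *m L = ev x (lower_path L) *m ev x torus_path.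
Proof.
move=> [L0 L1]; apply/matrixP => i j; rewrite [LHS]mxE [RHS]mxE.
rewrite (bigD1 i) //= big1 ?addr0; last first.
  by move=> k ki; rewrite ev_torusE eq_sym (negbTE ki) mul0r.
rewrite [RHS](bigD1 j) //= [X in _ + X]big1 ?addr0; last first.
  by move=> k kj; rewrite ev_torusE (negbTE kj) mulr0.
rewrite !ev_torusE !eqxx ev_lowerE.
have [ij|ji] := ltnP i j; first by rewrite L0 // mulr0 !mul0r.
by rewrite -mulrA -exprD subnK // mulrC.
Qed.

(* Conjugation by the torus contracts the lower unipotent group to the identity, so the
   component of lowest torus degree of [rho (L *m U) *m v] is a multiple of [v]. *)
Lemma hw_functional_LU : exists l : 'rV[K]_d, forall L U,
  lower_unitri L -> upper_tri U -> U \in unitmx ->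
  l *m (rho (L *m U) *m v) = (\prod_(i < n) U i i ^+ nth 0%N lambda i)%:M.
Proof.
(* At parameter [x] the torus path has determinant [x^N] and acts on [v] by [x^k0]; together with
   the denominator [det^e] this gives the degree [N * e + k0] extracted by [Pi]. *)
pose N := (\sum_(i < n) i)%N; pose k0 := (\sum_(i < n) i * nth 0 lambda i)%N.
pose Pi : 'M[K]_d := map_mx (coefp (N * e + k0)) (path_mx P torus_path).
have PiL L : lower_unitri L -> Pi *m (rho L *m v) = v.
  move=> hL; pose u := rho L *m v.
  (* Moving the torus past [L] replaces [L] by its conjugate and leaves the torus acting on [v]. The
     coefficient at the lowest possible degree is then the value at 0, where the conjugate is the
     identity. *)
  have key : path_mx P torus_path *m map_mx polyC u =
             'X^(N * e + k0) *: (path_mx P (lower_path L) *m map_mx polyC v).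
    apply/colP => i; apply/eqP; rewrite -subr_eq0; apply/eqP.
    apply: (@poly_eq0_generic _ 'X); rewrite ?polyX_eq0 // => x; rewrite hornerX => x0.
    have Tu : ev x torus_path \in unitmx by rewrite unitmxE ev_torus_det unitfE expf_neq0.
    have Lu : ev x (lower_path L) \in unitmx by apply/lower_unitri_unit/ev_lower_unitri.
    rewrite hornerD hornerN; apply/eqP; rewrite subr_eq0; apply/eqP.
    rewrite [in RHS]mxE hornerM hornerXn !ev_mulmx !ev_const.
    have scE (a b : K) (w w' : 'cV_d) k : a *: w = b *: w' -> a * w k 0 = b * w' k 0.
      by move/colP/(_ k); rewrite !mxE.
    rewrite -[LHS]mul1r; apply: scE; rewrite scale1r -!rho_path // ev_torus_det (lower_unitri_det (ev_lower_unitri _ hL)).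
    rewrite expr1n scale1r -scalemxAl /u mulmxA -(rhoM Tu (lower_unitri_unit hL)) (torus_lower x hL).
    rewrite rhoM // -mulmxA hw //; last exact: ev_torus_upper.
    rewrite -scalemxAr scalerA -exprM; congr (_ *: _).
    rewrite exprD -/N; congr (_ * _); rewrite expr_sum; apply: eq_bigr => j _.
    by rewrite ev_torusE eqxx exprM.
  have /colP key' := key; apply/colP => i.
  have := congr1 (coefp (N * e + k0)) (key' i); rewrite /= mxE coef_sum.
  have -> : \sum_j (path_mx P torus_path i j * map_mx polyC u j 0)`_(N * e + k0) = (Pi *m u) i 0.
    by rewrite mxE; apply: eq_bigr => j _; rewrite [map_mx polyC u j 0]mxE coefMC [Pi i j]mxE.
  move=> ->; rewrite mxE coefXnM ltnn subnn -horner_coef0.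
  rewrite ev_mulmx ev_const.
  have hL0 := ev_lower_unitri 0 hL.
  rewrite -rho_path ?lower_unitri_unit // lower_unitri_det // expr1n scale1r.
  have -> : ev 0 (lower_path L) = 1%:M; last by rewrite rho1 mul1mx.
  apply/matrixP => a b; rewrite ev_lowerE mxE expr0n subn_eq0.
  have [ab|ba] := ltnP a b.
    by rewrite (hL.1 _ _ ab) mul0r; case: eqP => // e'; rewrite e' ltnn in ab.
  have [ab|ab] := leqP a b; last first.
    by rewrite mulr0; case: eqP => // e'; rewrite e' ltnn in ab.
  have -> : a = b by apply: val_inj; apply/eqP; rewrite eqn_leq ab.
  by rewrite hL.2 eqxx mulr1.
have [k vk] : exists k, v k 0 != 0.
  apply/existsP; apply: contraR v_neq0; rewrite negb_exists => /forallP h.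
  by apply/eqP/colP => k; rewrite [RHS]mxE; apply/eqP/negbNE/h.
exists ((v k 0)^-1 *: (delta_mx 0 k *m Pi)) => L U hL hU Uu.
rewrite (rhoM (lower_unitri_unit hL) Uu) -mulmxA hw // -!scalemxAr -scalemxAl -mulmxA PiL //.
by apply/matrixP => i j; rewrite !ord1 mxE mxE -rowE mxE mulVf // mxE eqxx mulr1.
Qed.

Variables (f : 'M[K]_n -> K) (fpath : 'M[{poly K}]_n -> {poly K}).
Hypothesis fpathE : forall Gam x, (fpath Gam).[x] = f (ev x Gam).
Hypothesis f_LU : forall L U, lower_unitri L -> upper_tri U ->
  f (L *m U) = \prod_(i < n) U i i ^+ nth 0%N lambda i.

(* The matrices with an LU decomposition are dense. *)
Lemma hw_functional : exists l : 'rV[K]_d, forall A, A \in unitmx ->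
  l *m (rho A *m v) = (f A)%:M.
Proof.
have [l hl] := hw_functional_LU; exists l => A Au.
(* The line through [A] in the direction of the identity is generically LU-decomposable, being
   diagonally dominant in degree, and passes through [A] at parameter 0. *)
pose Gam : 'M[{poly K}]_n := map_mx polyC A + 'X%:M.
have piv : pivots Gam != 0.
  apply: (@pivots_dominant _ _ 1) => [i|i j ij]; rewrite !mxE.
    by rewrite eqxx mulr1n addrC size_polyDl size_polyX // size_polyC; case: (_ != 0).
  by rewrite (negbTE ij) mulr0n addr0 size_polyC leq_b1.
have ev0 : ev 0 Gam = A.
  by apply/matrixP => i j; rewrite !mxE /horner_eval hornerD hornerC hornerMn hornerX mul0rn addr0.
have det0 : \det Gam != 0.
  apply: contraTneq Au => h; rewrite unitmxE -ev0 det_map_mx h.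
  by rewrite rmorph0 unitr0.
pose p := (map_mx polyC l *m (path_mx P Gam *m map_mx polyC v)) 0 0 - \det Gam ^+ e * fpath Gam.
have pE x : p.[x] = (l *m (ev x (path_mx P Gam) *m v)) 0 0 - \det (ev x Gam) ^+ e * f (ev x Gam).
  rewrite /p hornerD hornerN hornerM horner_exp fpathE det_map_mx /horner_eval; congr (_ - _).
  by rewrite ev_mulmx map_mxM !ev_const.
have p0 : p = 0.
  apply: (@poly_eq0_generic _ (\det Gam * pivots Gam)); first by rewrite mulf_neq0.
  move=> x; rewrite hornerM mulf_eq0 negb_or => /andP[dx px].
  have Gu : ev x Gam \in unitmx by rewrite unitmxE det_map_mx unitfE.
  have [L [U [hL hU GE]]] : exists L U, [/\ lower_unitri L, upper_tri U & ev x Gam = L *m U].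
    by apply: LU_of_pivots; rewrite map_pivots.
  have Uu : U \in unitmx by move: Gu; rewrite GE unitmx_mul => /andP[].
  rewrite pE -rho_path // -!scalemxAl -scalemxAr GE hl // f_LU // !mxE.
  by rewrite eqxx mulr1n subrr.
have := pE 0; rewrite p0 horner0 ev0 => /esym /eqP; rewrite subr_eq0 -{1}ev0 -rho_path ?ev0 //.
rewrite -scalemxAl -scalemxAr mxE => /eqP h.
apply/matrixP => i j; rewrite !ord1 [RHS]mxE eqxx mulr1n.
by apply: (mulfI _ h); rewrite expf_neq0 // -unitfE -unitmxE.
Qed.

End HighestWeightFunctional.

(** * Completing one or two rows to an invertible matrix *)

Section Completion.

Variables (K : fieldType) (n : nat).

Lemma complete_row (i0 : 'I_n) (x : 'rV[K]_n) : x != 0 ->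
  exists2 A : 'M[K]_n, A \in unitmx & row i0 A = x.
Proof.
move=> x0; pose f : 'M[K]_n := delta_mx i0 (0 : 'I_1) *m x.
have fE : (delta_mx (0 : 'I_1) i0 : 'rV_n) *m f = x.
  rewrite /f mulmxA mul_delta_mx; apply/rowP => j.
  by rewrite !mxE big_ord1 mxE !eqxx mul1r.
have [|A Au AE] := @complete_unitmx K 1 n (delta_mx 0 i0) f.
  by rewrite fE !rank_rV x0; case: eqP => // /rowP/(_ i0) /eqP; rewrite !mxE !eqxx oner_eq0.
by exists A => //; rewrite rowE -AE fE.
Qed.

Lemma complete_row2 (i0 i1 : 'I_n) (x y : 'rV[K]_n) : i0 != i1 -> row_free (col_mx x y) ->
  exists A : 'M[K]_n, [/\ A \in unitmx, row i0 A = x & row i1 A = y].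
Proof.
move=> i01 xy.
pose U : 'M[K]_(1 + 1, n) := col_mx (delta_mx 0 i0) (delta_mx 0 i1).
pose f : 'M[K]_n := delta_mx i0 (0 : 'I_1) *m x + delta_mx i1 (0 : 'I_1) *m y.
have e11 : delta_mx 0 0 = 1%:M :> 'M[K]_1.
  by apply/matrixP => i j; rewrite !ord1 !mxE.
have dd (i j : 'I_n) : (delta_mx (0 : 'I_1) i : 'rV[K]_n) *m delta_mx j (0 : 'I_1) = (i == j)%:R%:M.
  have [->|ij] := eqVneq i j; first by rewrite mul_delta_mx e11.
  by rewrite mul_delta_mx_0 // raddf0.
have fE : U *m f = col_mx x y.
  rewrite /U mul_col_mx /f !mulmxDr !mulmxA !dd !eqxx (negbTE i01) eq_sym (negbTE i01).
  by rewrite !mul1mx raddf0 !mul0mx addr0 add0r.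
have Ufree : row_free U.
  apply/row_freeP; exists (row_mx (delta_mx i0 0) (delta_mx i1 0)).
  rewrite mul_col_mx !mul_mx_row !dd !eqxx (negbTE i01) eq_sym (negbTE i01) raddf0.
  by rewrite -block_mxEv -scalar_mx_block.
have [|A Au AE] := @complete_unitmx K _ n U f.
  by rewrite fE (eqP xy) (eqP Ufree).
rewrite fE /U mul_col_mx -!rowE in AE; have [e0 e1] := eq_col_mx AE.
by exists A.
Qed.

Lemma not_row_free2 (x y : 'rV[K]_n) : ~~ row_free (col_mx x y) ->
  exists a b : K, a *: x + b *: y = 0 /\ (a != 0 \/ b != 0).
Proof.
rewrite -kermx_eq0 => /rowV0Pn[w /sub_kermxP].
rewrite -[w](@hsubmxK _ 1 1 1) mul_row_col => h w0.
exists (lsubmx w 0 0), (rsubmx w 0 0); split.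
  by rewrite -!mul_scalar_mx -!mx11_scalar.
have [a0|a0] := eqVneq (lsubmx w 0 0) 0; last by left.
have [b0|b0] := eqVneq (rsubmx w 0 0) 0; last by right.
by move: w0; rewrite [lsubmx w]mx11_scalar [rsubmx w]mx11_scalar a0 b0 raddf0 row_mx0 eqxx.
Qed.

End Completion.

Lemma sum_triple (R : comPzRingType) (T : finType) (x y z : T -> R) :
  \sum_(a : T * T * T) x a.1.1 * y a.1.2 * z a.2 = (\sum_i x i) * (\sum_i y i) * (\sum_i z i).
Proof.
rewrite -(pair_bigA _ (fun p k => x p.1 * y p.2 * z k)) /=.
rewrite -(pair_bigA _ (fun i j => \sum_k x i * y j * z k)) /=.
rewrite !mulr_suml; apply: eq_bigr => i _ /=.
rewrite [x i * _]mulr_sumr mulr_suml; apply: eq_bigr => j _.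
by rewrite mulr_sumr.
Qed.

Lemma entD (R : nmodType) m p (A B : 'M[R]_(m, p)) i j : (A + B) i j = A i j + B i j.
Proof. exact: mxE. Qed.

Lemma entZ (R : pzRingType) m p c (A : 'M[R]_(m, p)) i j : (c *: A) i j = c * A i j.
Proof. exact: mxE. Qed.

Lemma entN (R : zmodType) m p (A : 'M[R]_(m, p)) i j : (- A) i j = - A i j.
Proof. exact: mxE. Qed.

(** * Tensor coordinates on irreducible representations *)

Section Models.

Variables (K : fieldType) (charK : [pchar K] =i pred0) (n : nat).
Local Notation I3 := ('I_n * 'I_n * 'I_n)%type.

Definition act3 (A : 'M[K]_n) (a b : I3) : K := A a.1.1 b.1.1 * A a.1.2 b.1.2 * A a.2 b.2.

Definition sym3 (t : I3 -> K) : Prop :=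
  (forall i j k, t (j, i, k) = t (i, j, k)) /\ (forall i j k, t (i, k, j) = t (i, j, k)).

(** The copy of the Schur functor of (2,1) inside the tensors symmetric in the first two indices,
    complementary there to the symmetric tensors. *)
Definition mix3 (t : I3 -> K) : Prop :=
  (forall i j k, t (j, i, k) = t (i, j, k)) /\
  (forall i j k, t (i, j, k) + t (j, k, i) + t (k, i, j) = 0).

(* [E] embeds the representation into the tensors satisfying [cond], and [D] inverts it. *)
Definition is_model (cond : (I3 -> K) -> Prop) (d : nat) (rho : 'M[K]_n -> 'M[K]_d)
    (E : I3 -> 'rV[K]_d) (D : I3 -> 'cV[K]_d) : Prop :=
  [/\ forall u : 'cV[K]_d, cond (fun a => (E a *m u) 0 0),
      forall A a, A \in unitmx -> E a *m rho A = \sum_b act3 A a b *: E b,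
      forall t, cond t -> forall a, \sum_b t b * (E a *m D b) 0 0 = t a
    & forall u : 'cV[K]_d, (forall a, (E a *m u) 0 0 = 0) -> u = 0].

Section HighestWeight.

Variables (d : nat) (rho : 'M[K]_n -> 'M[K]_d) (v : 'cV[K]_d) (l : 'rV[K]_d) (f : 'M[K]_n -> K).
Hypothesis rep : is_gl_rep rho.
Hypothesis irr : gl_irreducible rho.
Hypothesis v_neq0 : v != 0.
Hypothesis lv : forall A, A \in unitmx -> l *m (rho A *m v) = (f A)%:M.
Hypothesis f1 : f 1%:M != 0.

Local Notation coef w h := (((w : 'rV[K]_d) *m (rho h *m v)) 0 0).

Let rhoM A B : A \in unitmx -> B \in unitmx -> rho (A *m B) = rho A *m rho B.
Proof. by case: rep => _ h _; apply: h. Qed.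

Let rho1 : rho 1%:M = 1%:M.
Proof. by case: rep. Qed.

(** By irreducibility the translates of [v] span. Hence identities between functionals may be
    checked as identities between functions on the group. *)
Lemma coef_inj (w w' : 'rV[K]_d) :
  (forall h, h \in unitmx -> coef w h = coef w' h) -> w = w'.
Proof.
move=> hw; pose Q (u : 'cV[K]_d) := forall z : 'rV[K]_d,
  (forall h, h \in unitmx -> coef z h = 0) -> (z *m u) 0 0 = 0.
have QT : forall u, Q u.
  apply: (gl_irreducible_pred irr).
  - by move=> z _; rewrite mulmx0 mxE.
  - by move=> c u u' hu hu' z hz; rewrite mulmxDr -scalemxAr 2!mxE hu // hu' // mulr0 addr0.
  - move=> A u Au hu z hz; rewrite mulmxA; apply: hu => h hh.
    by rewrite -mulmxA [rho A *m _]mulmxA -rhoM // hz // unitmx_mul Au.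
  exists v => // z hz; have := hz 1%:M (unitmx1 _ _).
  by rewrite rho1 mul1mx.
apply/rowP => j; apply/eqP; rewrite -subr_eq0; apply/eqP.
have := QT (delta_mx j 0) (w - w'); rewrite -colE mxE mxE mxE; apply => h hh.
have entB (A B : 'M[K]_1) : (A - B) 0 0 = A 0 0 - B 0 0 by rewrite !mxE.
by rewrite mulmxBl entB hw // subrr.
Qed.

(** The vectors killed by all translates of [l] form an invariant subspace, which misses [v] because
    [l] takes the nonzero value [f 1] there. *)
Lemma functional_nondeg (u : 'cV[K]_d) :
  (forall h, h \in unitmx -> (l *m (rho h *m u)) 0 0 = 0) -> u = 0.
Proof.
move=> hu; apply/eqP; apply: contraT => u0.
pose Q (u : 'cV[K]_d) := forall h, h \in unitmx -> (l *m (rho h *m u)) 0 0 = 0.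
have QT : forall u, Q u.
  apply: (gl_irreducible_pred irr).
  - by move=> h _; rewrite !mulmx0 mxE.
  - by move=> c w w' hw hw' h hh; rewrite !mulmxDr -!scalemxAr 2!mxE hw // hw' // mulr0 addr0.
  - by move=> A w Au hw h hh; rewrite [rho h *m _]mulmxA -rhoM // hw // unitmx_mul hh.
  by exists u.
have := QT v 1%:M (unitmx1 _ _); rewrite lv ?unitmx1 // mxE eqxx mulr1n => /eqP.
by rewrite (negbTE f1).
Qed.

Lemma coef_functional A h : A \in unitmx -> h \in unitmx -> coef (l *m rho A) h = f (A *m h).
Proof.
move=> Au hu; rewrite -mulmxA [rho A *m _]mulmxA -rhoM // lv ?unitmx_mul ?Au //.
by rewrite mxE eqxx mulr1n.
Qed.

Lemma coef_act w A h : A \in unitmx -> h \in unitmx -> coef (w *m rho A) h = coef w (A *m h).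
Proof. by move=> Au hu; rewrite -mulmxA [rho A *m _]mulmxA -rhoM. Qed.

Lemma coefZ c w h : coef (c *: w) h = c * coef w h.
Proof. by rewrite -scalemxAl mxE. Qed.

Lemma coefD w w' h : coef (w + w') h = coef w h + coef w' h.
Proof. by rewrite mulmxDl mxE. Qed.

Lemma coefN w h : coef (- w) h = - coef w h.
Proof. by rewrite mulNmx mxE. Qed.

Lemma coef_sumZ (T : finType) (c : T -> K) (w : T -> 'rV[K]_d) h :
  coef (\sum_i c i *: w i) h = \sum_i c i * coef (w i) h.
Proof. by rewrite mulmx_suml summxE; apply: eq_bigr => i _; rewrite coefZ. Qed.

End HighestWeight.

Lemma mulmx_coord m p (A : 'M[K]_(m, n)) (B : 'M[K]_(n, p)) i j :
  (A *m B) i j = \sum_k A i k * B k j.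
Proof. exact: mxE. Qed.

Lemma sum_delta3 (t : I3 -> K) (s s' : I3 -> I3) a : cancel s s' -> cancel s' s ->
  \sum_b t b * ((a.1.1 == (s b).1.1)%:R * (a.1.2 == (s b).1.2)%:R * (a.2 == (s b).2)%:R) = t (s' a).
Proof.
move=> sK s'K; have dE b : (a.1.1 == (s b).1.1)%:R * (a.1.2 == (s b).1.2)%:R * (a.2 == (s b).2)%:R
    = (b == s' a)%:R :> K.
  rewrite -!natrM !mulnb; congr (_ (nat_of_bool _)); apply/idP/eqP => [|->].
    case: (a) (s b) (sK b) => -[i j] k [[i' j'] k'] <- /=.
    by move=> /andP[/andP[/eqP-> /eqP->] /eqP->].
  by rewrite s'K !eqxx.
under eq_bigr => b _ do rewrite dE.
rewrite (bigD1 (s' a)) //= eqxx mulr1 big1 ?addr0 // => b /negbTE ->.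
by rewrite mulr0.
Qed.

Section Sym3.

Variables (d : nat) (rho : 'M[K]_n -> 'M[K]_d) (v : 'cV[K]_d) (l : 'rV[K]_d) (i0 : 'I_n).
Hypothesis rep : is_gl_rep rho.
Hypothesis irr : gl_irreducible rho.
Hypothesis v_neq0 : v != 0.
Hypothesis lv : forall A, A \in unitmx -> l *m (rho A *m v) = (A i0 i0 ^+ 3)%:M.

Local Notation coef w h := (((w : 'rV[K]_d) *m (rho h *m v)) 0 0).
Local Notation del i := (delta_mx 0 i : 'rV[K]_n).
Local Notation cdel i := (delta_mx i 0 : 'cV[K]_n).

Let f1 : (1%:M : 'M[K]_n) i0 i0 ^+ 3 != 0.
Proof. by rewrite mxE eqxx expr1n oner_neq0. Qed.

(** For nonzero [x], translate [l] by an invertible matrix whose row [i0] is [x]. *)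
Let row_fun (x : 'rV[K]_n) : exists w : 'rV[K]_d,
  forall h, h \in unitmx -> coef w h = (x *m h) 0 i0 ^+ 3.
Proof.
have [->|x0] := eqVneq x 0.
  by exists 0 => h _; rewrite !mul0mx !mxE expr0n.
have [A Au <-] := complete_row i0 x0; exists (l *m rho A) => h hu.
by rewrite (coef_functional rep lv) // -row_mul [in RHS]mxE.
Qed.

Let col_vec (y : 'cV[K]_n) : exists u : 'cV[K]_d, forall E : I3 -> 'rV[K]_d,
  (forall a h, h \in unitmx -> coef (E a) h = h a.1.1 i0 * h a.1.2 i0 * h a.2 i0) ->
  forall a, (E a *m u) 0 0 = y a.1.1 0 * y a.1.2 0 * y a.2 0.
Proof.
have [->|y0] := eqVneq y 0.
  by exists 0 => E _ a; rewrite mulmx0 !mxE !mul0r.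
have [|A Au AE] := @complete_row _ _ i0 (y^T).
  by rewrite -(inj_eq trmx_inj) trmxK raddf0.
exists (rho A^T *m v) => E hE a; rewrite hE ?unitmx_tr //.
have h i : A^T i i0 = y i 0 by rewrite mxE; have /rowP/(_ i) := AE; rewrite !mxE.
by rewrite !h.
Qed.

Lemma sym3_model : exists E D, is_model sym3 rho E D.
Proof.
have n2 : (2%:R : K) != 0 by apply: natf_neq0_char0.
have n3 : (3%:R : K) != 0 by apply: natf_neq0_char0.
have n6 : (6%:R : K) != 0 by apply: natf_neq0_char0.
have exE (a : I3) : exists w : 'rV[K]_d,
    forall h, h \in unitmx -> coef w h = h a.1.1 i0 * h a.1.2 i0 * h a.2 i0.
  case: a => -[i j] k /=.
  have [w1 h1] := row_fun (del i + del j + del k).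
  have [w2 h2] := row_fun (del i + del j).
  have [w3 h3] := row_fun (del j + del k).
  have [w4 h4] := row_fun (del i + del k).
  have [w5 h5] := row_fun (del i).
  have [w6 h6] := row_fun (del j).
  have [w7 h7] := row_fun (del k).
  (* Polarisation of the cube: [6xyz = (x+y+z)^3 - (x+y)^3 - (y+z)^3 - (x+z)^3 + x^3 + y^3 +
     z^3]. *)
  exists (6%:R^-1 *: (w1 - w2 - w3 - w4 + w5 + w6 + w7)) => h hu.
  rewrite coefZ !coefD !coefN h1 // h2 // h3 // h4 // h5 // h6 // h7 //.
  have dE t : (del t *m h) 0 i0 = h t i0 by rewrite -rowE mxE.
  rewrite !mulmxDl !entD !dE.
  apply: (mulfI n6); rewrite mulrA mulfV // mul1r; ring.
have [E hE] := fin_all_exists exE.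
(* The vector attached to [b] has as coordinates the symmetrised basis tensor at [b]. *)
have exD (b : I3) : exists u : 'cV[K]_d, forall a, (E a *m u) 0 0 = 6%:R^-1 *
    \sum_(s <- [:: (b.1.1, b.1.2, b.2); (b.1.1, b.2, b.1.2); (b.1.2, b.1.1, b.2);
                   (b.1.2, b.2, b.1.1); (b.2, b.1.1, b.1.2); (b.2, b.1.2, b.1.1)])
      (a.1.1 == s.1.1)%:R * (a.1.2 == s.1.2)%:R * (a.2 == s.2)%:R.
  case: b => -[i j] k /=.
  have [u1 /(_ E hE) h1] := col_vec (cdel i + cdel j + cdel k).
  have [u2 /(_ E hE) h2] := col_vec (cdel i + cdel j).
  have [u3 /(_ E hE) h3] := col_vec (cdel j + cdel k).
  have [u4 /(_ E hE) h4] := col_vec (cdel i + cdel k).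
  have [u5 /(_ E hE) h5] := col_vec (cdel i).
  have [u6 /(_ E hE) h6] := col_vec (cdel j).
  have [u7 /(_ E hE) h7] := col_vec (cdel k).
  exists (6%:R^-1 *: (u1 - u2 - u3 - u4 + u5 + u6 + u7)) => a.
  rewrite -scalemxAr !mulmxDr !mulmxN mxE; congr (_ * _).
  rewrite !entD !entN.
  rewrite h1 h2 h3 h4 h5 h6 h7 !big_cons big_nil /= !mxE !eqxx !andbT.
  move: (a.1.1 == i)%:R (a.1.1 == j)%:R (a.1.1 == k)%:R => x1 x2 x3.
  move: (a.1.2 == i)%:R (a.1.2 == j)%:R (a.1.2 == k)%:R => y1 y2 y3.
  move: (a.2 == i)%:R (a.2 == j)%:R (a.2 == k)%:R => z1 z2 z3.
  ring.
have [D hD] := fin_all_exists exD.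
exists E, D; split.
- have E1 i j k : E (j, i, k) = E (i, j, k).
    by apply: (coef_inj rep irr v_neq0) => h hu; rewrite !hE //=; ring.
  have E2 i j k : E (i, k, j) = E (i, j, k).
    by apply: (coef_inj rep irr v_neq0) => h hu; rewrite !hE //=; ring.
  by move=> u; split=> i j k; [rewrite E1|rewrite E2].
- move=> A a Au; apply: (coef_inj rep irr v_neq0) => h hu.
  rewrite (coef_act v rep) // coef_sumZ hE ?unitmx_mul ?Au // !mulmx_coord -sum_triple.
  by apply: eq_bigr => b _; rewrite hE // /act3; ring.
- move=> t [t1 t2] a.
  under eq_bigr => b _ do rewrite hD mulrCA.
  rewrite -mulr_sumr; apply: (mulfI n6); rewrite mulrA mulfV // mul1r.
  under eq_bigr => b _ do rewrite !big_cons big_nil addr0 !mulrDr.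
  rewrite !big_split /=; case: a => -[i j] k.
  rewrite (@sum_delta3 t id id) // (@sum_delta3 t (fun b => (b.1.1, b.2, b.1.2)) (fun b => (b.1.1, b.2, b.1.2))); try by case=> -[].
  rewrite (@sum_delta3 t (fun b => (b.1.2, b.1.1, b.2)) (fun b => (b.1.2, b.1.1, b.2))); try by case=> -[].
  rewrite (@sum_delta3 t (fun b => (b.1.2, b.2, b.1.1)) (fun b => (b.2, b.1.1, b.1.2))); try by case=> -[].
  rewrite (@sum_delta3 t (fun b => (b.2, b.1.1, b.1.2)) (fun b => (b.1.2, b.2, b.1.1))); try by case=> -[].
  rewrite (@sum_delta3 t (fun b => (b.2, b.1.2, b.1.1)) (fun b => (b.2, b.1.2, b.1.1))); try by case=> -[].
  rewrite /= !(t2 i k j, t1 i j k, t2 j i k, t1 i k j) !(t2 k i j, t1 j k i, t1 k j i).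
  by rewrite (t1 i k j); ring.
- move=> u hu; apply: (functional_nondeg rep irr lv f1) => A Au.
  have -> : l *m (rho A *m u) = (\sum_a (A i0 a.1.1 * A i0 a.1.2 * A i0 a.2) *: E a) *m u.
    rewrite mulmxA; congr (_ *m u); apply: (coef_inj rep irr v_neq0) => h hh.
    rewrite (coef_functional rep lv) // coef_sumZ exprS expr2 mulrA mulmx_coord -sum_triple.
    by apply: eq_bigr => b _; rewrite hE //; ring.
  rewrite mulmx_suml summxE big1 // => b _.
  by rewrite -scalemxAl mxE hu mulr0.
Qed.

End Sym3.
Section Mix3.

Variables (d : nat) (rho : 'M[K]_n -> 'M[K]_d) (v : 'cV[K]_d) (l : 'rV[K]_d) (i0 i1 : 'I_n).
Hypothesis i01 : i0 != i1.
Hypothesis rep : is_gl_rep rho.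
Hypothesis irr : gl_irreducible rho.
Hypothesis v_neq0 : v != 0.
Hypothesis lv : forall A, A \in unitmx ->
  l *m (rho A *m v) = (A i0 i0 * (A i0 i0 * A i1 i1 - A i0 i1 * A i1 i0))%:M.

Local Notation coef w h := (((w : 'rV[K]_d) *m (rho h *m v)) 0 0).
Local Notation del i := (delta_mx 0 i : 'rV[K]_n).
Local Notation cdel i := (delta_mx i 0 : 'cV[K]_n).

Let f1 : (1%:M : 'M[K]_n) i0 i0 * ((1%:M : 'M[K]_n) i0 i0 * (1%:M : 'M[K]_n) i1 i1
          - (1%:M : 'M[K]_n) i0 i1 * (1%:M : 'M[K]_n) i1 i0) != 0.
Proof. by rewrite !mxE !eqxx (negbTE i01) !mul1r mul0r subr0 oner_neq0. Qed.

Let n2 : (2%:R : K) != 0. Proof. exact: natf_neq0_char0. Qed.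
Let n3 : (3%:R : K) != 0. Proof. exact: natf_neq0_char0. Qed.

Let halfB (a b : K) : a - 2%:R^-1 * b = 2%:R^-1 * (2%:R * a - b).
Proof. by rewrite mulrBr mulKf. Qed.

Let half3 (a1 a2 a3 b1 b2 b3 : K) :
  (a1 - 2%:R^-1 * b1) - (a2 - 2%:R^-1 * b2) - (a3 - 2%:R^-1 * b3) =
  2%:R^-1 * (2%:R * (a1 - a2 - a3) - (b1 - b2 - b3)).
Proof. by rewrite -halfB; move: (2%:R^-1 : K) => c; ring. Qed.

Lemma dependent_minor0 (a b x0 x1 y0 y1 : K) : a * x0 + b * y0 = 0 -> a * x1 + b * y1 = 0 ->
  a != 0 \/ b != 0 -> x0 * y1 - x1 * y0 = 0.
Proof.
move=> h0 h1 ab.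
have ha : a * (x0 * y1 - x1 * y0) = 0.
  have -> : a * (x0 * y1 - x1 * y0) = (a * x0 + b * y0) * y1 - (a * x1 + b * y1) * y0 by ring.
  by rewrite h0 h1 !mul0r subrr.
have hb : b * (x0 * y1 - x1 * y0) = 0.
  have -> : b * (x0 * y1 - x1 * y0) = x0 * (a * x1 + b * y1) - x1 * (a * x0 + b * y0) by ring.
  by rewrite h0 h1 !mulr0 subrr.
by apply/eqP; case: ab => [/negbTE a0|/negbTE b0];
  [move/eqP: ha; rewrite mulf_eq0 a0|move/eqP: hb; rewrite mulf_eq0 b0].
Qed.

(** Independent [x], [y] are rows [i0], [i1] of an invertible matrix, by which [l] is translated.
    For dependent ones the minor vanishes and the zero functional serves. *)
Let row_fun (x y : 'rV[K]_n) : exists w : 'rV[K]_d, forall h, h \in unitmx ->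
  coef w h = (x *m h) 0 i0 * ((x *m h) 0 i0 * (y *m h) 0 i1 - (x *m h) 0 i1 * (y *m h) 0 i0).
Proof.
have [xy|/not_row_free2[a [b [ab0 ab]]]] := boolP (row_free (col_mx x y)).
  have [A [Au <- <-]] := complete_row2 i01 xy; exists (l *m rho A) => h hu.
  rewrite (coef_functional rep lv) //.
  have rE i j : (row i A *m h) 0 j = (A *m h) i j by rewrite -row_mul mxE.
  by rewrite !rE.
exists 0 => h _; rewrite mul0mx mxE.
have e j : a * (x *m h) 0 j + b * (y *m h) 0 j = 0.
  have := congr1 (fun z : 'rV[K]_n => (z *m h) 0 j) ab0.
  by rewrite /= mulmxDl entD -!scalemxAl mul0mx !entZ => ->; rewrite mxE.
by rewrite (dependent_minor0 (e i0) (e i1) ab) mulr0.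
Qed.

Let col_vec (x y : 'cV[K]_n) : exists u : 'cV[K]_d, forall E : I3 -> 'rV[K]_d,
  (forall a h, h \in unitmx -> coef (E a) h = h a.1.1 i0 * h a.1.2 i0 * h a.2 i1
     - 2%:R^-1 * (h a.1.1 i0 * h a.1.2 i1 * h a.2 i0 + h a.1.1 i1 * h a.1.2 i0 * h a.2 i0)) ->
  forall a, (E a *m u) 0 0 = x a.1.1 0 * x a.1.2 0 * y a.2 0
     - 2%:R^-1 * (x a.1.1 0 * y a.1.2 0 * x a.2 0 + y a.1.1 0 * x a.1.2 0 * x a.2 0).
Proof.
have [xy|/not_row_free2[a [b [ab0 ab]]]] := boolP (row_free (col_mx x^T y^T)).
  have [A [Au A0 A1]] := complete_row2 i01 xy.
  exists (rho A^T *m v) => E hE a; rewrite hE ?unitmx_tr //.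
  have h0 i : A^T i i0 = x i 0 by rewrite mxE; have /rowP/(_ i) := A0; rewrite !mxE.
  have h1 i : A^T i i1 = y i 0 by rewrite mxE; have /rowP/(_ i) := A1; rewrite !mxE.
  by rewrite !h0 !h1.
exists 0 => E _ c; rewrite mulmx0 mxE; apply/esym.
have e i : a * x i 0 + b * y i 0 = 0.
  by have /rowP/(_ i) := ab0; rewrite !mxE.
have m1 := dependent_minor0 (e c.1.1) (e c.2) ab.
have m2 := dependent_minor0 (e c.1.2) (e c.2) ab.
rewrite halfB.
have -> : 2%:R * (x c.1.1 0 * x c.1.2 0 * y c.2 0) -
   (x c.1.1 0 * y c.1.2 0 * x c.2 0 + y c.1.1 0 * x c.1.2 0 * x c.2 0) =
   x c.1.2 0 * (x c.1.1 0 * y c.2 0 - x c.2 0 * y c.1.1 0) +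
   x c.1.1 0 * (x c.1.2 0 * y c.2 0 - x c.2 0 * y c.1.2 0) by ring.
by rewrite m1 m2 !mulr0 addr0 mulr0.
Qed.

Lemma mix3_model : exists E D, is_model mix3 rho E D.
Proof.
have exE (a : I3) : exists w : 'rV[K]_d, forall h, h \in unitmx ->
    coef w h = h a.1.1 i0 * h a.1.2 i0 * h a.2 i1
     - 2%:R^-1 * (h a.1.1 i0 * h a.1.2 i1 * h a.2 i0 + h a.1.1 i1 * h a.1.2 i0 * h a.2 i0).
  case: a => -[i j] k /=.
  have [w1 h1] := row_fun (del i + del j) (del k).
  have [w2 h2] := row_fun (del i) (del k).
  have [w3 h3] := row_fun (del j) (del k).
  (* The function of [row_fun] is quadratic in [x]; this is its polarisation at the rows [i] and
     [j], with [y] the row [k]. *)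
  exists (2%:R^-1 *: (w1 - w2 - w3)) => h hu.
  rewrite coefZ !coefD !coefN h1 // h2 // h3 //.
  have dE t t' : (del t *m h) 0 t' = h t t' by rewrite -rowE mxE.
  rewrite !mulmxDl !entD !dE.
  by rewrite [RHS]halfB; congr (_ * _); ring.
have [E hE] := fin_all_exists exE.
(* The coordinates are the projection of the basis tensor at [b] to mixed tensors: its
   symmetrisation in the first two indices minus its full symmetrisation. The coefficients are
   [1/2 - 1/6 = 2/6] on two terms and [-1/6] on the other four. *)
have exD (b : I3) : exists u : 'cV[K]_d, forall a, (E a *m u) 0 0 = 6%:R^-1 *
    (2%:R * ((a.1.1 == b.1.1)%:R * (a.1.2 == b.1.2)%:R * (a.2 == b.2)%:R
          + (a.1.1 == b.1.2)%:R * (a.1.2 == b.1.1)%:R * (a.2 == b.2)%:R)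
      - \sum_(s <- [:: (b.1.1, b.2, b.1.2); (b.1.2, b.2, b.1.1);
                   (b.2, b.1.1, b.1.2); (b.2, b.1.2, b.1.1)])
      (a.1.1 == s.1.1)%:R * (a.1.2 == s.1.2)%:R * (a.2 == s.2)%:R).
  case: b => -[i j] k /=.
  have [u1 /(_ E hE) h1] := col_vec (cdel i + cdel j) (cdel k).
  have [u2 /(_ E hE) h2] := col_vec (cdel i) (cdel k).
  have [u3 /(_ E hE) h3] := col_vec (cdel j) (cdel k).
  (* Polarising [col_vec] in its first argument gives coefficients 1 and [-1/2]; one third of them
     are the required [2/6] and [-1/6]. *)
  exists (3%:R^-1 *: (u1 - u2 - u3)) => a.
  rewrite -scalemxAr !mulmxDr !mulmxN mxE !entD !entN.
  rewrite h1 h2 h3 !big_cons big_nil /= !mxE !eqxx !andbT.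
  move: (a.1.1 == i)%:R (a.1.1 == j)%:R (a.1.1 == k)%:R => x1 x2 x3.
  move: (a.1.2 == i)%:R (a.1.2 == j)%:R (a.1.2 == k)%:R => y1 y2 y3.
  move: (a.2 == i)%:R (a.2 == j)%:R (a.2 == k)%:R => z1 z2 z3.
  have -> : (6%:R : K)^-1 = 3%:R^-1 * 2%:R^-1 by rewrite -invfM -natrM.
  rewrite -[RHS]mulrA; congr (_ * _).
  by rewrite half3; congr (_ * _); ring.
have [D hD] := fin_all_exists exD.
exists E, D; split.
- have E1 i j k : E (j, i, k) = E (i, j, k).
    by apply: (coef_inj rep irr v_neq0) => h hu; rewrite !hE //=; ring.
  have E2 i j k : E (i, j, k) + E (j, k, i) + E (k, i, j) = 0.
    apply: (coef_inj rep irr v_neq0) => h hu; rewrite !coefD !hE //= mul0mx mxE.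
    by rewrite !halfB -!mulrDr -[RHS](mulr0 2%:R^-1); congr (_ * _); ring.
  move=> u; split=> i j k; first by rewrite E1.
  by rewrite -!entD -!mulmxDl E2 mul0mx mxE.
- move=> A a Au; apply: (coef_inj rep irr v_neq0) => h hu.
  rewrite (coef_act v rep) // coef_sumZ hE ?unitmx_mul ?Au // !mulmx_coord -!sum_triple.
  rewrite -big_split mulr_sumr -sumrB.
  by apply: eq_bigr => b _; rewrite hE // /act3 /=; ring.
- move=> t [t1 t2] a.
  have n6 : (6%:R : K) != 0 by apply: natf_neq0_char0.
  under eq_bigr => b _ do rewrite hD mulrCA.
  rewrite -mulr_sumr; apply: (mulfI n6); rewrite mulrA mulfV // mul1r.
  under eq_bigr => b _ do rewrite mulrBr mulrCA mulrDr !big_cons big_nil addr0 !mulrDr.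
  rewrite sumrB !big_split /= -!mulr_sumr; case: a => -[i j] k.
  rewrite (@sum_delta3 t id id) // (@sum_delta3 t (fun b => (b.1.1, b.2, b.1.2)) (fun b => (b.1.1, b.2, b.1.2))); try by case=> -[].
  rewrite (@sum_delta3 t (fun b => (b.1.2, b.1.1, b.2)) (fun b => (b.1.2, b.1.1, b.2))); try by case=> -[].
  rewrite (@sum_delta3 t (fun b => (b.1.2, b.2, b.1.1)) (fun b => (b.2, b.1.1, b.1.2))); try by case=> -[].
  rewrite (@sum_delta3 t (fun b => (b.2, b.1.1, b.1.2)) (fun b => (b.1.2, b.2, b.1.1))); try by case=> -[].
  rewrite (@sum_delta3 t (fun b => (b.2, b.1.2, b.1.1)) (fun b => (b.2, b.1.2, b.1.1))); try by case=> -[].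
  rewrite /= (t1 i j k) (t1 k i j) (t1 j k i).
  have e : t (i, j, k) = - (t (j, k, i) + t (k, i, j)).
    by apply/eqP; rewrite -addr_eq0 addrA t2.
  by rewrite e; ring.
- move=> u hu; apply: (functional_nondeg rep irr lv f1) => A Au.
  have -> : l *m (rho A *m u) = (\sum_a (A i0 a.1.1 * A i0 a.1.2 * A i1 a.2) *: E a) *m u.
    rewrite mulmxA; congr (_ *m u); apply: (coef_inj rep irr v_neq0) => h hh.
    rewrite (coef_functional rep lv) // coef_sumZ.
    have -> : \sum_a A i0 a.1.1 * A i0 a.1.2 * A i1 a.2 * coef (E a) h =
      (A *m h) i0 i0 * (A *m h) i0 i0 * (A *m h) i1 i1 - 2%:R^-1 *
      ((A *m h) i0 i0 * (A *m h) i0 i1 * (A *m h) i1 i0 + (A *m h) i0 i1 * (A *m h) i0 i0 * (A *m h) i1 i0).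
      rewrite !mulmx_coord -!sum_triple -big_split mulr_sumr -sumrB.
      by apply: eq_bigr => b _; rewrite hE // /=; ring.
    by rewrite halfB; apply: (canRL (mulKf n2)); ring.
  rewrite mulmx_suml summxE big1 // => b _.
  by rewrite -scalemxAl mxE hu mulr0.
Qed.

End Mix3.

End Models.

(** * Models of V_(3) and V_(2,1) from the highest weight alone *)

Section SchurModels.

Variables (K : fieldType) (charK : [pchar K] =i pred0).

Lemma LU_first (n d : nat) (L : 'M[K]_n) (U : 'M[K]_(n, d)) (i0 : 'I_n) j : lower_unitri L ->
  val i0 = 0%N -> (L *m U) i0 j = U i0 j.
Proof.
move=> [L0 L1] i00; rewrite mulmx_coord (bigD1 i0) //= L1 mul1r big1 ?addr0 // => k ki.
by rewrite L0 ?mul0r // i00 lt0n -i00; apply: contraNneq ki => e; apply/eqP/val_inj.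
Qed.

Lemma sym3_of_highest_weight (n : nat) (n_gt0 : (0 < n)%N) (d : nat) (rho : 'M[K]_n -> 'M[K]_d) :
  is_V [:: 3%N] rho -> exists E D, is_model (@sym3 K n) rho E D.
Proof.
rewrite /is_V n_gt0 => -[rep irr [v v0 hw]].
pose i0 : 'I_n := Ordinal n_gt0.
have [r1 rM [e [P rP]]] := rep.
have [||l hl] := @hw_functional K charK n d rho e P r1 rM rP [:: 3%N] v v0 hw
   (fun A => A i0 i0 ^+ 3) (fun G => G i0 i0 ^+ 3).
- by move=> G x; rewrite mxE /horner_eval horner_exp.
- move=> L U hL hU; rewrite LU_first // (bigD1 i0) //= big1 ?mulr1 // => i ii.
  have : nat_of_ord i != 0%N by apply: contraNneq ii => h; apply/eqP/val_inj.
  by case: (nat_of_ord i) => // k _; rewrite /= nth_nil expr0.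
exact: (sym3_model charK rep irr v0 hl).
Qed.

Lemma mix3_of_highest_weight (n : nat) (n_gt0 : (0 < n)%N) (d : nat) (rho : 'M[K]_n -> 'M[K]_d) :
  is_V [:: 2%N; 1%N] rho -> exists E D, is_model (@mix3 K n) rho E D.
Proof.
rewrite /is_V; case: ifP => [n_gt1 [rep irr [v v0 hw]]|n1 d0].
  pose i0 : 'I_n := Ordinal n_gt0; pose i1 : 'I_n := Ordinal n_gt1.
  have i01 : i0 != i1 by [].
  have [r1 rM [e [P rP]]] := rep.
  have [||l hl] := @hw_functional K charK n d rho e P r1 rM rP [:: 2%N; 1%N] v v0 hw
     (fun A => A i0 i0 * (A i0 i0 * A i1 i1 - A i0 i1 * A i1 i0))
     (fun G => G i0 i0 * (G i0 i0 * G i1 i1 - G i0 i1 * G i1 i0)).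
  - by move=> G x; rewrite !mxE /horner_eval hornerM hornerD hornerN !hornerM.
  - move=> L U hL hU; rewrite !(@LU_first n n L U i0) // (bigD1 i0) //= (bigD1 i1) //= big1 ?mulr1.
      have row1 j : (L *m U) i1 j = L i1 i0 * U i0 j + U i1 j.
        rewrite mulmx_coord (bigD1 i0) //= (bigD1 i1) //= hL.2 mul1r big1 ?addr0 // => k /andP[k0 k1].
        rewrite hL.1 ?mul0r //= ltnNge.
        apply/negP => h; move: k0 k1; rewrite -!val_eqE /=; case: (nat_of_ord k) h => [|[|?]] //.
      by rewrite !row1 (hU i1 i0) //; ring.
    move=> k /andP[k0 k1]; move: k0 k1; rewrite -!val_eqE /=.
    by case: (nat_of_ord k) => [|[|m]] //= _ _; rewrite nth_nil expr0.
  exact: (mix3_model charK i01 rep irr v0 hl).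
(* Here V_(2,1) is zero, and so are the mixed tensors: their only entry vanishes when multiplied by
   3. *)
have n_1 : n = 1%N by move: n1; rewrite /=; lia.
move: rho; rewrite d0 => rho; exists (fun _ => 0), (fun _ => 0); split.
- by move=> u; split=> i j k; rewrite !mul0mx !mxE ?addr0.
- by move=> A a Au; apply/rowP; case.
- move=> t [_ t2] a.
  have n3 : (3%:R : K) != 0 by apply: natf_neq0_char0.
  have eq1 (i j : 'I_n) : i = j.
    by apply: val_inj; have /= := ltn_ord i; have /= := ltn_ord j; lia.
  case: a => -[i j] k; rewrite big1 => [|b _]; last by rewrite mul0mx mxE mulr0.
  apply/esym/(mulfI n3); rewrite mulr0 -[RHS](t2 i i i) (eq1 j i) (eq1 k i); ring.
by move=> u _; apply/colP; case.
Qed.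

End SchurModels.

(** * Tensors of linear syzygies *)

Section CubicTensors.

Variables (K : fieldType) (charK : [pchar K] =i pred0) (n : nat).
Local Notation I3 := ('I_n * 'I_n * 'I_n)%type.

Definition rot3 (a : I3) : I3 := (a.1.2, a.2, a.1.1).

Definition swap_sym (t : I3 -> I3 -> K) : Prop :=
  (forall i j k c, t (j, i, k) c = t (i, j, k) c) /\
  (forall a i j k, t a (j, i, k) = t a (i, j, k)).

(* The coordinates of the linear syzygies of the quadratic generators. *)
Definition cubic_syz (t : I3 -> I3 -> K) : Prop :=
  swap_sym t /\ forall a c, t a c + t (rot3 a) (rot3 c) + t (rot3 (rot3 a)) (rot3 (rot3 c)) = 0.

Let n3 : (3%:R : K) != 0. Proof. exact: natf_neq0_char0. Qed.

(* In the tensor square of the two-dimensional representation of the symmetric group S_3, the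
   vector fixed by (12) in both factors is not killed by the sum over the 3-cycles. *)
Lemma cubic_syz_mix_mix (t : I3 -> I3 -> K) : cubic_syz t ->
  (forall c, mix3 (t^~ c)) -> (forall a, mix3 (t a)) -> forall a c, t a c = 0.
Proof.
move=> [[tL tR] tC] mL mR [[i j] k] [[i' j'] k'].
have hL c : t (i, j, k) c + t (j, k, i) c + t (k, i, j) c = 0 by apply: (mL c).2.
have hR a : t a (i', j', k') + t a (j', k', i') + t a (k', i', j') = 0 by apply: (mR a).2.
have h1 := tC (i, j, k) (i', j', k'); have h2 := tC (j, i, k) (i', j', k').
rewrite /rot3 /= in h1 h2; rewrite (tL i j k) (tL k i j) (tL j k i) in h2.
apply: (mulfI n3); rewrite mulr0.
transitivity ((t (i, j, k) (i', j', k') + t (j, k, i) (j', k', i') + t (k, i, j) (k', i', j'))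
  + (t (i, j, k) (i', j', k') + t (k, i, j) (j', k', i') + t (j, k, i) (k', i', j'))
  - (t (j, k, i) (i', j', k') + t (j, k, i) (j', k', i') + t (j, k, i) (k', i', j'))
  - (t (k, i, j) (i', j', k') + t (k, i, j) (j', k', i') + t (k, i, j) (k', i', j'))
  + (t (i, j, k) (i', j', k') + t (j, k, i) (i', j', k') + t (k, i, j) (i', j', k'))).
  ring.
by rewrite h1 h2 hL !hR !subr0 !addr0.
Qed.

(** For tensors already symmetric in the first two left indices, averaging over rotations is the
    full symmetrisation on the left. *)
Definition symL (t : I3 -> I3 -> K) a c :=
  3%:R^-1 * (t a c + t (rot3 a) c + t (rot3 (rot3 a)) c).

Lemma rot3K (a : I3) : rot3 (rot3 (rot3 a)) = a.
Proof. by case: a => -[]. Qed.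

Lemma symL_sym t c : swap_sym t -> sym3 (symL t ^~ c).
Proof.
move=> [tL tR]; split=> i j k; rewrite /symL /rot3 /=.
  by rewrite (tL i j k) (tL k i j) (tL j k i); congr (_ * _); ring.
by rewrite (tL k i j) (tL j k i) (tL i j k); congr (_ * _); ring.
Qed.

Lemma mixL_mix t c : swap_sym t -> mix3 (fun a => t a c - symL t a c).
Proof.
move=> st; have [s1 s2] := symL_sym c st; have [tL tR] := st; split=> i j k.
  by rewrite tL s1.
have e : symL t (k, i, j) c = symL t (i, j, k) c by rewrite s1 s2.
have e' : symL t (j, k, i) c = symL t (i, j, k) c by rewrite s2 s1.
rewrite e e'; have := mulfV n3; move=> h3.
have {e e'} -> : t (i, j, k) c - symL t (i, j, k) c + (t (j, k, i) c - symL t (i, j, k) c) +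
   (t (k, i, j) c - symL t (i, j, k) c) =
   t (i, j, k) c + t (j, k, i) c + t (k, i, j) c - 3%:R * symL t (i, j, k) c by ring.
by rewrite /symL /rot3 /= mulrA h3 mul1r subrr.
Qed.

(** The left average is invariant under rotation on the left, so the relation over simultaneous
    rotations becomes one over rotations on the right alone. *)
Lemma symL_mixR t a : cubic_syz t -> mix3 (symL t a).
Proof.
move=> [[tL tR] tC]; split=> i j k; first by rewrite /symL (tR a i j) (tR _ i j) (tR (rot3 (rot3 a)) i j).
pose s b c := symL t b c.
have rotL b c : symL t (rot3 b) c = symL t b c.
  by rewrite /symL !rot3K; congr (_ * _); ring.
have h : symL t a (i, j, k) + symL t (rot3 a) (rot3 (i, j, k)) + symL t (rot3 (rot3 a)) (rot3 (rot3 (i, j, k))) = 0.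
  rewrite /symL -!mulrDr -[RHS](mulr0 3%:R^-1); congr (_ * _).
  transitivity ((t a (i, j, k) + t (rot3 a) (rot3 (i, j, k)) + t (rot3 (rot3 a)) (rot3 (rot3 (i, j, k))))
   + (t (rot3 a) (i, j, k) + t (rot3 (rot3 a)) (rot3 (i, j, k)) + t (rot3 (rot3 (rot3 a))) (rot3 (rot3 (i, j, k))))
   + (t (rot3 (rot3 a)) (i, j, k) + t (rot3 (rot3 (rot3 a))) (rot3 (i, j, k)) + t (rot3 (rot3 (rot3 (rot3 a)))) (rot3 (rot3 (i, j, k))))).
    ring.
  by rewrite !tC !addr0.
by rewrite !rotL in h.
Qed.

Definition tflip (t : I3 -> I3 -> K) a c := t c a.

Lemma swap_sym_flip t : swap_sym t -> swap_sym (tflip t).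
Proof. by move=> [tL tR]; split=> *; rewrite /tflip; [apply: tR|apply: tL]. Qed.

Lemma cubic_syz_flip t : cubic_syz t -> cubic_syz (tflip t).
Proof. by move=> [/swap_sym_flip st tC]; split=> // a c; apply: tC. Qed.

Lemma cubic_syz_sub t t' : cubic_syz t -> cubic_syz t' -> cubic_syz (fun a c => t a c - t' a c).
Proof.
move=> [[tL tR] tC] [[tL' tR'] tC']; split; first by split=> *; [rewrite tL tL'|rewrite tR tR'].
move=> a c; rewrite -[RHS](subrr 0) -{1}(tC a c) -(tC' a c); ring.
Qed.

Lemma symL_cubic t : cubic_syz t -> cubic_syz (symL t).
Proof.
move=> ct; have [st tC] := ct; split.
  split=> [i j k c|a i j k]; first by have [-> _] := symL_sym c st.
  by have [-> _] := symL_mixR a ct.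
move=> a [[i j] k].
have rotL b c : symL t (rot3 b) c = symL t b c.
  by rewrite /symL !rot3K; congr (_ * _); ring.
by rewrite !rotL; have [_] := symL_mixR a ct; apply.
Qed.

(** The part of [t] mixed on the left is again a syzygy tensor. Removing its right average leaves a
    tensor mixed on both sides, which is zero by [cubic_syz_mix_mix]; so it equals its right
    average. *)
Lemma mixL_symR t a : cubic_syz t -> sym3 (fun c => t a c - symL t a c).
Proof.
move=> ct; pose m b c := t b c - symL t b c.
have cm : cubic_syz m by apply: cubic_syz_sub => //; apply: symL_cubic.
pose mf := tflip m; have cmf : cubic_syz mf := cubic_syz_flip cm.
have hm c' : mix3 (m^~ c') := mixL_mix c' ct.1.
have z c b : mf c b - symL mf c b = 0.
  apply: (cubic_syz_mix_mix (t := fun c b => mf c b - symL mf c b)).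
  - by apply: cubic_syz_sub => //; apply: symL_cubic.
  - by move=> b'; exact: (mixL_mix b' cmf.1).
  - move=> c'; have hs := symL_mixR c' cmf.
    split=> i j k; first by rewrite hs.1 /mf /tflip (hm c').1.
    rewrite -[RHS](subrr 0) -{1}((hm c').2 i j k) -(hs.2 i j k) /mf /tflip; ring.
have e c b : m b c = symL mf c b by apply/eqP; rewrite -subr_eq0; apply/eqP/z.
have := symL_sym a cmf.1; rewrite /sym3 -/(m a).
by case=> h1 h2; split=> i j k; rewrite -/(m a _) -/(m a _) !e.
Qed.

Variables (d e : nat) (rho : 'M[K]_n -> 'M[K]_d) (sigma : 'M[K]_n -> 'M[K]_e).
Variables (Er : I3 -> 'rV[K]_d) (Dr : I3 -> 'cV[K]_d) (Es : I3 -> 'rV[K]_e) (Ds : I3 -> 'cV[K]_e).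
Hypothesis Mr : is_model (@sym3 K n) rho Er Dr.
Hypothesis Ms : is_model (@mix3 K n) sigma Es Ds.

Definition tens (q : swapmod K d e) (a c : I3) : K :=
  (Er a *m q.1 *m (Es c)^T) 0 0 + (Es a *m q.2 *m (Er c)^T) 0 0.

Lemma pair_tr p p' (x : 'rV[K]_p) (q : 'M[K]_(p, p')) (y : 'rV[K]_p') :
  (x *m q *m y^T) 0 0 = (y *m (q^T *m x^T)) 0 0.
Proof. by rewrite -[LHS](mxE trmx_key (fun i j => (x *m q *m y^T) j i)) -/(trmx _) !trmx_mul trmxK. Qed.

Lemma tens_cubic q : cubic_syz (tens q).
Proof.
have [cr _ _ _] := Mr; have [cs _ _ _] := Ms.
have hr p (A : 'M[K]_(d, p)) (w : 'cV_p) : sym3 (fun a => (Er a *m A *m w) 0 0).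
  by have [h1 h2] := cr (A *m w); split=> i j k; rewrite -!mulmxA; [exact: h1|exact: h2].
have hs p (A : 'M[K]_(e, p)) (w : 'cV_p) : mix3 (fun a => (Es a *m A *m w) 0 0).
  by have [h1 h2] := cs (A *m w); split=> i j k; rewrite -!mulmxA; [exact: h1|exact: h2].
split; last first.
  move=> [[i j] k] [[i' j'] k']; rewrite /tens /rot3 /=.
  have r1 (w : 'cV[K]_e) : (Er (j, k, i) *m q.1 *m w) 0 0 = (Er (i, j, k) *m q.1 *m w) 0 0.
    by rewrite (hr _ q.1 w).2 (hr _ q.1 w).1.
  have r2 (w : 'cV[K]_e) : (Er (k, i, j) *m q.1 *m w) 0 0 = (Er (i, j, k) *m q.1 *m w) 0 0.
    by rewrite (hr _ q.1 w).1 (hr _ q.1 w).2.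
  rewrite !r1 !r2 !pair_tr.
  have s1 (w : 'cV[K]_d) : (Er (j', k', i') *m w) 0 0 = (Er (i', j', k') *m w) 0 0.
    by rewrite (cr w).2 (cr w).1.
  have s2 (w : 'cV[K]_d) : (Er (k', i', j') *m w) 0 0 = (Er (i', j', k') *m w) 0 0.
    by rewrite (cr w).1 (cr w).2.
  rewrite !s1 !s2 -!pair_tr.
  transitivity (((Es (i', j', k') *m (q.1^T *m (Er (i, j, k))^T)) 0 0
    + (Es (j', k', i') *m (q.1^T *m (Er (i, j, k))^T)) 0 0
    + (Es (k', i', j') *m (q.1^T *m (Er (i, j, k))^T)) 0 0)
   + ((Es (i, j, k) *m q.2 *m (Er (i', j', k'))^T) 0 0
    + (Es (j, k, i) *m q.2 *m (Er (i', j', k'))^T) 0 0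
    + (Es (k, i, j) *m q.2 *m (Er (i', j', k'))^T) 0 0)).
    rewrite -!pair_tr; ring.
  by rewrite (cs _).2 (hs _ _ _).2 addr0.
split=> [i j k c|c i j k]; rewrite /tens.
  by rewrite (hr _ _ _).1 (hs _ _ _).1.
by rewrite !pair_tr (cs _).1 (cr _).1.
Qed.

Lemma model_bilinear_inj d' e' cond cond' rho' sigma' (E : I3 -> 'rV[K]_d') D (E' : I3 -> 'rV[K]_e') D'
    (q : 'M[K]_(d', e')) : is_model cond rho' E D -> is_model cond' sigma' E' D' ->
  (forall a c, (E a *m q *m (E' c)^T) 0 0 = 0) -> q = 0.
Proof.
move=> [_ _ _ sep] [_ _ _ sep'] h.
have h1 c : q *m (E' c)^T = 0 by apply: sep => a; rewrite mulmxA.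
have h2 k : (row k q)^T = 0.
  apply: sep' => c; have := congr1 (fun w : 'cV_d' => w k 0) (h1 c).
  rewrite [RHS]mxE => <-; rewrite !mxE; apply: eq_bigr => i _.
  by rewrite !mxE mulrC.
by apply/row_matrixP => k; apply: trmx_inj; rewrite h2 row0 trmx0.
Qed.

Lemma tens_lin c q q' a b : tens (c *: q + q') a b = c * tens q a b + tens q' a b.
Proof. by rewrite /tens /= !mulmxDr !mulmxDl -!scalemxAr -!scalemxAl !entD !entZ; ring. Qed.

(** Summing over the rotations of the left triple kills the block that is mixed on the left and
    multiplies the symmetric one by 3; hence each block vanishes separately. *)
Lemma tens_eq0 q : (forall a c, tens q a c = 0) -> q = 0.
Proof.
move=> h.
have [cr _ _ _] := Mr; have [cs _ _ _] := Ms.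
have h1 : q.1 = 0.
  apply: (model_bilinear_inj Mr Ms) => a c; apply: (mulfI n3); rewrite mulr0.
  have [c1 c2] := cr (q.1 *m (Es c)^T); have [_ s2] := cs (q.2 *m (Er c)^T).
  case: a => -[i j] k.
  have e1 := h (i, j, k) c; have e2 := h (j, k, i) c; have e3 := h (k, i, j) c; have e4 := s2 i j k.
  rewrite /tens -!mulmxA in e1 e2 e3; rewrite (c2 j i k) (c1 i j k) in e2; rewrite (c1 i k j) (c2 i j k) in e3.
  rewrite -mulmxA; move: e1 e2 e3 e4; set x := (Er _ *m _) 0 0.
  set z1 := (Es (i, j, k) *m _) 0 0; set z2 := (Es (j, k, i) *m _) 0 0; set z3 := (Es (k, i, j) *m _) 0 0.
  move=> e1 e2 e3 e4; transitivity ((x + z1) + (x + z2) + (x + z3) - (z1 + z2 + z3)); first by ring.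
  by rewrite e1 e2 e3 e4 !addr0 subrr.
have h2 : q.2 = 0.
  apply: (model_bilinear_inj Ms Mr) => a c.
  by have := h a c; rewrite /tens h1 mulmx0 mul0mx mxE add0r.
by case: (q) h1 h2 => q1 q2 /= -> ->.
Qed.

Lemma model_bilinear_surj d' e' cond cond' rho' sigma' (E : I3 -> 'rV[K]_d') D (E' : I3 -> 'rV[K]_e') D'
    (t : I3 -> I3 -> K) : is_model cond rho' E D -> is_model cond' sigma' E' D' ->
  (forall c, cond (t^~ c)) -> (forall a, cond' (t a)) ->
  exists q : 'M[K]_(d', e'), forall a c, (E a *m q *m (E' c)^T) 0 0 = t a c.
Proof.
move=> [_ _ rep _] [_ _ rep' _] ht ht'.
exists (\sum_b \sum_b' t b b' *: (D b *m (D' b')^T)) => a c.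
rewrite -[RHS](rep _ (ht c)) mulmx_sumr mulmx_suml summxE; apply: eq_bigr => b _.
rewrite -(rep' _ (ht' b)) mulmx_sumr mulmx_suml summxE mulr_suml; apply: eq_bigr => b' _.
rewrite -scalemxAr -scalemxAl entZ -mulrA; congr (_ * _).
have -> : E a *m (D b *m (D' b')^T) *m (E' c)^T = (E a *m D b) *m (E' c *m D' b')^T.
  by rewrite trmx_mul !mulmxA.
have e11 (x y : 'M[K]_1) : (x *m y^T) 0 0 = y 0 0 * x 0 0.
  by rewrite mxE big_ord1 mxE mulrC.
exact: e11.
Qed.

Lemma tens_surj t : cubic_syz t -> exists q, forall a c, tens q a c = t a c.
Proof.
move=> ct; have [st _] := ct.
have [q1 h1] := model_bilinear_surj Mr Ms (fun c => symL_sym c st) (fun a => symL_mixR a ct).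
have [q2 h2] := model_bilinear_surj Ms Mr (t := fun a c => t a c - symL t a c)
   (fun c => mixL_mix c st) (fun a => mixL_symR a ct).
by exists (q1, q2) => a c; rewrite /tens /= h1 h2 addrC subrK.
Qed.

Lemma tens_act A B q a c : A \in unitmx -> B \in unitmx ->
  tens (gl_act (swap_action rho sigma) A B q) a c =
  \sum_a' \sum_c' act3 A a a' * act3 B c c' * tens q a' c'.
Proof.
move=> Au Bu; rewrite /tens /=.
have pairE d' e' cond cond' rho' sigma' (E : I3 -> 'rV[K]_d') D (E' : I3 -> 'rV[K]_e') D' q' :
    is_model cond rho' E D -> is_model cond' sigma' E' D' ->
    (E a *m (rho' A *m q' *m (sigma' B)^T) *m (E' c)^T) 0 0 =
    \sum_a' \sum_c' act3 A a a' * act3 B c c' * (E a' *m q' *m (E' c')^T) 0 0.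
  move=> [_ act _ _] [_ act' _ _].
  have -> : E a *m (rho' A *m q' *m (sigma' B)^T) *m (E' c)^T =
      (E a *m rho' A) *m q' *m (E' c *m sigma' B)^T by rewrite trmx_mul !mulmxA.
  rewrite act // act' // mulmx_suml mulmx_suml summxE; apply: eq_bigr => a' _.
  rewrite linear_sum mulmx_sumr summxE; apply: eq_bigr => c' _ /=.
  by rewrite linearZ /= -scalemxAr -!scalemxAl !entZ mulrA [_ * act3 A a a']mulrC.
rewrite (pairE _ _ _ _ _ _ _ _ _ _ _ Mr Ms) (pairE _ _ _ _ _ _ _ _ _ _ _ Ms Mr) -big_split.
apply: eq_bigr => a' _; rewrite -big_split; apply: eq_bigr => c' _ /=.
by rewrite mulrDr.
Qed.

Lemma tens_invol q a c : tens (invol (swap_action rho sigma) q) a c = tens q c a.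
Proof.
have tr p p' (x : 'rV[K]_p) (z : 'M[K]_(p', p)) (y : 'rV[K]_p') :
    (x *m z^T *m y^T) 0 0 = (y *m z *m x^T) 0 0.
  by rewrite pair_tr trmxK mulmxA.
by rewrite /tens /= !tr addrC.
Qed.

End CubicTensors.

(** * Tensors as coordinates of the degree 3 part of F_1 *)

Section LinearSyzygyTensors.

Variables (K : fieldType) (charK : [pchar K] =i pred0) (n : nat) (F : min_resolution K n).
Local Notation S := (mxpolyring K n).
Local Notation I2 := ('I_n * 'I_n)%type.
Local Notation I3 := ('I_n * 'I_n * 'I_n)%type.
Local Notation idx i j := (@mxvec_index n n i j).
Local Notation X i j := ('X_(idx i j) : S).
Local Notation mu := (rowev (gen_map F)).

Variable (g : I2 -> I2 -> 'rV[K]_(rk F 1)).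
Hypothesis gP : forall a c, mu (crow _ (g a c)) = perm2 K a c.

Definition swap12 (a : I3) : I3 := (a.1.2, a.1.1, a.2).

Lemma swap12K : involutive swap12.
Proof. by case=> -[]. Qed.

Definition cubic_elt (a c : I3) : 'rV[S]_(rk F 1) := X a.2 c.2 *: crow _ (g a.1 c.1).

Definition cubic_comb (t : I3 -> I3 -> K) : 'rV[S]_(rk F 1) :=
  \sum_a \sum_c (t a c)%:MP *: cubic_elt a c.

Definition x3 (a c : I3) : S := X a.1.1 c.1.1 * X a.1.2 c.1.2 * X a.2 c.2.

Lemma cubic_elt_swapL a c : cubic_elt (swap12 a) c = cubic_elt a c.
Proof. by rewrite /cubic_elt /= (quad_gen_swapL charK gP a.1 c.1). Qed.

Lemma cubic_elt_swapR a c : cubic_elt a (swap12 c) = cubic_elt a c.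
Proof. by rewrite /cubic_elt /= (quad_gen_swapR charK gP a.1 c.1). Qed.

Lemma row_homog_cubic_comb t : row_homog (@shift _ _ F 1) 3 (cubic_comb t).
Proof.
apply: row_homog_sum => a _; apply: row_homog_sum => c _.
rewrite -[3%N]/(0 + (1 + 2))%N; apply: row_homogZ.
  apply/dhomogP => m; rewrite msuppC; case: ifP => // _.
  by rewrite inE => /eqP ->; exact: mdeg0.
apply: row_homogZ; last exact: quad_gen_homog.
by apply/dhomogP => m; rewrite msuppX inE => /eqP ->; exact: mdeg1.
Qed.

Lemma cubic_comb_lin c t t' :
  cubic_comb (fun a b => c * t a b + t' a b) = c%:MP *: cubic_comb t + cubic_comb t'.
Proof.
rewrite /cubic_comb scaler_sumr -big_split; apply: eq_bigr => a _ /=.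
rewrite scaler_sumr -big_split; apply: eq_bigr => b _ /=.
by rewrite mpolyCD mpolyCM scalerDl scalerA.
Qed.

Lemma eq_cubic_comb t t' : (forall a c, t a c = t' a c) -> cubic_comb t = cubic_comb t'.
Proof. by move=> e; apply: eq_bigr => a _; apply: eq_bigr => c _; rewrite e. Qed.

Lemma gen_map_cubic_comb t : swap_sym t ->
  mu (cubic_comb t) = 2%:R * \sum_a \sum_c (t a c)%:MP * x3 a c.
Proof.
move=> [tL tR].
have muY a c : mu (cubic_elt a c) = x3 a c + x3 a (swap12 c).
  rewrite /cubic_elt rowevZ gP /perm2 /x3 /= mulrDr.
  by rewrite -!mulrA ![X a.2 c.2 * _]mulrC -!mulrA.
transitivity (\sum_a \sum_c ((t a c)%:MP * x3 a c + (t a (swap12 c))%:MP * x3 a c)).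
  rewrite rowev_sum; apply: eq_bigr => a _; rewrite rowev_sum big_split /=.
  rewrite [Y in _ = _ + Y](reindex_inj (inv_inj swap12K)) -big_split; apply: eq_bigr => c _ /=.
  by rewrite rowevZ muY mulrDr swap12K.
rewrite mulr_sumr; apply: eq_bigr => a _; rewrite mulr_sumr; apply: eq_bigr => c _.
have -> : t a (swap12 c) = t a c by case: c => -[i j] k; rewrite tR.
by rewrite mulr_natl mulr2n.
Qed.

Lemma collapse3 (T : I3 -> I3 -> K) (p q r : I2) :
  \sum_a \sum_c (T a c)%:MP * ((idx a.1.1 c.1.1 == idx p.1 p.2)%:R *
     (idx a.1.2 c.1.2 == idx q.1 q.2)%:R * (idx a.2 c.2 == idx r.1 r.2)%:R : S)
  = (T (p.1, q.1, r.1) (p.2, q.2, r.2))%:MP.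
Proof.
pose a0 : I3 := (p.1, q.1, r.1); pose c0 : I3 := (p.2, q.2, r.2).
have dE (a c : I3) : ((idx a.1.1 c.1.1 == idx p.1 p.2)%:R *
     (idx a.1.2 c.1.2 == idx q.1 q.2)%:R * (idx a.2 c.2 == idx r.1 r.2)%:R : S)
     = ((a == a0) && (c == c0))%:R.
  rewrite -!natrM !mulnb !eq_idx; congr (_ (nat_of_bool _)).
  case: a c => -[a1 a2] a3 [[c1 c2] c3]; rewrite /a0 /c0 !xpair_eqE /=.
  by case: (a1 == _); case: (a2 == _); case: (a3 == _); case: (c1 == _); case: (c2 == _); case: (c3 == _).
under eq_bigr => a _ do under eq_bigr => c _ do rewrite dE.
rewrite (bigD1 a0) //= (bigD1 c0) //= !eqxx mulr1 !big1 ?addr0 //.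
  by move=> a /negbTE ne; rewrite big1 // => c _; rewrite ne mulr0.
by move=> c /negbTE ne; rewrite ne mulr0.
Qed.

(** A third derivative picks the six orders of three variables, equal in pairs by [swap_sym], that
    is, twice the rotation sum. Conversely [x3] is invariant under simultaneous rotation, so three
    times the sum is a combination of rotation sums. *)
Lemma sum_x3_eq0 t : swap_sym t ->
  \sum_a \sum_c (t a c)%:MP * x3 a c = 0 <->
  forall a c, t a c + t (rot3 a) (rot3 c) + t (rot3 (rot3 a)) (rot3 (rot3 c)) = 0.
Proof.
move=> [tL tR]; split=> [h [[i j] k] [[i' j'] k']|h].
  pose D (f : S) : S := f^`M(idx i i')^`M(idx j j')^`M(idx k k').
  have DZ c (f : S) : D (c%:MP * f) = c%:MP * D f by rewrite /D !mderiv_mulC.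
  have D0 : D 0 = 0 by rewrite /D !mderiv0.
  have DD f f' : D (f + f') = D f + D f' by rewrite /D !mderivD.
  have Dsum (G : I3 -> S) : D (\sum_a G a) = \sum_a D (G a) by apply: (big_morph D DD D0).
  have := congr1 D h; rewrite Dsum D0.
  under eq_bigr => a _ do rewrite Dsum.
  under eq_bigr => a _ do under eq_bigr => c _ do rewrite DZ /D /x3 mderiv3 !mulrDr.
  under eq_bigr => a _ do rewrite !big_split /=.
  rewrite !big_split /=.
  rewrite (collapse3 t (i, i') (j, j') (k, k')) (collapse3 t (j, j') (i, i') (k, k')).
  rewrite (collapse3 t (i, i') (k, k') (j, j')).
  rewrite (collapse3 t (k, k') (i, i') (j, j')) (collapse3 t (j, j') (k, k') (i, i')).
  rewrite (collapse3 t (k, k') (j, j') (i, i')) /= -!mpolyCD => /eqP; rewrite mpolyC_eq0 => /eqP.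
  rewrite (tL i j k) (tR _ i' j' k') (tL k i j) (tR _ k' i' j') (tL j k i) (tR _ j' k' i').
  have n2 : (2%:R : K) != 0 by apply: natf_neq0_char0.
  by move=> e; apply: (mulfI n2); rewrite mulr0 -[RHS]e /rot3 /=; ring.
have n3 : (3%:R : K) != 0 by apply: natf_neq0_char0.
have rot3_inj : injective (@rot3 n).
  by apply: (can_inj (g := fun a => rot3 (rot3 a))) => -[[]].
pose T a c : S := (t a c)%:MP.
have reidx (T' : I3 -> I3 -> S) : \sum_a \sum_c T' a c * x3 a c =
    \sum_a \sum_c T' (rot3 a) (rot3 c) * x3 a c.
  rewrite (reindex_inj rot3_inj) /=; apply: eq_bigr => a _.
  rewrite (reindex_inj rot3_inj) /=; apply: eq_bigr => c _; congr (_ * _).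
  by rewrite /x3 /rot3 /= [LHS]mulrC mulrA.
have e3 : (3%:R : K)%:MP * (\sum_a \sum_c T a c * x3 a c) = 0.
  transitivity (\sum_a \sum_c T a c * x3 a c + \sum_a \sum_c T (rot3 a) (rot3 c) * x3 a c
     + \sum_a \sum_c T (rot3 (rot3 a)) (rot3 (rot3 c)) * x3 a c).
    rewrite -(reidx (fun a c => T (rot3 a) (rot3 c))) -(reidx T) mpolyC_nat.
    by rewrite mulr_natl !mulrS mulr0n addr0 addrA.
  rewrite -!big_split big1 // => a _; rewrite /= -!big_split big1 // => c _ /=.
  by rewrite -!mulrDl -!mpolyCD h mpolyC0 mul0r.
by move/eqP: e3; rewrite mulf_eq0 mpolyC_eq0 (negbTE n3) /= => /eqP.
Qed.

Lemma gen_map_cubic_eq0 t : swap_sym t -> mu (cubic_comb t) = 0 <-> cubic_syz t.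
Proof.
move=> st; rewrite gen_map_cubic_comb //.
have n2 : (2%:R : S) != 0 by rewrite -mpolyC_nat mpolyC_eq0; apply: natf_neq0_char0.
split=> [/eqP|[_ /(sum_x3_eq0 st) ->]]; last by rewrite mulr0.
by rewrite mulf_eq0 (negbTE n2) /= => /eqP/(sum_x3_eq0 st).
Qed.

(** A mixed second derivative of the corresponding combination of permanents consists of four terms,
    all equal by the two symmetries of [s]. *)
Lemma quad_comb_eq0 (s : I2 -> I2 -> K) : (forall a c, s (a.2, a.1) c = s a c) ->
  (forall a c, s a (c.2, c.1) = s a c) -> \sum_a \sum_c s a c *: g a c = 0 ->
  forall a c, s a c = 0.
Proof.
move=> sL sR h [i k] [j l].
have n4 : (4%:R : K) != 0 by apply: natf_neq0_char0.
have h2 : \sum_a \sum_c (s a c)%:MP * perm2 K a c = 0.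
  transitivity (mu (crow _ (\sum_a \sum_c s a c *: g a c))).
    rewrite crow_sum rowev_sum; apply: eq_bigr => a _; rewrite crow_sum rowev_sum; apply: eq_bigr => c _.
    by rewrite -[s a c *: _]addr0 crow_lin crow0 addr0 rowevZ gP.
  by rewrite h /rowev; apply/eqP; rewrite -[crow _ 0]/(map_mx _ 0) map_mx0 mul0mx mxE.
pose D (f : S) : S := f^`M(idx i j)^`M(idx k l).
have DZ c (f : S) : D (c%:MP * f) = c%:MP * D f by rewrite /D !mderiv_mulC.
have D0 : D 0 = 0 by rewrite /D !mderiv0.
have DD f f' : D (f + f') = D f + D f' by rewrite /D !mderivD.
have Dsum (G : I2 -> S) : D (\sum_a G a) = \sum_a D (G a) by apply: (big_morph D DD D0).
have collapse2 (p q : I2) (sg : I2 -> I2) : involutive sg ->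
    \sum_a \sum_c (s a c)%:MP * ((idx a.1 (sg c).1 == idx p.1 p.2)%:R *
     (idx a.2 (sg c).2 == idx q.1 q.2)%:R : S) = (s (p.1, q.1) (sg (p.2, q.2)))%:MP.
  move=> sgK; have dE (a c : I2) : ((idx a.1 (sg c).1 == idx p.1 p.2)%:R *
     (idx a.2 (sg c).2 == idx q.1 q.2)%:R : S) = ((a == (p.1, q.1)) && (c == sg (p.2, q.2)))%:R.
    rewrite -natrM mulnb !eq_idx -(can2_eq sgK sgK); congr (_ (nat_of_bool _)).
    case: a (sg c) => a1 a2 [c1 c2]; rewrite !xpair_eqE /=.
    by case: (a1 == _); case: (a2 == _); case: (c1 == _); case: (c2 == _).
  under eq_bigr => a _ do under eq_bigr => c _ do rewrite dE.
  rewrite (bigD1 (p.1, q.1)) //= (bigD1 (sg (p.2, q.2))) //= !eqxx mulr1 !big1 ?addr0 //.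
    by move=> a /negbTE ne; rewrite big1 // => c _; rewrite ne mulr0.
  by move=> c /negbTE ne; rewrite ne mulr0.
have := congr1 D h2; rewrite Dsum D0.
under eq_bigr => a _ do rewrite Dsum.
under eq_bigr => a _ do under eq_bigr => c _ do rewrite DZ /perm2 DD /D !mderiv2 !mulrDr.
under eq_bigr => a _ do rewrite !big_split /=.
rewrite !big_split /=.
have sw : involutive (fun c : I2 => (c.2, c.1)) by case.
rewrite (collapse2 (i, j) (k, l) id) // (collapse2 (k, l) (i, j) id) //.
rewrite (collapse2 (i, j) (k, l) (fun c => (c.2, c.1))) // (collapse2 (k, l) (i, j) (fun c => (c.2, c.1))) //=.
rewrite -!mpolyCD => /eqP; rewrite mpolyC_eq0 => /eqP.
have eL c : s (k, i) c = s (i, k) c by rewrite -(sL (i, k)).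
have eR b : s b (l, j) = s b (j, l) by rewrite -(sR b (j, l)).
rewrite !eL !eR => e.
by apply: (mulfI n4); rewrite mulr0 -[RHS]e; ring.
Qed.

(** Taking the coefficient of one variable fixes the last index on each side and leaves a constant
    relation among the quadratic generators. *)
Lemma cubic_comb_inj t : swap_sym t -> cubic_comb t = 0 -> forall a c, t a c = 0.
Proof.
move=> [tL tR] h a c.
have split3 (G : I3 -> K) : \sum_a G a = \sum_(b : I2) \sum_k G (b, k).
  by rewrite pair_bigA; apply: eq_bigr => -[].
suff e : \sum_(a' : I2) \sum_(c' : I2) t (a', a.2) (c', c.2) *: g a' c' = 0.
  have -> : t a c = t (a.1, a.2) (c.1, c.2) by case: a {e} => ? ?; case: c => ? ?.
  apply: (quad_comb_eq0 (s := fun a' c' => t (a', a.2) (c', c.2)) _ _ e).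
    by move=> [i j] c' /=; rewrite tL.
  by move=> a' [i j] /=; rewrite tR.
apply/rowP => j; rewrite summxE.
have := congr1 (fun u : 'rV[S]__ => (u 0 j)@_(U_(idx a.2 c.2))%MM) h.
rewrite [in Y in _ = Y -> _]mxE mcoeff0 => e0; rewrite [RHS]mxE -[RHS]e0.
rewrite /cubic_comb summxE raddf_sum /= split3.
apply: eq_bigr => a' _; rewrite summxE.
under [RHS]eq_bigr => k _ do rewrite summxE raddf_sum /= split3.
rewrite exchange_big /=; apply: eq_bigr => c' _.
have cE k k' : ((t (a', k) (c', k'))%:MP *: cubic_elt (a', k) (c', k')) 0 j =
   (t (a', k) (c', k') * g a' c' 0 j) *: X k k'.
  by rewrite !mxE /= [X _ _ * _]mulrC !mul_mpolyC scalerA.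
under [RHS]eq_bigr => k _ do under eq_bigr => k' _ do
  rewrite cE mcoeffZ mcoeffX eq_mnm1 eq_idx.
rewrite (bigD1 a.2) //= (bigD1 c.2) //= !eqxx mulr1 !big1 ?addr0 ?mxE //.
  by move=> k /negbTE ne; rewrite big1 // => k' _; rewrite ne mulr0.
by move=> k /negbTE ne; rewrite ne mulr0.
Qed.

Lemma homog1_sum (p : S) : p \is 1.-homog ->
  p = \sum_(i < n) \sum_(j < n) (p@_(U_(idx i j))%MM)%:MP * X i j.
Proof.
move=> hp; apply/mpolyP => m; rewrite raddf_sum /=.
under [RHS]eq_bigr => i _ do rewrite raddf_sum /=.
under [RHS]eq_bigr => i _ do under eq_bigr => j _ do rewrite mcoeffCM mcoeffX.
have [/eqP/mdeg1P [x /eqP ->]|ne] := eqVneq (mdeg m) 1%N.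
  have [i [j ->]] : exists i j, x = idx i j.
    by case: (mxvec_indexP x) => i j; exists i, j.
  rewrite (bigD1 i) //= (bigD1 j) //= eqxx mulr1 !big1 ?addr0 // => k.
    by move=> /negbTE ne; rewrite big1 // => l _; rewrite eq_mnm1 eq_idx ne mulr0.
  by move=> /negbTE ne; rewrite eq_mnm1 eq_idx ne andbF mulr0.
rewrite (dhomog_nemf_coeff hp) // big1 // => i _; rewrite big1 // => j _.
by case: eqP => [e|]; rewrite ?mulr0 //; move: ne; rewrite -e mdeg1.
Qed.

Lemma cubic_comb_surj u : row_homog (@shift _ _ F 1) 3 u ->
  exists2 t, swap_sym t & u = cubic_comb t.
Proof.
move=> hu.
have hz j : u 0 j \is 1.-homog.
  apply/dhomogP => m hm; have /forallP/(_ j)/allP/(_ m hm) := hu.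
  by rewrite (shift1 charK) -[3%N]/(1 + 2)%N eqn_add2r => /eqP.
have [s [hs ->]] := quad_gen_span_homog charK gP hz.
pose t0 (a c : I3) : K := (s a.1 c.1)@_(U_(idx a.2 c.2))%MM.
have -> : \sum_a \sum_c s a c *: crow _ (g a c) = cubic_comb t0.
  have split3 (G : I3 -> 'rV[S]_(rk F 1)) : \sum_a G a = \sum_(b : I2) \sum_k G (b, k).
    by rewrite pair_bigA; apply: eq_bigr => -[].
  rewrite /cubic_comb split3; apply: eq_bigr => a _.
  under [RHS]eq_bigr => k _ do rewrite split3.
  rewrite exchange_big /=; apply: eq_bigr => c _.
  rewrite {1}(homog1_sum (hs a c)) scaler_suml; apply: eq_bigr => k _.
  by rewrite scaler_suml; apply: eq_bigr => l _; rewrite /cubic_elt /= scalerA.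
(* Averaging over the exchange of the first two indices on both sides makes the tensor symmetric
   without changing the combination, by the symmetries of the generators. *)
pose t (a c : I3) : K := 4%:R^-1 * (t0 a c + t0 (swap12 a) c + t0 a (swap12 c) + t0 (swap12 a) (swap12 c)).
have n4 : (4%:R : K) != 0 by apply: natf_neq0_char0.
have L t1 : cubic_comb (fun a c => t1 (swap12 a) c) = cubic_comb t1.
  rewrite /cubic_comb [RHS](reindex_inj (inv_inj swap12K)); apply: eq_bigr => a _.
  by apply: eq_bigr => c _; rewrite cubic_elt_swapL.
have R t1 : cubic_comb (fun a c => t1 a (swap12 c)) = cubic_comb t1.
  apply: eq_bigr => a _; rewrite [RHS](reindex_inj (inv_inj swap12K)).
  by apply: eq_bigr => c _; rewrite cubic_elt_swapR.
exists t.
  by split=> [i j k c|a i j k]; rewrite /t /swap12 /=; congr (_ * _); ring.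
pose t1 a c := 1 * t0 (swap12 a) c + t0 a c.
pose t2 a c := 1 * t1 a (swap12 c) + t1 a c.
have e2 : cubic_comb t2 = (4%:R : K)%:MP *: cubic_comb t0.
  rewrite cubic_comb_lin R cubic_comb_lin L mpolyC1 !scale1r mpolyC_nat.
  by rewrite scaler_nat !mulrS mulr0n addr0 !addrA.
transitivity (cubic_comb (fun a c => 4%:R^-1 * t2 a c + (0 * t0 a c + 0))); last first.
  by apply: eq_cubic_comb => a c; rewrite /t /t2 /t1 mul0r !addr0 !mul1r; congr (_ * _); ring.
have z0 : cubic_comb (fun a c => 0 * t0 a c + 0) = 0.
  rewrite /cubic_comb big1 // => a _; rewrite big1 // => c _.
  by rewrite mul0r addr0 mpolyC0 scale0r.
by rewrite cubic_comb_lin e2 z0 addr0 scalerA -mpolyCM mulVf // mpolyC1 scale1r.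
Qed.

End LinearSyzygyTensors.

(** * Lifts of the group action *)

Section Substitution.

Variables (K : fieldType) (n : nat) (M : 'M[mxpolyring K n]_n).
Local Notation idx i j := (@mxvec_index n n i j).
Local Notation X i j := ('X_(idx i j) : mxpolyring K n).
Local Notation theta := (mxsubst M).

Lemma mxsubstD p q : theta (p + q) = theta p + theta q.
Proof. exact: rmorphD. Qed.

Lemma mxsubstM p q : theta (p * q) = theta p * theta q.
Proof. exact: rmorphM. Qed.

Lemma mxsubstC c : theta c%:MP = c%:MP.
Proof. exact: comp_mpolyC. Qed.

Lemma mxsubstX i j : theta (X i j) = M i j.
Proof. by rewrite /mxsubst comp_mpolyXU -tnth_nth tnth_mktuple mxvecE. Qed.

End Substitution.

Section Regrouping.

Variables (V : nmodType) (I J I' J' : finType).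

Lemma regroup_sum (H : I -> J -> I' -> J' -> V) :
  \sum_i \sum_j \sum_i' \sum_j' H i j i' j' =
  \sum_(a : I' * I) \sum_(c : J' * J) H a.2 c.2 a.1 c.1.
Proof.
rewrite -(pair_bigA _ (fun i' i => \sum_(c : J' * J) H i c.2 i' c.1)) exchange_big /=.
apply: eq_bigr => i _; rewrite exchange_big; apply: eq_bigr => i' _.
by rewrite -(pair_bigA _ (fun j' j => H i j i' j')) exchange_big.
Qed.

Lemma exchange_sum2 (H : I -> J -> I' -> J' -> V) :
  \sum_i \sum_j \sum_i' \sum_j' H i j i' j' = \sum_i' \sum_j' \sum_i \sum_j H i j i' j'.
Proof.
under eq_bigr => i _ do (rewrite exchange_big; under eq_bigr => i' _ do rewrite exchange_big).
by rewrite exchange_big; apply: eq_bigr => i' _; rewrite exchange_big.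
Qed.

End Regrouping.

(** * Any lift of a substitution acts on linear syzygies by the expected formula *)

Section Twist.

Variables (K : fieldType) (charK : [pchar K] =i pred0) (n : nat) (F : min_resolution K n).
Local Notation S := (mxpolyring K n).
Local Notation I2 := ('I_n * 'I_n)%type.
Local Notation I3 := ('I_n * 'I_n * 'I_n)%type.
Local Notation idx i j := (@mxvec_index n n i j).
Local Notation X i j := ('X_(idx i j) : S).
Local Notation mu := (rowev (gen_map F)).
Local Notation sh i := (@shift _ _ F i).

Variable (M : 'M[S]_n) (T : forall i, 'rV[S]_(rk F i) -> 'rV[S]_(rk F i)).
Local Notation theta := (mxsubst M).

(* [T] is a lift to the resolution of the endomorphism [theta] of [S / det^perp]. *)
Record lifts_subst : Prop := LiftsSubst {
  lift_semilinear : forall i s (u v : 'rV[S]_(rk F i)), T (s *: u + v) = theta s *: T u + T v;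
  lift_homog : forall i d u, row_homog (sh i) d u -> row_homog (sh i) d (T u);
  lift_bdry : forall i (u : 'rV[S]_(rk F i.+1)), T (u *m bdry F i) = T u *m bdry F i;
  lift_aug : forall u : 'rV[S]_(rk F 0),
    in_det_perp ((T u *m aug F) 0 0 - theta ((u *m aug F) 0 0))
}.

Hypothesis TP : lifts_subst.

Lemma lift0 i : T (0 : 'rV[S]_(rk F i)) = 0.
Proof.
have := lift_semilinear TP 1 (0 : 'rV[S]_(rk F i)) 0.
rewrite scaler0 addr0 -mpolyC1 mxsubstC mpolyC1 scale1r.
by move=> e; apply: (addrI (T 0)); rewrite -e addr0.
Qed.

Lemma liftD i (u v : 'rV[S]_(rk F i)) : T (u + v) = T u + T v.
Proof. by have := lift_semilinear TP 1 u v; rewrite -mpolyC1 mxsubstC mpolyC1 !scale1r. Qed.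

Lemma liftZ i s (u : 'rV[S]_(rk F i)) : T (s *: u) = theta s *: T u.
Proof. by have := lift_semilinear TP s u 0; rewrite lift0 !addr0. Qed.

Lemma lift_sum i (I : Type) (r : seq I) (P : pred I) (f : I -> 'rV[S]_(rk F i)) :
  T (\sum_(k <- r | P k) f k) = \sum_(k <- r | P k) T (f k).
Proof. exact: (big_morph (@T i) (@liftD i) (lift0 i)). Qed.

(** Compatibility with the augmentation is assumed only modulo the apolar ideal. On the generator of
    F_0 the discrepancy is a constant, by degree, and the ideal has no nonzero constants. *)
Lemma lift_augE (u : 'rV[S]_(rk F 0)) : (T u *m aug F) 0 0 = theta ((u *m aug F) 0 0).
Proof.
have [j0 [c [j0P augE _ sh0]]] := rk0_basis charK F.
have uE (w : 'rV[S]_(rk F 0)) : (w *m aug F) 0 0 = w 0 j0 * c%:MP.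
  by rewrite mxE (bigD1 j0) //= big1 ?addr0 ?augE // => j /eqP []; apply: j0P.
pose e0 : 'rV[S]_(rk F 0) := delta_mx 0 j0.
have e0T : T e0 0 j0 = ((T e0 0 j0)@_0%MM)%:MP.
  have := lift_homog TP (@row_homog_delta K (n * n) _ (sh 0%N) j0); rewrite -/e0 => h.
  have h0 : row_homog (sh 0%N) 0 (T e0) by move: h; rewrite sh0.
  apply/mpolyP => m; rewrite mcoeffC; case: eqP => [<-|ne]; rewrite ?mulr1 ?mulr0 //.
  apply/eqP; apply: contraT => nz.
  have /row_homogP/(_ _ _ nz)/eqP := h0.
  by rewrite addn_eq0 mdeg_eq0 => /andP [/eqP e _]; case: ne.
have -> : u = u 0 j0 *: e0.
  by apply/rowP => j; rewrite !mxE (j0P j) !eqxx mulr1.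
have scE s (w : 'rV[S]_(rk F 0)) : ((s *: w) *m aug F) 0 0 = s * (w *m aug F) 0 0.
  by rewrite -scalemxAl mxE.
rewrite liftZ !scE mxsubstM; congr (_ * _).
have e01 : e0 0 j0 = 1 by rewrite mxE !eqxx.
have := lift_aug TP e0; rewrite !uE e01 mul1r mxsubstC e0T.
move=> /(in_det_perp_const0 charK); rewrite -mpolyCM mcoeffB !mcoeffC !eqxx !mulr1 => /eqP.
by rewrite subr_eq0 => /eqP ->.
Qed.

Lemma lift_gen_map (u : 'rV[S]_(rk F 1)) : mu (T u) = theta (mu u).
Proof. by rewrite /rowev /gen_map !mulmxA -lift_bdry // lift_augE. Qed.

Lemma lift_crow i (d : nat) (w : 'rV[K]_(rk F i)) : (forall j, sh i j = d) ->
  T (crow (n * n) w) = crow (n * n) (const_coef (T (crow (n * n) w))).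
Proof.
move=> shE; apply/esym/(row_homog_crow _ shE); apply: (lift_homog TP).
by apply/(row_homog_crow _ shE); rewrite crowK.
Qed.

Variable (g : I2 -> I2 -> 'rV[K]_(rk F 1)).
Hypothesis gP : forall a c, mu (crow _ (g a c)) = perm2 K a c.

Lemma lift_quad_gen a c w : theta (perm2 K a c) = mu (crow _ w) -> T (crow (n * n) (g a c)) = crow _ w.
Proof.
rewrite -gP -lift_gen_map (lift_crow _ (shift1 charK (F := F))) => /(gen_map_inj charK) <-.
by [].
Qed.

Lemma mu_crow_sum (I : finType) (k : I -> K) (w : I -> 'rV[K]_(rk F 1)) :
  mu (crow _ (\sum_i k i *: w i)) = \sum_i (k i)%:MP * mu (crow _ (w i)).
Proof.
rewrite crow_sum rowev_sum; apply: eq_bigr => i _; rewrite -rowevZ; congr mu.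
by apply/rowP => j; rewrite !mxE mpolyCM.
Qed.

Lemma lift_cubic_comb_gl A B t : M = (cstmx _ A)^T *m varmx K n *m cstmx _ B ->
  T (cubic_comb g t) =
  cubic_comb g (fun a c => \sum_a' \sum_c' act3 A a a' * act3 B c c' * t a' c').
Proof.
move=> defM.
have thX i j : theta (X i j) = \sum_k \sum_l (A k i * B l j)%:MP * X k l.
  rewrite mxsubstX defM mxE exchange_big /=; apply: eq_bigr => l _.
  rewrite mxE mulr_suml; apply: eq_bigr => k _; rewrite !mxE mpolyCM.
  by rewrite -!mulrA; congr (_ * _); rewrite mulrC.
pose k2 (a c a' c' : I2) : K := A a'.1 a.1 * A a'.2 a.2 * (B c'.1 c.1 * B c'.2 c.2).
have thXX i j i' j' : theta (X i j * X i' j') =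
    \sum_a' \sum_c' (k2 (i, i') (j, j') a' c')%:MP * (X a'.1 c'.1 * X a'.2 c'.2).
  rewrite mxsubstM !thX mulr_suml.
  transitivity (\sum_k \sum_l \sum_k' \sum_l'
     ((A k i * B l j)%:MP * X k l) * ((A k' i' * B l' j')%:MP * X k' l')).
    apply: eq_bigr => k _; rewrite mulr_suml; apply: eq_bigr => l _.
    by rewrite mulr_sumr; apply: eq_bigr => k' _; rewrite mulr_sumr.
  rewrite exchange_sum2 regroup_sum; apply: eq_bigr => a' _; apply: eq_bigr => c' _.
  by rewrite mulrACA -mpolyCM; congr (_%:MP * _); rewrite /k2 /=; ring.
have gT a c : T (crow _ (g a c)) = \sum_a' \sum_c' (k2 a c a' c')%:MP *: crow _ (g a' c').
  have -> : \sum_a' \sum_c' (k2 a c a' c')%:MP *: crow (n * n) (g a' c') =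
      crow (n * n) (\sum_a' \sum_c' k2 a c a' c' *: g a' c').
    rewrite crow_sum; apply: eq_bigr => a' _; rewrite crow_sum; apply: eq_bigr => c' _.
    by apply/rowP => j; rewrite !mxE -mpolyCM.
  apply: lift_quad_gen; rewrite crow_sum rowev_sum /perm2 mxsubstD.
  rewrite (thXX a.1 c.1 a.2 c.2) (thXX a.1 c.2 a.2 c.1) -big_split; apply: eq_bigr => a' _ /=.
  rewrite mu_crow_sum; pose s (c' : I2) : I2 := (c'.2, c'.1).
  have sK : involutive s by case.
  rewrite [Y in _ + Y](reindex_inj (inv_inj sK)) -big_split; apply: eq_bigr => c' _ /=.
  by rewrite gP /perm2 mulrDr; congr (_ + _%:MP * _); rewrite /k2 /=; ring.
have eltT a c : theta (X a.2 c.2) *: T (crow _ (g a.1 c.1)) =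
    \sum_b \sum_d (act3 A b a * act3 B d c)%:MP *: cubic_elt g b d.
  transitivity (\sum_k \sum_l \sum_a' \sum_c'
     (k2 a.1 c.1 a' c' * (A k a.2 * B l c.2))%:MP *: (X k l *: crow (n * n) (g a' c'))).
    rewrite gT thX scaler_suml; apply: eq_bigr => k _; rewrite scaler_suml; apply: eq_bigr => l _.
    rewrite scaler_sumr; apply: eq_bigr => a' _; rewrite scaler_sumr; apply: eq_bigr => c' _.
    by rewrite !scalerA; congr (_ *: _); rewrite [LHS]mulrC [LHS]mulrA -mpolyCM.
  rewrite regroup_sum; apply: eq_bigr => b _; apply: eq_bigr => d _.
  by congr (_%:MP *: _); rewrite /act3 /k2 /=; ring.
transitivity (\sum_a \sum_c \sum_b \sum_d
    (act3 A b a * act3 B d c * t a c)%:MP *: cubic_elt g b d).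
  rewrite /cubic_comb lift_sum; apply: eq_bigr => a _; rewrite lift_sum; apply: eq_bigr => c _.
  rewrite /cubic_elt !liftZ mxsubstC eltT scaler_sumr; apply: eq_bigr => b _.
  by rewrite scaler_sumr; apply: eq_bigr => d _; rewrite scalerA -mpolyCM mulrC.
rewrite exchange_sum2; apply: eq_bigr => b _; apply: eq_bigr => d _.
rewrite raddf_sum scaler_suml; apply: eq_bigr => a _.
by rewrite raddf_sum scaler_suml.
Qed.

Lemma lift_cubic_comb_tr t : M = (varmx K n)^T ->
  T (cubic_comb g t) = cubic_comb g (fun a c => t c a).
Proof.
move=> defM.
have thX i j : theta (X i j) = X j i by rewrite mxsubstX defM !mxE.
have gT a c : T (crow _ (g a c)) = crow _ (g c a).
  apply: lift_quad_gen; rewrite gP /perm2 mxsubstD !mxsubstM !thX.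
  by congr (_ + _); rewrite mulrC.
rewrite /cubic_comb lift_sum exchange_big; apply: eq_bigr => a _; rewrite lift_sum.
apply: eq_bigr => c _.
by rewrite !liftZ mxsubstC thX gT.
Qed.

End Twist.

(** * Pairs of matrices as row vectors *)

Section SwapVectors.

Variables (R : pzRingType) (d e : nat).

Definition swap_vec (q : swapmod R d e) : 'rV[R]_(d * e + e * d) :=
  row_mx (mxvec q.1) (mxvec q.2).

Definition vec_swap (v : 'rV[R]_(d * e + e * d)) : swapmod R d e :=
  (vec_mx (lsubmx v), vec_mx (rsubmx v)).

Lemma swap_vecK : cancel swap_vec vec_swap.
Proof. by case=> p q; rewrite /vec_swap row_mxKl row_mxKr !mxvecK. Qed.

Lemma vec_swapK : cancel vec_swap swap_vec.
Proof. by move=> v; rewrite /swap_vec !vec_mxK hsubmxK. Qed.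

Lemma vec_swap_lin c v w : vec_swap (c *: v + w) = c *: vec_swap v + vec_swap w.
Proof. by rewrite /vec_swap !linearP. Qed.

Lemma vec_swap0 : vec_swap 0 = 0.
Proof. by apply/eqP; rewrite /vec_swap !linear0. Qed.

Lemma swap_vec_lin c p q : swap_vec (c *: p + q) = c *: swap_vec p + swap_vec q.
Proof. by apply: (can_inj vec_swapK); rewrite vec_swap_lin !swap_vecK. Qed.

Lemma swap_vec0 : swap_vec 0 = 0.
Proof. by rewrite -vec_swap0 vec_swapK. Qed.

End SwapVectors.

Section ConstantScalars.

Variables (K : fieldType) (N d e : nat).
Local Notation S := {mpoly K[N]}.

Definition swap_cst (q : swapmod K d e) : swapmod S d e := (cstmx N q.1, cstmx N q.2).

Lemma swap_vec_cst q : swap_vec (swap_cst q) = cstmx N (swap_vec q).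
Proof. by rewrite /swap_vec /cstmx map_row_mx !map_mxvec. Qed.

Lemma vec_swap_cst v : vec_swap (cstmx N v) = swap_cst (vec_swap v).
Proof. by apply: (can_inj (@swap_vecK S d e)); rewrite vec_swapK swap_vec_cst vec_swapK. Qed.

Lemma row_homog_mul_cst r r' (sh : 'I_r -> nat) (sh' : 'I_r' -> nat) (M : 'M[K]_(r, r')) c k
    (w : 'rV[S]_r) : (forall j, sh j = c) -> (forall j, sh' j = c) ->
  row_homog sh k w -> row_homog sh' k (w *m cstmx N M).
Proof.
move=> hs hs' /row_homogP hw; apply/row_homogP => j m nz; rewrite hs'.
apply/eqP; apply: contraR nz => /eqP ne.
rewrite mxE raddf_sum /= big1 // => i _; rewrite mxE mulrC mcoeffCM.
suff -> : (w 0 i)@_m = 0 by rewrite mulr0.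
by case: (eqVneq (w 0 i)@_m 0) => // /hw; rewrite hs => /ne.
Qed.

Lemma swap_homog_vec c k (q : swapmod S d e) :
  swap_homog c k q = row_homog (fun=> c) k (swap_vec q).
Proof.
rewrite /swap_homog /row_homog; apply/andP/forallP => [[/forallP h1 /forallP h2] j|h].
  rewrite /swap_vec mxE; case: (split j) => j'; case/mxvec_indexP: j' => i l; rewrite mxvecE.
    exact: (forallP (h1 i)).
  exact: (forallP (h2 i)).
split; apply/forallP => i; apply/forallP => l.
  by have := h (lshift _ (mxvec_index i l)); rewrite row_mxEl mxvecE.
by have := h (rshift _ (mxvec_index i l)); rewrite row_mxEr mxvecE.
Qed.

(** The constant pairs contain a basis of the free module, so semilinear maps over the same
    substitution are compared there. *)
Lemma semilinear_ext (th : S -> S) (V : lmodType S) (f f' : swapmod S d e -> V) :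
  (forall s p q, f (s *: p + q) = th s *: f p + f q) ->
  (forall s p q, f' (s *: p + q) = th s *: f' p + f' q) ->
  th 1 = 1 -> (forall q, f (swap_cst q) = f' (swap_cst q)) -> f =1 f'.
Proof.
move=> hf hf' th1 eqf q; rewrite -(swap_vecK q); move: (swap_vec q) => {q} w.
have z (h : swapmod S d e -> V) : (forall s p q, h (s *: p + q) = th s *: h p + h q) -> h 0 = 0 :> V.
  move=> hh; have := hh 1 0 0; rewrite scaler0 addr0 th1 scale1r => e0.
  by apply: (addrI (h 0)); rewrite -e0 addr0.
rewrite (row_sum_delta w).
have step (h : swapmod S d e -> V) : (forall s p q, h (s *: p + q) = th s *: h p + h q) ->
    h (vec_swap (\sum_j w 0 j *: delta_mx 0 j)) = \sum_j th (w 0 j) *: h (swap_cst (vec_swap (delta_mx 0 j))) :> V.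
  move=> hh; elim/big_rec2: _ => [|j y v _ <-].
    by rewrite vec_swap0; exact: (z h hh).
  rewrite vec_swap_lin hh -vec_swap_cst; congr (_ *: h (vec_swap _) + _).
  by rewrite /cstmx map_delta_mx.
by rewrite (step f) // (step f') //; apply: eq_bigr => j _; rewrite eqf.
Qed.

End ConstantScalars.

Section Lifts.

Variables (K : fieldType) (n : nat) (F : min_resolution K n) (a : forall i, gdet_action K n 'rV[mxpolyring K n]_(rk F i)).
Hypothesis aP : equivariant_structure a.

Lemma gl_act_lifts A B : A \in unitmx -> B \in unitmx ->
  lifts_subst ((cstmx _ A)^T *m varmx K n *m cstmx _ B) (fun i => gl_act (a i) A B).
Proof.
move=> hA hB; split.
- by move=> i s u v; apply: (eqv_gl_semilinear aP).
- by move=> i k u; apply: (eqv_gl_homog aP).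
- by move=> i u; have [h _] := eqv_bdry aP i; rewrite h.
- by move=> u; apply: (eqv_aug_gl aP).
Qed.

Lemma invol_lifts : lifts_subst (varmx K n)^T (fun i => invol (a i)).
Proof.
split.
- by move=> i s u v; apply: (eqv_invol_semilinear aP).
- by move=> i k u; apply: (eqv_invol_homog aP).
- by move=> i u; have [_ h] := eqv_bdry aP i; rewrite h.
- by move=> u; apply: (eqv_aug_invol aP).
Qed.

End Lifts.

(** * Identification of F_2 with the free module on pairs of matrices *)

Section SecondSyzygies.

Variables (K : fieldType) (charK : [pchar K] =i pred0) (n : nat) (F : min_resolution K n).
Local Notation S := (mxpolyring K n).
Local Notation I2 := ('I_n * 'I_n)%type.
Local Notation I3 := ('I_n * 'I_n * 'I_n)%type.
Local Notation mu := (rowev (gen_map F)).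
Local Notation sh i := (@shift _ _ F i).
Variable (g : I2 -> I2 -> 'rV[K]_(rk F 1)).
Hypothesis gP : forall a c, mu (crow _ (g a c)) = perm2 K a c.
Variables (d e : nat) (rho : 'M[K]_n -> 'M[K]_d) (sigma : 'M[K]_n -> 'M[K]_e).
Variables (Er : I3 -> 'rV[K]_d) (Dr : I3 -> 'cV[K]_d) (Es : I3 -> 'rV[K]_e) (Ds : I3 -> 'cV[K]_e).
Hypothesis Mr : is_model (@sym3 K n) rho Er Dr.
Hypothesis Ms : is_model (@mix3 K n) sigma Es Ds.
Local Notation tens := (tens Er Es).

Lemma bdry1_inj (u v : 'rV[K]_(rk F 2)) :
  crow (n * n) u *m bdry F 1 = crow (n * n) v *m bdry F 1 -> u = v.
Proof.
move=> h.
have k0 : (crow (n * n) u - crow (n * n) v) *m bdry F 1 = 0 by rewrite mulmxBl h subrr.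
have [w hw] := (proj1 (exact_bdry _) k0).
have := bdry_const0 w; rewrite -hw => /rowP e0; apply/rowP => j.
have := e0 j; rewrite !mxE mcoeffB !mcoeffC !eqxx !mulr1 => /eqP.
by rewrite subr_eq0 => /eqP.
Qed.

Lemma cubic_comb0 (t : I3 -> I3 -> K) : (forall b c, t b c = 0) -> cubic_comb g t = 0.
Proof.
by move=> t0; rewrite /cubic_comb big1 // => b _; rewrite big1 // => c _; rewrite t0 mpolyC0 scale0r.
Qed.

(** Constant rows of F_2 and pairs [q] are two systems of coordinates on the same linear syzygies:
    the rows through their boundaries, since F_2 sits in degree 3, and the pairs through [tens].
    [Psi] is the change of coordinates. *)
Lemma syzygy_matrix : exists Psi : 'M[K]_(d * e + e * d, rk F 2), exists Phi,
  [/\ forall q, crow (n * n) (swap_vec q *m Psi) *m bdry F 1 = cubic_comb g (tens q),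
      Psi *m Phi = 1%:M & Phi *m Psi = 1%:M].
Proof.
have ex0 (i : 'I_(d * e + e * d)) : exists u : 'rV[K]_(rk F 2),
    crow (n * n) u *m bdry F 1 = cubic_comb g (tens (vec_swap (delta_mx 0 i))).
  set t := tens _; have ct : cubic_syz t by apply: (tens_cubic Mr Ms).
  have /(gen_map_eq0 charK) [w hw] := proj2 (gen_map_cubic_eq0 charK gP (proj1 ct)) ct.
  have hh : row_homog (sh 1%N) 3 (w *m bdry F 1) by rewrite -hw; apply: row_homog_cubic_comb.
  have [w' hw' e'] := homog_lift hh; exists (const_coef w').
  by rewrite (proj1 (row_homog_crow _ (shift2 charK gP)) hw') e' hw.
have [psi psiP] := fin_all_exists ex0.
pose Psi := \matrix_i psi i.
have PsiP (v : 'rV[K]_(d * e + e * d)) :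
    crow (n * n) (v *m Psi) *m bdry F 1 = cubic_comb g (tens (vec_swap v)).
  rewrite (row_sum_delta v); elim/big_rec: _ => [|i y _ IH].
    rewrite mul0mx crow0 mul0mx cubic_comb0 // => b c.
    by rewrite vec_swap0 /tens !mulmx0 !mul0mx !mxE addr0.
  rewrite mulmxDl -scalemxAl -rowE rowK crow_lin mulmxDl -scalemxAl IH psiP.
  rewrite -cubic_comb_lin; apply: eq_cubic_comb => a' c'.
  by rewrite vec_swap_lin tens_lin.
have inj (v : 'rV[K]_(d * e + e * d)) : v *m Psi = 0 -> v = 0.
  move=> e0; have := PsiP v; rewrite e0 crow0 mul0mx => /esym h.
  have /(tens_eq0 charK Mr Ms) e1 := cubic_comb_inj charK gP (proj1 (tens_cubic Mr Ms _)) h.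
  by rewrite -[v]vec_swapK e1 swap_vec0.
have surj (j : 'I_(rk F 2)) : exists v : 'rV[K]_(d * e + e * d), v *m Psi = delta_mx 0 j.
  pose u : 'rV[S]_(rk F 2) := crow _ (delta_mx 0 j).
  have hu : row_homog (sh 2%N) 3 u by apply/(row_homog_crow _ (shift2 charK gP)); rewrite crowK.
  have [t st tE] := cubic_comb_surj charK gP (bdry_homog hu).
  have ct : cubic_syz t.
    by apply/(gen_map_cubic_eq0 charK gP st); rewrite -tE; apply/(gen_map_eq0 charK); exists u.
  have [q qE] := tens_surj charK Mr Ms ct.
  exists (swap_vec q); apply: bdry1_inj; rewrite PsiP swap_vecK -/u tE.
  exact: eq_cubic_comb.
have [phi phiP] := fin_all_exists surj.
pose Phi := \matrix_j phi j.
have PhiPsi : Phi *m Psi = 1%:M.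
  by apply/row_matrixP => j; rewrite row_mul rowK phiP row1.
exists Psi, Phi; split=> //.
  by move=> q; rewrite PsiP swap_vecK.
apply/row_matrixP => i; apply/eqP; rewrite -subr_eq0 -raddfB /=; apply/eqP; apply: inj.
by rewrite -row_mul mulmxBl -mulmxA PhiPsi mulmx1 mul1mx subrr row0.
Qed.

Variables (M : 'M[S]_n) (T : forall i, 'rV[S]_(rk F i) -> 'rV[S]_(rk F i)).
Hypothesis TP : lifts_subst M T.
Variables (Psi : 'M[K]_(d * e + e * d, rk F 2)) (Phi : 'M[K]_(rk F 2, d * e + e * d)).
Hypothesis PsiE : forall q, crow (n * n) (swap_vec q *m Psi) *m bdry F 1 = cubic_comb g (tens q).
Hypothesis PsiK : Psi *m Phi = 1%:M.
Hypothesis PhiK : Phi *m Psi = 1%:M.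
Local Notation theta := (mxsubst M).

Lemma syzygy_equivariant q q' :
  T (cubic_comb g (tens q)) = cubic_comb g (tens q') ->
  T (crow (n * n) (swap_vec q *m Psi)) = crow (n * n) (swap_vec q' *m Psi).
Proof.
move=> h; rewrite (lift_crow TP _ (shift2 charK gP)); congr crow; apply: bdry1_inj.
by rewrite -(lift_crow TP _ (shift2 charK gP)) -(lift_bdry TP) !PsiE.
Qed.

Lemma cst_mul_inv r r' (A : 'M[K]_(r, r')) (B : 'M[K]_(r', r)) :
  A *m B = 1%:M -> cstmx (n * n) A *m cstmx (n * n) B = 1%:M.
Proof. by move=> h; rewrite /cstmx -map_mxM h map_mx1. Qed.

(** Both sides are semilinear over [theta], so equivariance on constant pairs propagates to the free
    module. *)
Lemma syzygy_free_equivariant (act : swapmod S d e -> swapmod S d e)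
    (act0 : swapmod K d e -> swapmod K d e) :
  (forall s p q, act (s *: p + q) = theta s *: act p + act q) ->
  (forall q, act (swap_cst _ q) = swap_cst _ (act0 q)) ->
  (forall q, T (cubic_comb g (tens q)) = cubic_comb g (tens (act0 q))) ->
  forall u, vec_swap (T u *m cstmx _ Phi) = act (vec_swap (u *m cstmx _ Phi)).
Proof.
move=> actl actc h.
have key : forall q, T (swap_vec q *m cstmx _ Psi) = swap_vec (act q) *m cstmx _ Psi.
  apply: (@semilinear_ext K (n * n) d e theta _ (fun q => T (swap_vec q *m cstmx _ Psi))
     (fun q => swap_vec (act q) *m cstmx _ Psi)).
  - by move=> s p q; rewrite swap_vec_lin mulmxDl -scalemxAl (lift_semilinear TP).
  - by move=> s p q; rewrite actl swap_vec_lin mulmxDl -scalemxAl.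
  - by rewrite -mpolyC1 mxsubstC.
  move=> q; rewrite actc !swap_vec_cst /cstmx -!map_mxM.
  by rewrite -![map_mx _ (_ *m _)]/(crow _ _); apply: syzygy_equivariant.
move=> u; rewrite -[in LHS](mulmx1 u) -(cst_mul_inv PhiK) mulmxA -[u *m _](vec_swapK).
by rewrite key -mulmxA (cst_mul_inv PsiK) mulmx1 !swap_vecK.
Qed.

End SecondSyzygies.

(** * Irreducibility *)

Lemma cols_eq0 (R : nmodType) p q (m : 'M[R]_(p, q)) : (forall j, col j m = 0) -> m = 0.
Proof. by move=> h; apply/matrixP => i j; have := congr1 (fun c : 'cV_p => c i 0) (h j); rewrite !mxE. Qed.

Lemma mul_col (R : pzRingType) p q r (A : 'M[R]_(p, q)) (B : 'M[R]_(q, r)) j :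
  A *m col j B = col j (A *m B).
Proof. by rewrite !colE mulmxA. Qed.

Section Irreducible.

Variables (K : fieldType) (charK : [pchar K] =i pred0) (n : nat) (i0 : 'I_n).
Local Notation I3 := ('I_n * 'I_n * 'I_n)%type.
Local Notation a0 := ((i0, i0, i0) : I3).

Definition torus_elt (k : nat) : 'M[K]_n := diag_mx (\row_i if i == i0 then k.+1%:R else 1).

Lemma torus_elt_unit k : torus_elt k \in unitmx.
Proof.
rewrite unitmxE unitfE det_diag; apply/prodf_neq0 => i _; rewrite mxE.
by case: ifP => _; [apply: natf_neq0_char0 | exact: oner_neq0].
Qed.

Definition third_diff (V : lmodType K) (f : 'M[K]_n -> V) : V :=
  6%:R^-1 *: (f (torus_elt 3) - 3%:R *: f (torus_elt 2) + 3%:R *: f (torus_elt 1) - f (torus_elt 0)).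

(* The third finite difference of k ^ m at k = 1 is 6 for m = 3, and 0 for m < 3. *)
Lemma third_diff_model cond d rho (E : I3 -> 'rV[K]_d) D a : is_model cond rho E D ->
  E a *m third_diff rho = (a == a0)%:R *: E a.
Proof.
move=> [_ actE _ _].
have step k : E a *m rho (torus_elt k) = ((if a.1.1 == i0 then k.+1%:R else 1) *
    (if a.1.2 == i0 then k.+1%:R else 1) * (if a.2 == i0 then k.+1%:R else 1)) *: E a.
  rewrite actE ?torus_elt_unit // (bigD1 a) //= big1 ?addr0.
    by congr (_ *: _); rewrite /act3 !mxE !eqxx !mulr1n.
  move=> b; case: a b => -[a1 a2] a3 [[b1 b2] b3] ne; rewrite /act3 /= !mxE.
  move: ne; rewrite !xpair_eqE ![_ == a1]eq_sym ![_ == a2]eq_sym ![_ == a3]eq_sym !negb_and.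
  by case/orP => [/orP []|] /negbTE ->; rewrite !(mulr0n, mulr0, mul0r) scale0r.
rewrite /third_diff -scalemxAr mulmxBr mulmxDr mulmxBr -!scalemxAr !step !scalerA.
rewrite -!scalerBl -scalerDl -scalerBl scalerA; congr (_ *: _).
have n6 : (6%:R : K) != 0 by apply: natf_neq0_char0.
apply: (mulfI n6); rewrite mulrA mulfV // mul1r.
case: a {step} => -[a1 a2] a3; rewrite !xpair_eqE /=.
by do 3 case: (_ == i0); rewrite /=; ring.
Qed.

Variables (d e : nat) (rho : 'M[K]_n -> 'M[K]_d) (sigma : 'M[K]_n -> 'M[K]_e).
Variables (Er : I3 -> 'rV[K]_d) (Dr : I3 -> 'cV[K]_d) (Es : I3 -> 'rV[K]_e) (Ds : I3 -> 'cV[K]_e).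
Hypothesis Mr : is_model (@sym3 K n) rho Er Dr.
Hypothesis Ms : is_model (@mix3 K n) sigma Es Ds.
Hypothesis rho_rep : is_gl_rep rho.
Hypothesis sigma_rep : is_gl_rep sigma.
Hypothesis rho_irr : gl_irreducible rho.
Hypothesis sigma_irr : gl_irreducible sigma.

Lemma third_diff_mul p q (f : 'M[K]_n -> 'M[K]_p) (x : 'M[K]_(p, q)) :
  third_diff f *m x = third_diff (fun h => f h *m x).
Proof. by rewrite /third_diff -scalemxAl mulmxBl mulmxDl mulmxBl -!scalemxAl. Qed.

Lemma separating_cols cond d' rho' (E : I3 -> 'rV[K]_d') D p (m m' : 'M[K]_(d', p)) :
  is_model cond rho' E D -> (forall a, E a *m m = E a *m m') -> m = m'.
Proof.
move=> [_ _ _ sep] h; apply/eqP; rewrite -subr_eq0; apply/eqP/cols_eq0 => j.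
apply: sep => a; rewrite mul_col.
by rewrite mulmxBr h subrr col0 mxE.
Qed.

(** Only the coordinate at [(i0, i0, i0)] could survive the difference, and a mixed tensor vanishes
    there, three times this entry being its rotation sum. *)
Lemma third_diff_mix : third_diff sigma = 0.
Proof.
apply: (separating_cols Ms) => a; rewrite (third_diff_model _ Ms) mulmx0.
case: eqP => [->|]; rewrite ?scale0r // scale1r; apply/rowP => j.
have EsE : (Es a0 *m (delta_mx j 0 : 'cV[K]_e)) 0 0 = Es a0 0 j by rewrite -colE mxE.
have [condE _ _ _] := Ms; have [_ /(_ i0 i0 i0) /=] := condE (delta_mx j 0).
rewrite EsE => h; have n3 : (3%:R : K) != 0 by apply: natf_neq0_char0.
by apply: (mulfI n3); rewrite mxE [RHS]mulr0 -[RHS]h; ring.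
Qed.

Lemma highest_functional_nondeg (u : 'cV[K]_d) :
  (forall A, A \in unitmx -> Er a0 *m rho A *m u = 0) -> u = 0.
Proof.
have [rho1 rhoM _] := rho_rep.
move=> h; apply/eqP; apply: contraT => nz.
have all0 : forall x : 'cV[K]_d, forall A, A \in unitmx -> Er a0 *m rho A *m x = 0.
  apply: (gl_irreducible_pred (Q := fun x => forall A, A \in unitmx -> Er a0 *m rho A *m x = 0) rho_irr).
  - by move=> A _; rewrite mulmx0.
  - by move=> c x y hx hy A hA; rewrite mulmxDr -scalemxAr hx // hy // scaler0 addr0.
  - by move=> B x hB hx A hA; rewrite mulmxA -[Er a0 *m _ *m _]mulmxA -rhoM // hx // unitmx_mul hA.
  - by exists u.
have [_ _ repr _] := Mr.
(* The constant tensor 1 is symmetric, which shows that the coordinate functional at [a0] is not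
   zero. *)
have := repr (fun=> 1) (conj (fun _ _ _ => erefl) (fun _ _ _ => erefl)) a0.
rewrite big1 => [/eqP|b _]; first by rewrite eq_sym oner_eq0.
by have := all0 (Dr b) 1%:M (unitmx1 _ _); rewrite rho1 mulmx1 => ->; rewrite mxE mulr0.
Qed.

Lemma swap_irreducible : gdet_irreducible (swap_action rho sigma).
Proof.
have [rho1 rhoM _] := rho_rep; have [sigma1 sigmaM _] := sigma_rep.
have [d_gt0 _] := rho_irr; have [e_gt0 _] := sigma_irr.
pose left (x : 'M[K]_(d, e)) : swapmod K d e := (x, 0).
have leftE c x y : left (c *: x + y) = c *: left x + left y.
  by apply/eqP; rewrite xpair_eqE /= scaler0 addr0 !eqxx.
split.
  apply/eqP => h; have := memvf ((const_mx 1, 0) : swapmod K d e); rewrite h memv0.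
  move=> /eqP [] /matrixP /(_ (Ordinal d_gt0) (Ordinal e_gt0)); rewrite !mxE => /eqP.
  by rewrite oner_eq0.
move=> P Pgl Pinv; have [->|nz] := eqVneq P 0%VS; [by left | right].
(* The involution exchanges the two blocks, so the first one may be assumed nonzero. *)
have [q qP q1] : exists2 q, q \in P & q.1 != 0.
  have := memv_pick P; have : vpick P != 0 by rewrite vpick0.
  case: (vpick P) => q1 q2 q_nz qP; have [q10|] := eqVneq q1 0; last by exists (q1, q2).
  exists (q2^T, q1^T); first exact: (Pinv _ qP).
  rewrite /= -(inj_eq trmx_inj) trmxK trmx0; apply: contraNneq q_nz => q20.
  by rewrite q10 q20.
have [A hA wnz] : exists2 A, A \in unitmx & Er a0 *m rho A *m q.1 != 0.
  apply: NNPP => h; case/eqP: q1; apply: cols_eq0 => j.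
  apply: highest_functional_nondeg => A hA; rewrite mul_col.
  apply/eqP; apply: contraT => nz'; case: h; exists A => //.
  by apply: contraNneq nz' => ->; rewrite col0.
set w := Er a0 *m rho A *m q.1 in wnz.
pose m := third_diff rho *m (rho A *m q.1).
have mP : (m, 0) \in P.
  pose q' := gl_act (swap_action rho sigma) A 1%:M q.
  have q'P : q' \in P by apply: Pgl; rewrite ?unitmx1.
  have Y k : gl_act (swap_action rho sigma) (torus_elt k) 1%:M q' \in P.
    by apply: Pgl; rewrite ?unitmx1 ?torus_elt_unit.
  have -> : (m, 0) = third_diff (fun g => gl_act (swap_action rho sigma) g 1%:M q').
    apply/eqP; rewrite /third_diff xpair_eqE /= sigma1 rho1 !trmx1 !mulmx1.
    apply/andP; split; apply/eqP; first exact: third_diff_mul.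
    (* The second block is acted on through [sigma] on the left, hence is killed by the third
       difference. *)
    rewrite -[LHS](mul0mx _ (sigma A *m q.2)) -third_diff_mix. exact: third_diff_mul.
  by rewrite /third_diff rpredZ // rpredB // rpredD ?rpredB ?rpredZ.
have mE a : Er a *m m = (a == a0)%:R *: w.
  rewrite /m mulmxA (third_diff_model _ Mr) -scalemxAl.
  by case: eqP => [->|_]; rewrite ?scale0r // !scale1r mulmxA.
have [j wj] : exists j, w 0 j != 0.
  apply/existsP; apply: contraNT wnz => /existsPn h; apply/eqP/rowP => j; rewrite [RHS]mxE.
  by have := h j; rewrite negbK => /eqP.
(* All coordinates of [m] except that at [a0] vanish, so [m] has rank one, with [v] the vector whose
   coordinate is 1 at [a0] and 0 elsewhere. *)
pose v := (w 0 j)^-1 *: col j m.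
have mvw : m = v *m w.
  apply: (separating_cols Mr) => a; rewrite [RHS]mulmxA.
  have -> : Er a *m v = (a == a0)%:R%:M.
    rewrite /v -scalemxAr mul_col mE; apply/matrixP => k l; rewrite !ord1 [LHS]mxE [col _ _ _ _]mxE.
    by rewrite [(_ *: w) _ _]mxE mulrCA mulVf // mulr1 mxE mulr1n.
  by rewrite mE mul_scalar_mx.
have v_nz : v != 0.
  apply: contraNneq wnz => v0.
  by have := mE a0; rewrite eqxx scale1r mvw v0 mul0mx mulmx0 => <-.
(* With one group component equal to the identity the two tensor factors move independently: first
   every [y] is reached beside [v], then every [x] beside every [y]. *)
have vall (y : 'cV[K]_e) : (v *m y^T, 0) \in P.
  apply: (gl_irreducible_pred (Q := fun y => (v *m y^T, 0) \in P) sigma_irr).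
  - by rewrite trmx0 mulmx0; apply: mem0v.
  - move=> c x x' hx hx'.
    by rewrite linearP /= mulmxDr -scalemxAr -/(left _) leftE rpredD ?rpredZ.
  - move=> B x hB hx; have := Pgl 1%:M B _ (unitmx1 _ _) hB hx.
    by rewrite /= rho1 sigma1 mul1mx mulmx0 mul0mx trmx_mul mulmxA.
  - by exists w^T; [rewrite trmxK -mvw | rewrite -(inj_eq trmx_inj) trmxK trmx0].
have xall (x : 'cV[K]_d) : forall y : 'cV[K]_e, (x *m y^T, 0) \in P.
  apply: (gl_irreducible_pred (Q := fun x => forall y : 'cV[K]_e, (x *m y^T, 0) \in P) rho_irr).
  - by move=> y; rewrite mul0mx; apply: mem0v.
  - move=> c z z' hz hz' y.
    rewrite mulmxDl -scalemxAl -/(left _) leftE.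
    by apply: rpredD; [apply: rpredZ; exact: hz | exact: hz'].
  - move=> B z hB hz y; have := Pgl B 1%:M _ hB (unitmx1 _ _) (hz y).
    by rewrite /= rho1 sigma1 trmx1 mulmx1 mulmx0 mul0mx mulmxA.
  - by exists v.
have left_all (p : 'M[K]_(d, e)) : left p \in P.
  have -> : p = \sum_k col k p *m (delta_mx k 0 : 'cV[K]_e)^T.
    apply/matrixP => i l; rewrite summxE (bigD1 l) //= big1 ?addr0 => [|k /negbTE ne].
      by rewrite mxE big_ord1 !mxE !eqxx mulr1.
    by rewrite mxE big_ord1 !mxE eq_sym ne mulr0.
  elim/big_rec: _ => [|k y _ IH]; first exact: mem0v.
  by rewrite -[_ *m _]scale1r leftE scale1r rpredD // xall.
apply/eqP; rewrite eqEsubv subvf; apply/subvP => -[p1 p2] _.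
have -> : (p1, p2) = (p1, 0) + invol (swap_action rho sigma) (p2^T, 0) :> swapmod K d e.
  by apply/eqP; rewrite xpair_eqE /= trmx0 trmxK addr0 add0r !eqxx.
by rewrite rpredD ?left_all // Pinv // left_all.
Qed.

End Irreducible.

(** * Semilinearity of the action over the polynomial ring *)

Section PolyAction.

Variables (K : fieldType) (n d e : nat) (rho : 'M[K]_n -> 'M[K]_d) (sigma : 'M[K]_n -> 'M[K]_e).
Local Notation S := (mxpolyring K n).

Lemma map_mxsubst_lin (M : 'M[S]_n) p q s (x y : 'M[S]_(p, q)) :
  map_mx (mxsubst M) (s *: x + y) = mxsubst M s *: map_mx (mxsubst M) x + map_mx (mxsubst M) y.
Proof. by apply/matrixP => i j; rewrite !mxE mxsubstD mxsubstM. Qed.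

Lemma map_mxsubst_cst (M : 'M[S]_n) p q (x : 'M[K]_(p, q)) :
  map_mx (mxsubst M) (cstmx _ x) = cstmx _ x.
Proof. by apply/matrixP => i j; rewrite !mxE mxsubstC. Qed.

Lemma swap_gl_lin A B s p q :
  gl_act (swap_action_poly rho sigma) A B (s *: p + q) =
  gl_act (poly_action K n) A B s *: gl_act (swap_action_poly rho sigma) A B p
  + gl_act (swap_action_poly rho sigma) A B q.
Proof.
apply/eqP; rewrite xpair_eqE /= !map_mxsubst_lin !mulmxDr !mulmxDl.
by rewrite -!scalemxAr -!scalemxAl !eqxx.
Qed.

Lemma swap_invol_lin s p q :
  invol (swap_action_poly rho sigma) (s *: p + q) =
  invol (poly_action K n) s *: invol (swap_action_poly rho sigma) p
  + invol (swap_action_poly rho sigma) q.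
Proof. by apply/eqP; rewrite xpair_eqE /= !map_mxsubst_lin !linearP !eqxx. Qed.

Lemma swap_gl_cst A B q :
  gl_act (swap_action_poly rho sigma) A B (swap_cst _ q) =
  swap_cst _ (gl_act (swap_action rho sigma) A B q).
Proof.
apply/eqP; rewrite xpair_eqE /= !map_mxsubst_cst /cstmx.
by rewrite !map_trmx -!map_mxM !eqxx.
Qed.

Lemma swap_invol_cst q :
  invol (swap_action_poly rho sigma) (swap_cst _ q) =
  swap_cst _ (invol (swap_action rho sigma) q).
Proof. by apply/eqP; rewrite xpair_eqE /= !map_mxsubst_cst /cstmx !map_trmx !eqxx. Qed.

End PolyAction.

Theorem proposition7p2 (K : fieldType) (charK : [pchar K] =i pred0)
    (n : nat) (n_gt0 : (0 < n)%N)
    (F : min_resolution K n) (a : forall i, gdet_action K n (resmod F i))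
    (aP : equivariant_structure a)
    (d e : nat) (rho : 'M[K]_n -> 'M[K]_d) (sigma : 'M[K]_n -> 'M[K]_e)
    (rhoP : is_V [:: 3%N] rho) (sigmaP : is_V [:: 2%N; 1%N] sigma) :
  (exists phi : resmod F 2%N -> swapmod (mxpolyring K n) d e,
     [/\ forall s u v, phi (s *: u + v) = s *: phi u + phi v,
         bijective phi,
         forall k u,
           swap_homog 3%N k (phi u) = row_homog (@shift _ _ F 2%N) k u
       & equivariant (a 2%N) (swap_action_poly rho sigma) phi])
  /\ (exists psi : swapmod K d e -> resmod F 2%N,
        [/\ forall c q q', psi (c *: q + q') = c%:MP *: psi q + psi q',
            injective psi,
            forall u,
              row_homog (@shift _ _ F 2%N) 3%N u <-> exists q, u = psi q
          & equivariant (swap_action rho sigma) (a 2%N) psi])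
  /\ ((1 < n)%N -> gdet_irreducible (swap_action rho sigma)).
Proof.
have [Er [Dr Mr]] := sym3_of_highest_weight charK n_gt0 rhoP.
have [Es [Ds Ms]] := mix3_of_highest_weight charK n_gt0 sigmaP.
have [g gP] := quad_gen_ex charK F.
have sh2 := shift2 charK gP.
have [Psi [Phi [PsiE PsiK PhiK]]] := syzygy_matrix charK gP Mr Ms.
have glT A B (hA : A \in unitmx) (hB : B \in unitmx) := gl_act_lifts aP hA hB.
have invT := invol_lifts aP.
have cub_gl A B q : A \in unitmx -> B \in unitmx ->
    gl_act (a 1%N) A B (cubic_comb g (tens Er Es q)) =
    cubic_comb g (tens Er Es (gl_act (swap_action rho sigma) A B q)).
  move=> hA hB; rewrite (lift_cubic_comb_gl charK (glT A B hA hB) gP _ erefl).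
  by apply: eq_cubic_comb => b c; rewrite (tens_act Mr Ms).
have cub_inv q : invol (a 1%N) (cubic_comb g (tens Er Es q)) =
    cubic_comb g (tens Er Es (invol (swap_action rho sigma) q)).
  rewrite (lift_cubic_comb_tr charK invT gP _ erefl).
  by apply: eq_cubic_comb => b c; rewrite tens_invol.
split; [|split].
(* The isomorphism is a constant matrix between free modules generated in degree 3, so it respects
   the grading. *)
- exists (fun u => vec_swap (u *m cstmx _ Phi)); split.
  + by move=> s u v; rewrite mulmxDl -scalemxAl vec_swap_lin.
  + exists (fun q => swap_vec q *m cstmx _ Psi).
      by move=> u; rewrite vec_swapK -mulmxA (cst_mul_inv _ PhiK) mulmx1.
    by move=> q; rewrite -mulmxA (cst_mul_inv _ PsiK) mulmx1 swap_vecK.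
  + move=> k u; rewrite swap_homog_vec vec_swapK; apply/idP/idP => h.
      rewrite -[u]mulmx1 -(cst_mul_inv _ PhiK) mulmxA.
      exact: (row_homog_mul_cst Psi _ sh2 h).
    exact: (row_homog_mul_cst Phi sh2 _ h).
  split=> [A B u hA hB|u].
    apply: (syzygy_free_equivariant charK gP (glT A B hA hB) PsiE PsiK PhiK
      (act0 := gl_act (swap_action rho sigma) A B)).
    * by move=> s p q; apply: swap_gl_lin.
    * by move=> q; apply: swap_gl_cst.
    * by move=> q; apply: cub_gl.
  apply: (syzygy_free_equivariant charK gP invT PsiE PsiK PhiK
      (act0 := invol (swap_action rho sigma))).
  * by move=> s p q; apply: swap_invol_lin.
  * by move=> q; apply: swap_invol_cst.
  * by move=> q; apply: cub_inv.
- exists (fun q => crow _ (swap_vec q *m Psi)); split.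
  + by move=> c q q'; rewrite swap_vec_lin mulmxDl -scalemxAl crow_lin.
  + move=> q q' /(can_inj (@crowK _ _ _)) h.
    by rewrite -[q]swap_vecK -[q']swap_vecK -[swap_vec q]mulmx1 -[swap_vec q']mulmx1 -PsiK !mulmxA h.
  + move=> u; rewrite (row_homog_crow _ sh2); split=> [<-|[q ->]]; last by rewrite crowK.
    exists (vec_swap (const_coef u *m Phi)).
    by rewrite vec_swapK -mulmxA PhiK mulmx1.
  split=> [A B q hA hB|q].
    by rewrite (syzygy_equivariant charK gP (glT A B hA hB) PsiE (cub_gl A B q hA hB)).
  by rewrite (syzygy_equivariant charK gP invT PsiE (cub_inv q)).
move=> n_gt1.
(* For [1 < n] both partitions have at most [n] parts, so both representations are genuine
   irreducible ones. *)
move: rhoP sigmaP; rewrite /is_V /= n_gt0 n_gt1 => -[rrep rirr _] [srep sirr _].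
exact: (swap_irreducible charK (Ordinal n_gt0) Mr Ms).
Qed.
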